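(* Let $q$ be a prime power, let $n,d$ be positive integers, let $\delta\in(0,1]$ be a distance parameter, and let $t\leq \frac{\delta}{100}q^{\frac{n}{100(d+q)}-1}$. Then there is a $t$-online-corruption-resilient tester for degree $d$ for functions $f:\mathbb{F}_q^n\to\mathbb{F}_q$ with query complexity $\frac{q^{O(1)}}{\delta}\,O\!\left((\log(t/\delta))^{3d+3q}\right)$, satisfying: (Completeness) if $f$ has degree at most $d$, the tester accepts with probability at least $2/3$; (Soundness) if $f$ is $\delta$-far from degree $d$, the tester rejects with probability at least $2/3$.
   Context: Every function $f:\mathbb{F}_q^n\to\mathbb{F}_q$ has a unique polynomial representation $f(x)=\sum_{e\in\{0,\dots,q-1\}^n} C_e x^e$ with $x^e=\prod_i x_i^{e_i}$; its degree is $\max\{|e|_1 : C_e\neq 0\}$. For $f,g$ on $\mathbb{F}_q^n$, $\delta(f,g)=\Pr_{x\in\mathbb{F}_q^n}[f(x)\neq g(x)]$, and $f$ is $\delta$-far from degree $d$ if $\min_{g:\deg g\le d}\delta(f,g)\geq\delta$. The $t$-online-corruption model: a (randomized, adaptive) tester has query access to $f$; the tester queries points one at a time, and after each query an adversary (who may know all queries so far) may change the values of any $t$ entries of the truth table of $f$. A query returns the current (possibly modified) value at that point, with no indication of whether it was modified. A tester is $t$-online-corruption-resilient if its completeness and soundness guarantees hold against every such adversary, where ''$f$ has degree at most $d$'' / ''$f$ is $\delta$-far'' refer to the original input function.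
   Formalization: In the query bound, log(t/δ) is replaced by max(2, ln(t/δ)), since for t = 0 or small t/δ the logarithm is undefined or too small for the stated bound to hold; the hidden constants are universal. *)

(* Defs.v *)
From Stdlib Require Import Reals.
From mathcomp Require Import all_boot all_order all_algebra.
Set Implicit Arguments. Unset Strict Implicit. Unset Printing Implicit Defensive.
Import GRing.Theory.
Delimit Scope R_scope with Re.

Section Defs.
Variables (F : finFieldType) (n : nat).
Local Notation X := 'rV[F]_n.

Definition expvec := {ffun 'I_n -> 'I_#|F|}.

Definition monomial (e : expvec) (x : X) : F :=
  (\prod_(i < n) (x ord0 i) ^+ (e i))%R.

Definition expdeg (e : expvec) : nat := \sum_(i < n) (e i : nat).

(* f has degree at most d: its (unique) representation
   f(x) = sum_e C_e x^e (e in {0..q-1}^n) has C_e = 0 whenever |e|_1 > d. *)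
Definition deg_le (d : nat) (f : X -> F) : Prop :=
  exists C : expvec -> F,
    (forall e, d < expdeg e -> C e = 0%R) /\
    (forall x, f x = (\sum_(e : expvec) C e * monomial e x)%R).

(* number of disagreements of f and g (delta(f,g) = ndiff f g / q^n) *)
Definition ndiff (f g : X -> F) : nat := #|[set x | f x != g x]|.

Definition far (delta : R) (d : nat) (f : X -> F) : Prop :=
  forall g, deg_le d g ->
    (delta * INR (#|F| ^ n) <= INR (ndiff f g))%Re.

(* A deterministic adaptive adversary in the t-online-corruption model:
   after each query, given the sequence of all queries so far and the current
   truth table, it outputs a new truth table differing in at most t entries. *)
Definition adversary := seq X -> (X -> F) -> (X -> F).
Definition t_adversary (t : nat) (adv : adversary) : Prop :=
  forall qs g, ndiff (adv qs g) g <= t.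

(* Execution of a randomized adaptive tester with seed s:
   query s as = next query point given the answers as received so far.
   State: (queries so far, answers so far, current truth table). *)
Fixpoint run (S : Type) (query : S -> seq F -> X) (adv : adversary)
    (f : X -> F) (s : S) (k : nat) : seq X * seq F * (X -> F) :=
  match k with
  | 0 => ([::], [::], f)
  | k'.+1 =>
      let '(qs, ans, g) := run query adv f s k' in
      let x := query s ans in
      let qs' := rcons qs x in
      (qs', rcons ans (g x), adv qs' g)
  end.

Definition accepts (S : Type) (query : S -> seq F -> X)
    (decide : S -> seq F -> bool) (Q : nat) (adv : adversary)
    (f : X -> F) (s : S) : bool :=
  decide s (run query adv f s Q).1.2.

End Defs.

Definition acc_prob (F : finFieldType) (n : nat) (S : finType)
    (query : S -> seq F -> 'rV[F]_n) (decide : S -> seq F -> bool) (Q : nat)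
    (adv : adversary F n) (f : 'rV[F]_n -> F) : R :=
  (INR #|[set s | accepts query decide Q adv f s]| / INR #|S|)%Re.

(* Main.v *)
(** The tester picks a random affine injection [phi : F^k -> F^n] with [k] of order
    [d + log (t / delta)], queries [f] at the images of independent uniform points of
    [F^k], and accepts iff some polynomial of degree at most [d] on [F^k] agrees with the
    answers up to a number of errors which is prescribed on several prefixes of the
    query sequence.

    Corruptions.  After [l] queries at most [t l] of the [q^k] candidate points are
    corrupted, and the next query is uniform, so about [t j^2 / q^k] of the first [j]
    answers are wrong: short prefixes are much cleaner than long ones.

    Soundness on [F^k].  If [f o phi] is [eta]-far from degree [d], the union bound over
    the polynomials at distance about [q^-i] is run on a prefix of length [j_i].  Such
    polynomials are few: a polynomial [g] of weight below [q^-i / 16] is the pointwise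
    majority of [k q] random iterated line sums [x |-> sum_a g (x + a_1 y_1 + .. + a_i y_i)],
    which have degree at most [d - i (q - 1)].  This keeps [j_i] below [8^d] even when
    [t / delta] is bounded.

    Soundness of the restriction.  [phi] is a composition of random hyperplane charts.
    If [f] is close to degree [d] on many hyperplanes, then [d + 1] of them are
    independent, the polynomials found there agree on intersections, glue to one
    polynomial [P] of degree [d] on the whole space, and [P] fits all other good
    hyperplanes; a second moment argument on [{f <> P}] then shows that [f] is close to [P]. *)

Require Import Defs.
From Stdlib Require Import Reals Lra.
From Stdlib Require Znat.
From mathcomp Require Import all_boot all_order all_algebra finfield.
From mathcomp Require Import zify ring lra.
Set Implicit Arguments. Unset Strict Implicit. Unset Printing Implicit Defensive.
Import Order.TTheory GRing.Theory Num.Theory.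

(** * Functions of bounded degree *)

(** Let [N_i] be the number of monomials of degree at most [d - i (q - 1)] on [F^k]. Up to factors
    polynomial in [k], [d] and [q], eliminating the polynomials at distance about [q^-i] takes
    [j_i = q^i N_i] samples and leaves room for [N_i] errors. By Markov, the corruptions stay within
    that room once [t j_i^2 / q^k <= N_i], that is [t q^(2 i) N_i <= q^k]. So [k] must be large
    enough for the weight [q^(2 i)], yet small enough that [q^i N_i] remains below [8^d], which is
    all that the exponent [3 d + 3 q] provides when the logarithm is replaced by 2. Both weighted
    counts are estimated by the generating function of the monomials at a suitable point [z]; the
    window for [k] is narrow when [q = 2].

    If [t = 0], only the restriction argument asks for a large [k], and it is void when [n] is
    small, because then no restriction is made.

    Probabilities are counts over finite seed sets, compared in [nat] and [rat]; [delta] enters only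
    through an integer [m] with [1 <= delta m <= 2]. *)

Section Degree.
Variable F : finFieldType.
Local Open Scope ring_scope.
Local Notation q := #|F|.

Lemma card_field_gt1 : (1 < q)%N.
Proof. exact: card_finNzRing_gt1. Qed.

Lemma deg_le_ext n d (f g : 'rV[F]_n -> F) : f =1 g -> deg_le d f -> deg_le d g.
Proof. by move=> fg [C [C0 CE]]; exists C; split=> // x; rewrite -fg. Qed.

Lemma deg_leW n d d' (f : 'rV[F]_n -> F) : (d <= d')%N -> deg_le d f -> deg_le d' f.
Proof.
by move=> dd' [C [C0 CE]]; exists C; split=> // e ?; apply: C0; apply: leq_ltn_trans dd' _.
Qed.

Lemma deg_le_sum n d (I : Type) (r : seq I) (P : pred I) (f : I -> 'rV[F]_n -> F) :
  (forall i, P i -> deg_le d (f i)) -> deg_le d (fun x => \sum_(i <- r | P i) f i x).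
Proof.
move=> fd; elim: r => [|i r [C [C0 CE]]].
  exists (fun=> 0); split=> // x; rewrite big_nil big1 // => e _; exact: mul0r.
case Pi: (P i); last by exists C; split=> // x; rewrite big_cons Pi.
have [C' [C'0 C'E]] := fd i Pi.
exists (fun e => C' e + C e); split=> [e de|x]; first by rewrite C0 // C'0 // addr0.
rewrite big_cons Pi C'E CE -big_split /=.
by apply: eq_bigr => e _; rewrite mulrDl.
Qed.

Lemma deg_leZ n d c (f : 'rV[F]_n -> F) : deg_le d f -> deg_le d (fun x => c * f x).
Proof.
move=> [C [C0 CE]]; exists (fun e => c * C e); split=> [e de|x]; first by rewrite C0 // mulr0.
by rewrite CE big_distrr /=; apply: eq_bigr => e _; rewrite mulrA.
Qed.

Lemma deg_leD n d (f g : 'rV[F]_n -> F) :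
  deg_le d f -> deg_le d g -> deg_le d (fun x => f x + g x).
Proof.
move=> df dg.
have := @deg_le_sum n d bool [:: true; false] xpredT (fun b => if b then f else g).
case=> [[]//|C [C0 CE]]; exists C; split=> // x.
by rewrite -CE !big_cons big_nil addr0.
Qed.

Lemma deg_leB n d (f g : 'rV[F]_n -> F) :
  deg_le d f -> deg_le d g -> deg_le d (fun x => f x - g x).
Proof.
move=> df dg; apply: deg_leD => //.
by apply: deg_le_ext (deg_leZ (-1) dg) => x; rewrite mulN1r.
Qed.

Lemma deg_le_monomial n (e : expvec F n) : deg_le (expdeg e) (monomial e).
Proof.
exists (fun e' => (e' == e)%:R); split=> [e'|x].
  by case: eqP => // ->; rewrite ltnn.
rewrite (bigD1 e) //= eqxx mul1r big1 ?addr0 // => e' /negPf ->; exact: mul0r.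
Qed.

Lemma deg_le_const n d c : deg_le d (fun _ : 'rV[F]_n => c).
Proof.
have o : (0 < q)%N by apply: ltnW card_field_gt1.
pose e : expvec F n := [ffun=> Ordinal o].
have e0 : expdeg e = 0%N by apply: big1 => i _; rewrite ffunE.
have H : deg_le d (monomial e) by apply: deg_leW (deg_le_monomial e); rewrite e0.
apply: deg_le_ext (deg_leZ c H) => x.
by rewrite /monomial big1 ?mulr1 // => i _; rewrite ffunE.
Qed.

Lemma deg_le_coord n (i : 'I_n) : deg_le 1 (fun x : 'rV[F]_n => x ord0 i).
Proof.
have o : (0 < q)%N by apply: ltnW card_field_gt1.
pose e : expvec F n := [ffun j => if j == i then Ordinal card_field_gt1 else Ordinal o].
have e1 : expdeg e = 1%N.
  rewrite /expdeg (bigD1 i) //= ffunE eqxx big1 // => j /negPf ji; by rewrite ffunE ji.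
have H := deg_le_monomial e; rewrite e1 in H.
apply: deg_le_ext H => x.
rewrite /monomial (bigD1 i) //= ffunE eqxx expr1 big1 ?mulr1 // => j /negPf ji.
by rewrite ffunE ji.
Qed.

(** One subtraction is enough for a sum of two exponents below [q]. What remains is positive, so the
    power is unchanged at 0 too. *)
Definition red_exp (m : nat) : nat := if (m < q)%N then m else (m - q.-1)%N.

Lemma red_expE (x : F) m : x ^+ red_exp m = x ^+ m.
Proof.
rewrite /red_exp; case: ltnP => // qm.
have q1 := card_field_gt1.
have -> : m = (m - q + q)%N by rewrite subnK.
rewrite exprD expf_card -exprSr; congr (_ ^+ _); lia.
Qed.

(** A product of two monomials becomes a reduced monomial through [x^q = x], and this reduction can
    only lower the degree. *)
Lemma deg_leM n d d' (f g : 'rV[F]_n -> F) :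
  deg_le d f -> deg_le d' g -> deg_le (d + d') (fun x => f x * g x).
Proof.
move=> [C [C0 CE]] [C' [C'0 C'E]].
have H e e' : deg_le (d + d') (fun x : 'rV[F]_n => C e * C' e' * (monomial e x * monomial e' x)).
  case: (leqP (expdeg e) d) => [ed|/C0 ->]; last first.
    by apply: deg_le_ext (deg_le_const n _ 0) => x; rewrite !mul0r.
  case: (leqP (expdeg e') d') => [ed'|/C'0 ->]; last first.
    by apply: deg_le_ext (deg_le_const n _ 0) => x; rewrite mulr0 mul0r.
  apply: deg_leZ.
  have lt i : (red_exp (e i + e' i) < q)%N.
    have l1 := ltn_ord (e i); have l2 := ltn_ord (e' i); have q1 := card_field_gt1.
    by rewrite /red_exp; case: (ltnP (e i + e' i) q) => // l3; lia.
  pose e2 : expvec F n := [ffun i => Ordinal (lt i)].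
  have e2d : (expdeg e2 <= d + d')%N.
    apply: leq_trans (leq_add ed ed'); rewrite /expdeg -big_split /=.
    by apply: leq_sum => i _; rewrite ffunE /= /red_exp; case: (ltnP (e i + e' i) q); lia.
  apply: deg_le_ext (deg_leW e2d (deg_le_monomial e2)) => x.
  rewrite /monomial -big_split /=; apply: eq_bigr => i _.
  by rewrite ffunE /= red_expE exprD.
apply: (@deg_le_ext _ _ (fun x => \sum_e \sum_e' C e * C' e' * (monomial e x * monomial e' x))).
  move=> x; rewrite CE C'E big_distrl /=; apply: eq_bigr => e _.
  by rewrite big_distrr /=; apply: eq_bigr => e' _; rewrite mulrACA.
by apply: deg_le_sum => e _; apply: deg_le_sum.
Qed.

Lemma deg_leX n d m (f : 'rV[F]_n -> F) :
  deg_le d f -> deg_le (m * d) (fun x => f x ^+ m).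
Proof.
move=> df; elim: m => [|m IH]; first exact: deg_le_const.
by rewrite mulSn; apply: deg_le_ext (deg_leM df IH) => x; rewrite exprS.
Qed.

Lemma deg_le_prod n (I : Type) (r : seq I) (a : I -> nat) (f : I -> 'rV[F]_n -> F) :
  (forall i, deg_le (a i) (f i)) ->
  deg_le (\sum_(i <- r) a i) (fun x => \prod_(i <- r) f i x).
Proof.
move=> fd; elim: r => [|i r IH].
  by apply: deg_le_ext (deg_le_const n _ 1) => x; rewrite big_nil.
by rewrite big_cons; apply: deg_le_ext (deg_leM (fd i) IH) => x; rewrite big_cons.
Qed.

Definition affine_map k n (phi : 'rV[F]_k -> 'rV[F]_n) : Prop :=
  forall i, deg_le 1 (fun u => phi u ord0 i).

Lemma deg_le_comp k n d (phi : 'rV[F]_k -> 'rV[F]_n) f :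
  affine_map phi -> deg_le d f -> deg_le d (fun u => f (phi u)).
Proof.
move=> aphi [C [C0 CE]].
apply: (@deg_le_ext _ _ (fun u => \sum_e C e * monomial e (phi u))) => [u|]; first by rewrite CE.
apply: deg_le_sum => e _.
case: (leqP (expdeg e) d) => [ed|/C0 ->]; last first.
  by apply: deg_le_ext (deg_le_const k _ 0) => x; rewrite mul0r.
apply: deg_leZ; apply: deg_leW ed _; apply: deg_le_prod => i.
by have := deg_leX (e i) (aphi i); rewrite muln1.
Qed.

Lemma affine_map_comp k l n (phi : 'rV[F]_k -> 'rV[F]_l) (psi : 'rV[F]_l -> 'rV[F]_n) :
  affine_map phi -> affine_map psi -> affine_map (fun u => psi (phi u)).
Proof. by move=> aphi apsi i; apply: (deg_le_comp aphi (apsi i)). Qed.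

Lemma affine_map_id k : affine_map (fun u : 'rV[F]_k => u).
Proof. exact: deg_le_coord. Qed.

Definition dotp n (w x : 'rV[F]_n) : F := \sum_i w ord0 i * x ord0 i.

Lemma deg_le_dotp n (w : 'rV[F]_n) : deg_le 1 (dotp w).
Proof. by apply: deg_le_sum => i _; apply/deg_leZ/deg_le_coord. Qed.

(* [(a, x) |-> f (x + a y)] has degree [d] on [F^(n+1)]; its monomials are grouped by the
   exponent of [a], which is therefore already reduced below [q]. *)
Lemma taylor n d (f : 'rV[F]_n -> F) (y : 'rV[F]_n) : deg_le d f ->
  exists c : 'I_q -> 'rV[F]_n -> F,
  [/\ forall j : 'I_q, (j <= d)%N -> deg_le (d - j) (c j),
      forall j : 'I_q, (d < j)%N -> forall x, c j x = 0 &
      forall x a, f (x + a *: y) = \sum_(j < q) a ^+ j * c j x].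
Proof.
move=> df.
pose phi (u : 'rV[F]_n.+1) : 'rV[F]_n :=
  \row_i (u ord0 (lift ord0 i) + u ord0 ord0 * y ord0 i).
have aphi : affine_map phi.
  move=> i; apply: (@deg_le_ext _ _ (fun u => u ord0 (lift ord0 i) + y ord0 i * u ord0 ord0)).
    by move=> u; rewrite mxE [y _ _ * _]mulrC.
  by apply: deg_leD (deg_le_coord _) (deg_leZ _ (deg_le_coord _)).
have [C [C0 CE]] := deg_le_comp aphi df.
pose m (e : expvec F n.+1) (x : 'rV[F]_n) : F := \prod_i x ord0 i ^+ e (lift ord0 i).
have mdeg (e : expvec F n.+1) : deg_le (\sum_i (e (lift ord0 i) : nat)) (m e).
  apply: deg_le_prod => i.
  by have := deg_leX (e (lift ord0 i)) (deg_le_coord i); rewrite muln1.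
have degS (e : expvec F n.+1) :
    expdeg e = (e ord0 + \sum_i (e (lift ord0 i) : nat))%N by rewrite /expdeg big_ord_recl.
exists (fun j x => \sum_(e : expvec F n.+1 | e ord0 == j) C e * m e x); split.
- move=> j jd; apply: deg_le_sum => e /eqP ej.
  case: (leqP (expdeg e) d) => [ed|/C0 ->]; last first.
    by apply: deg_le_ext (deg_le_const n _ 0) => x; rewrite mul0r.
  apply: deg_leZ; apply: deg_leW (mdeg e).
  by rewrite leq_subRL // -ej -degS.
- move=> j jd x; apply: big1 => e /eqP ej; rewrite C0 ?mul0r //.
  by rewrite degS ej; apply: leq_trans jd (leq_addr _ _).
move=> x a.
pose u : 'rV[F]_n.+1 := \row_i oapp (x ord0) a (unlift ord0 i).
have -> : x + a *: y = phi u by apply/rowP => i; rewrite !mxE liftK unlift_none.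
rewrite CE (partition_big (fun e : expvec F n.+1 => e ord0) xpredT) //=.
apply: eq_bigr => j _; rewrite big_distrr /=; apply: eq_bigr => e /eqP ej.
rewrite /monomial big_ord_recl mxE unlift_none /= ej mulrCA; congr (_ * (_ * _)).
by apply: eq_bigr => i _; rewrite mxE liftK.
Qed.

(** For [j > 0], [X^j - 1] has fewer than [q - 1] roots, so some nonzero [b] has [b^j] different
    from 1, and substituting [b a] for [a] multiplies the sum by [b^j]. For [j = 0], translating the
    sum of all [a] by 1 shows that the ones add up to 0. *)
Lemma sum_pow_eq0 j : (j < q.-1)%N -> \sum_(a : F) a ^+ j = 0.
Proof.
move=> jq.
have [b b0 bj] : exists2 b : F, b != 0 & (b ^+ j != 1) || (j == 0)%N.
  case: (posnP j) => [->|j0]; first by exists 1; rewrite ?oner_eq0 ?orbT.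
  pose p : {poly F} := 'X^j - 1.
  have sp : size p = j.+1 by rewrite size_XnsubC.
  have p0 : p != 0 by rewrite -size_poly_eq0 sp.
  have [/existsP[b /andP[b0 bj]]|/existsPn H] := boolP [exists b : F, (b != 0) && (b ^+ j != 1)].
    by exists b; rewrite ?bj.
  have := @max_poly_roots _ p (enum [set~ (0 : F)]) p0.
  rewrite -cardE cardsC1 sp enum_uniq => /(_ _ isT).
  suff -> : all (root p) (enum [set~ (0 : F)]) by move=> /(_ isT); rewrite ltnS leqNgt jq.
  apply/allP => b; rewrite mem_enum !inE => b0.
  have := H b; rewrite b0 /= negbK => /eqP bj.
  by rewrite /root !hornerE bj subrr.
case/orP: bj => [bj|/eqP ->]; last first.
  under eq_bigr do rewrite expr0.
  have : \sum_(a : F) a = \sum_(a : F) (1 + a) by apply: (reindex_inj (addrI (1 : F))).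
  by rewrite big_split /= => /eqP; rewrite -subr_eq0 opprD addrCA subrr addr0 oppr_eq0 => /eqP.
apply/eqP; have : (b ^+ j - 1) * \sum_(a : F) a ^+ j == 0.
  rewrite mulrBl mul1r subr_eq0 big_distrr /=; apply/eqP.
  rewrite [RHS](reindex_inj (mulfI b0)) /=.
  by apply: eq_bigr => a _; rewrite exprMn.
by rewrite mulf_eq0 subr_eq0 (negPf bj).
Qed.

Definition lsum n (y : 'rV[F]_n) (f : 'rV[F]_n -> F) (x : 'rV[F]_n) : F :=
  \sum_(a : F) f (x + a *: y).

(** Of the powers of [a] in the expansion of [f (x + a y)], only [a^(q-1)] survives summation over
    [a]; its coefficient has lost [q - 1] degrees. *)
Lemma lsumE n d (f : 'rV[F]_n -> F) y : deg_le d f ->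
  exists2 c : 'rV[F]_n -> F,
    ((q.-1 <= d)%N -> deg_le (d - q.-1) c) /\ ((d < q.-1)%N -> forall x, c x = 0) &
    lsum y f =1 c.
Proof.
move=> /(taylor y)[c [cd c0 cE]].
have q1 : (q.-1 < q)%N by rewrite prednK // ltnW // card_field_gt1.
pose j := Ordinal q1.
exists (fun x => (\sum_(a : F) a ^+ q.-1) * c j x); first split.
- by move=> qd; apply: deg_leZ; exact: (cd j qd).
- by move=> dq x; rewrite (c0 j dq) mulr0.
move=> x; rewrite /lsum; under eq_bigr do rewrite cE.
rewrite exchange_big /= (bigD1 j) //= big_distrl /= [X in _ + X]big1 ?addr0 // => i ij.
rewrite -big_distrl /= sum_pow_eq0 ?mul0r //.
by rewrite ltn_neqAle -ltnS prednK ?ltn_ord ?andbT // ltnW // card_field_gt1.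
Qed.

Lemma deg_le_lsum n d (f : 'rV[F]_n -> F) y :
  (q.-1 <= d)%N -> deg_le d f -> deg_le (d - q.-1) (lsum y f).
Proof.
move=> qd /(lsumE y)[c [cd _] cE].
by apply: deg_le_ext (cd qd) => x; rewrite cE.
Qed.

Lemma lsum_eq0 n d (f : 'rV[F]_n -> F) y x : (d < q.-1)%N -> deg_le d f -> lsum y f x = 0.
Proof. by move=> dq /(lsumE y)[c [_ c0] ->]; apply: c0. Qed.

End Degree.

(** * Minimum distance, hyperplanes and gluing *)

Lemma card_bigcup_leq (I T : finType) (P : pred I) (A : I -> {set T}) :
  #|\bigcup_(i | P i) A i| <= \sum_(i | P i) #|A i|.
Proof.
elim/big_rec2: _ => [|i m B _ BA]; first by rewrite cards0.
by apply: leq_trans (leq_card_setU _ _) _; rewrite leq_add2l.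
Qed.

Section MinDistance.
Variable F : finFieldType.
Local Open Scope ring_scope.
Local Notation q := #|F|.

Lemma card_rV n : #|'rV[F]_n| = (q ^ n)%N.
Proof. by rewrite card_mx mul1n. Qed.

Lemma card_shift n (v : 'rV[F]_n) (f : 'rV[F]_n -> bool) :
  #|[set x | f (x + v)]| = #|[set x | f x]|.
Proof.
rewrite -(card_preimset [set x | f x] (addIr v)).
by apply: eq_card => x; rewrite !inE.
Qed.

Lemma card_line n (x : 'rV[F]_n) (a : F) (f : 'rV[F]_n -> bool) : a != 0 ->
  #|[set y | f (x + a *: y)]| = #|[set x | f x]|.
Proof.
move=> a0; have inj : injective (fun y => x + a *: y).
  by move=> y z /addrI /(scalerI a0).
rewrite -(card_preimset [set x | f x] inj).
by apply: eq_card => y; rewrite !inE.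
Qed.

(** Induction on [I]. A nonzero line sum has degree lower by [q - 1], and its support is covered by
    [q] translates of the support of [f]. *)
Lemma min_dist I d n (f : 'rV[F]_n -> F) :
  deg_le d f -> (d < I * q.-1)%N -> (exists x, f x != 0) ->
  (q ^ n <= q ^ I * #|[set x | f x != 0%R]|)%N.
Proof.
elim: I d f => [//|I IH] d f df dI [x0 fx0].
have [/existsP[y /existsP[x yx]]|H] := boolP [exists y, [exists x, lsum y f x != 0]].
  have qd : (q.-1 <= d)%N.
    by rewrite leqNgt; apply: contra yx => /lsum_eq0 -> //.
  have := IH (d - q.-1)%N (lsum y f) (deg_le_lsum y qd df).
  rewrite ltn_subLR // -mulSn => /(_ dI (ex_intro _ x yx)) /leq_trans; apply.
  rewrite expnSr -mulnA leq_mul2l; apply/orP; right.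
  have sub : [set x | lsum y f x != 0] \subset \bigcup_(a : F) [set x | f (x + a *: y) != 0].
    apply/subsetP => z; rewrite inE => nz; apply/bigcupP.
    have [/existsP[a az]|/existsPn H] := boolP [exists a, f (z + a *: y) != 0].
      by exists a => //; rewrite inE.
    by case/eqP: nz; apply: big1 => a _; apply/eqP; rewrite -[_ == _]negbK.
  apply: leq_trans (subset_leq_card sub) (leq_trans (card_bigcup_leq _ _) _).
  under eq_bigr do rewrite (card_shift _ (fun x => f x != 0)).
  by rewrite sum_nat_const.
(* All line sums vanish, so every line through [x0] meets the support again. Hence every direction
   [y] lies in one of [q - 1] sets of the size of the support. *)
have sub : [set: 'rV[F]_n] \subset
    \bigcup_(a | a != 0) [set y | f (x0 + a *: y) != 0].
  apply/subsetP => y _; apply/bigcupP.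
  have [/existsP[a /andP[a0 az]]|/existsPn H'] := boolP [exists a, (a != 0) && (f (x0 + a *: y) != 0)].
    by exists a => //; rewrite inE.
  move/existsPn: H => /(_ y) /existsPn /(_ x0); rewrite negbK /lsum (bigD1 0) //= big1.
    by rewrite addr0 scale0r addr0 (negPf fx0).
  by move=> a a0; have := H' a; rewrite a0 /= negbK => /eqP.
have := leq_trans (subset_leq_card sub) (card_bigcup_leq _ _).
rewrite cardsT card_rV => /leq_trans; apply.
under eq_bigr => a a0 do rewrite (card_line x0 (fun x => f x != 0) a0).
rewrite sum_nat_const leq_mul2r; apply/orP; right.
apply: leq_trans (max_card _) _; rewrite expnS leq_pmulr // expn_gt0.
by rewrite (ltnW (card_field_gt1 F)).
Qed.

End MinDistance.

(** * Hyperplanes in general position and gluing *)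

Section Hyperplanes.
Variables (F : finFieldType) (n : nat).
Local Open Scope ring_scope.
Local Notation q := #|F|.
Local Notation V := 'rV[F]_n.

Lemma dotpD (w x y : V) : dotp w (x + y) = dotp w x + dotp w y.
Proof. by rewrite /dotp -big_split /=; apply: eq_bigr => i _; rewrite mxE mulrDr. Qed.

Lemma dotpZ (w x : V) a : dotp w (a *: x) = a * dotp w x.
Proof. by rewrite /dotp big_distrr /=; apply: eq_bigr => i _; rewrite mxE mulrCA. Qed.

(* The hyperplane [{x | w.x = c}] together with a direction [y] along which to project on it. *)
Definition hyp := (V * F * V)%type.
Definition hw (h : hyp) : V := h.1.1.
Definition hc (h : hyp) : F := h.1.2.
Definition hy (h : hyp) : V := h.2.
Definition hlam (h : hyp) (x : V) : F := dotp (hw h) x - hc h.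
Definition hproj (h : hyp) (x : V) : V := x - hlam h x *: hy h.

Lemma deg_le_hlam h : deg_le 1 (hlam h).
Proof. exact: (deg_leB (deg_le_dotp (hw h)) (deg_le_const n 1 (hc h))). Qed.

Lemma affine_hproj h : affine_map (hproj h).
Proof.
move=> i; apply: (@deg_le_ext _ _ _ (fun x => x ord0 i - hy h ord0 i * hlam h x)).
  by move=> x; rewrite !mxE mulrC.
exact: (deg_leB (deg_le_coord _ i) (deg_leZ _ (deg_le_hlam h))).
Qed.

Lemma hlam_hproj h h' x :
  hlam h' (hproj h x) = hlam h' x - hlam h x * dotp (hw h') (hy h).
Proof.
rewrite {1}/hlam /hproj -scaleNr dotpD dotpZ mulNr addrAC; congr (_ - _).
Qed.

Lemma hproj_on h x : hlam h x = 0 -> hproj h x = x.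
Proof. by rewrite /hproj => ->; rewrite scale0r subr0. Qed.

(* Triangular duality between normals and directions; the head of the list is the
   hyperplane added last, so that projecting on it preserves all the others. *)
Definition tri (s : seq hyp) : bool :=
  all (fun h => dotp (hw h) (hy h) == 1) s &&
  pairwise (fun h h' => dotp (hw h') (hy h) == 0) s.

Lemma tri_cons h s : tri (h :: s) ->
  [/\ dotp (hw h) (hy h) = 1, forall h', h' \in s -> dotp (hw h') (hy h) = 0 & tri s].
Proof.
rewrite /tri /= => /andP[/andP[/eqP h1 s1] /andP[/allP hs ps]]; split=> //.
- by move=> h' /hs /eqP.
- by rewrite s1.
Qed.

Lemma tri_rcons h s : tri (rcons s h) ->
  [/\ dotp (hw h) (hy h) = 1, forall h', h' \in s -> dotp (hw h) (hy h') = 0 & tri s].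
Proof.
rewrite /tri all_rcons pairwise_rcons => /andP[/andP[/eqP h1 s1] /andP[/allP hs ps]].
split=> //; last by rewrite s1.
by move=> h' /hs /eqP.
Qed.

(** Newton-style correction: add [(P h - G)] composed with the projection on [h]. That projection
    keeps the earlier hyperplanes, where [G] already equals [P h] at the projected point, so nothing
    achieved before is spoiled. *)
Lemma glue d (s : seq hyp) (P : hyp -> V -> F) : tri s ->
  (forall h, h \in s -> deg_le d (P h)) ->
  (forall h h' x, h \in s -> h' \in s -> hlam h x = 0 -> hlam h' x = 0 -> P h x = P h' x) ->
  exists2 G, deg_le d G & forall h x, h \in s -> hlam h x = 0 -> G x = P h x.
Proof.
elim: s => [|h s IH]; first by exists (fun=> 0) => //; apply: deg_le_const.
move=> /tri_cons[h1 hs ts] Pd Pc.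
have [||G Gd GE] := IH ts.
- by move=> h' h's; apply: Pd; rewrite inE h's orbT.
- by move=> h' h'' x h's h''s; apply: Pc; rewrite inE ?h's ?h''s orbT.
exists (fun x => G x + (P h (hproj h x) - G (hproj h x))).
  apply: deg_leD => //; apply: (deg_le_comp (affine_hproj h)) (deg_leB _ _) => //.
  by apply: Pd; rewrite inE eqxx.
move=> h' x; rewrite inE => /orP[/eqP -> /hproj_on ->|h's h'x]; first by rewrite addrC subrK.
have h'p : hlam h' (hproj h x) = 0 by rewrite hlam_hproj hs // mulr0 subr0.
have hp : hlam h (hproj h x) = 0 by rewrite hlam_hproj h1 mulr1 subrr.
rewrite (GE h') // (GE h') //.
by rewrite (Pc h h') ?subrr ?addr0 // inE ?eqxx // h's orbT.
Qed.

Definition hdiff (h : hyp) (f : V -> F) (x : V) : F := f x - f (hproj h x).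
Definition hdiffs (s : seq hyp) (f : V -> F) : V -> F := foldr hdiff f s.

Lemma hdiffs_ext s f g : f =1 g -> hdiffs s f =1 hdiffs s g.
Proof. by move=> fg; elim: s => //= h s IH x; rewrite /hdiff !IH. Qed.

Lemma hdiffs_lin s (I : finType) (P : pred I) (m c : I -> V -> F) :
  (forall i h x, h \in s -> m i (hproj h x) = m i x) ->
  hdiffs s (fun x => \sum_(i | P i) m i x * c i x) =1
  fun x => \sum_(i | P i) m i x * hdiffs s (c i) x.
Proof.
elim: s => // h s IH inv x /=; rewrite /hdiff !IH; first last.
- by move=> i h' y h's; apply: inv; rewrite inE h's orbT.
- by move=> i h' y h's; apply: inv; rewrite inE h's orbT.
rewrite -sumrB; apply: eq_bigr => i _.
by rewrite inv ?inE ?eqxx // -mulrBr.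
Qed.

(** Each difference loses at least one degree. The innermost one, for the last [h], is a combination
    of terms [hlam h ^ j * c j] with [j > 0] and [c j] of degree [d - j]; [hlam h] is invariant
    under the other projections and acts as a scalar for the remaining differences. *)
Lemma hdiffs_eq0 d s f : tri s -> (d < size s)%N -> deg_le d f -> forall x, hdiffs s f x = 0.
Proof.
elim/last_ind: s d f => // s h IH d f /tri_rcons[h1 hs ts].
rewrite size_rcons ltnS => ds df x.
have [c [cd c0 cE]] := taylor (hy h) df.
have o : (0 < q)%N by apply: ltnW (card_field_gt1 F).
rewrite /hdiffs foldr_rcons -/(hdiffs s (hdiff h f)).
rewrite (@hdiffs_ext s (hdiff h f)
  (fun x => \sum_(j < q | j != Ordinal o) - ((- hlam h x) ^+ j) * c j x)); last first.
  move=> y; have fy : f y = c (Ordinal o) y.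
    rewrite -{1}[y]addr0 -(scale0r (hy h)) cE (bigD1 (Ordinal o)) //= expr0 mul1r big1 ?addr0 //.
    by move=> j j0; rewrite expr0n (negPf (_ : (j : nat) != 0)%N) ?mul0r.
  rewrite /hdiff /hproj -scaleNr cE fy (bigD1 (Ordinal o)) //= expr0 mul1r.
  rewrite opprD addrA subrr add0r -sumrN; apply: eq_bigr => j _.
  by rewrite mulNr.
rewrite hdiffs_lin.
  apply: big1 => j j0; rewrite [X in _ * X](_ : _ = 0) ?mulr0 //.
  case: (leqP j d) => jd; last first.
    rewrite (@hdiffs_ext s (c j) (fun=> 0)) //; last by move=> y; apply: c0.
    by elim: (s) x => //= h' s' IH' x; rewrite /hdiff !IH' subrr.
  apply: (IH (d - j)%N) (cd j jd) x => //; apply: leq_trans ds.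
  by rewrite ltn_subrL lt0n j0 /= (leq_trans _ jd) // lt0n.
by move=> j h' y h's; rewrite hlam_hproj hs // mulr0 subr0.
Qed.

(** Where [f] vanishes on the hyperplanes, the subtracted terms are 0, so the iterated difference of
    [f] is [f] itself. *)
Lemma deg_le_vanish d s f : tri s -> (d < size s)%N -> deg_le d f ->
  (forall h x, h \in s -> hlam h x = 0 -> f x = 0) -> forall x, f x = 0.
Proof.
move=> ts ds df f0 x; rewrite -(hdiffs_eq0 ts ds df x).
elim: s ts f0 {ds} x => // h s IH ts f0 x /=; have [h1 hs ts'] := tri_cons ts.
have E := IH ts' (fun h' x h's => f0 h' x (mem_behead (s := h :: s) h's)).
rewrite /hdiff -!E (f0 h (hproj h x)) ?subr0 ?mem_head //.
by rewrite hlam_hproj h1 mulr1 subrr.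
Qed.

(** [y] is a rescaled column of the cokernel of [W] on which [w] does not vanish. *)
Lemma hyp_extend (r : nat) (W : 'M[F]_(r, n)) (w : V) : ~~ (w <= W)%MS ->
  exists2 y, dotp w y = 1 & forall i, dotp (row i W) y = 0.
Proof.
have dE (x : V) j : dotp x (col j (cokermx W))^T = (x *m cokermx W) ord0 j.
  by rewrite mxE; apply: eq_bigr => i _; rewrite !mxE.
rewrite submxE => nz.
have [j wj] : exists j, (w *m cokermx W) ord0 j != 0.
  apply/existsP; apply: contraNT nz => /existsPn H.
  by apply/eqP/rowP => j; rewrite [RHS]mxE; apply/eqP; rewrite -[_ == _]negbK.
exists (((w *m cokermx W) ord0 j)^-1 *: (col j (cokermx W))^T).
  by rewrite dotpZ dE mulVf.
by move=> i; rewrite dotpZ dE -row_mul mulmx_coker !mxE mulr0.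
Qed.

End Hyperplanes.

Section ReedMuller.
Variables (F : finFieldType).
Local Open Scope ring_scope.
Local Notation q := #|F|.

(** The finite counterpart of [deg_le], over which one can count, quantify decidably and pick. *)
Definition rm n d : {set {ffun 'rV[F]_n -> F}} :=
  [set g : {ffun 'rV[F]_n -> F} | [exists C : {ffun expvec F n -> F},
     [forall e, (d < expdeg e)%N ==> (C e == 0)] &&
     [forall x, g x == \sum_e C e * monomial e x]]].

Lemma rmP n d (g : {ffun 'rV[F]_n -> F}) : reflect (deg_le d g) (g \in rm n d).
Proof.
rewrite inE; apply: (iffP existsP) => [[C /andP[/forallP C0 /forallP CE]]|[C [C0 CE]]].
  exists C; split=> [e|x]; last exact/eqP.
  by have /implyP H := C0 e; move=> /H /eqP.
exists [ffun e => C e]; apply/andP; split; apply/forallP.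
  by move=> e; apply/implyP => /C0; rewrite ffunE => ->.
by move=> x; rewrite CE; apply/eqP/eq_bigr => e _; rewrite ffunE.
Qed.

Lemma rm_fun n d (f : 'rV[F]_n -> F) : deg_le d f -> [ffun x => f x] \in rm n d.
Proof. by move=> df; apply/rmP; apply: deg_le_ext df => x; rewrite ffunE. Qed.

End ReedMuller.

(** * One polynomial that fits almost all close hyperplanes *)

Section HyperplaneCover.
Variables (F : finFieldType) (n d I : nat) (f : 'rV[F]_n -> F) (tau : rat).
Local Open Scope ring_scope.
Local Notation q := #|F|.
Local Notation V := 'rV[F]_n.

Definition hcount (w : V) (c : F) (P : V -> F) : nat :=
  #|[set x | (dotp w x == c) && (f x != P x)]|.

Definition hclose (w : V) (c : F) : bool :=
  [exists P, (P \in rm F n d) && ((hcount w c P)%:R < tau)].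

Hypothesis dI : (d < I * q.-1)%N.
Hypothesis tauI : 2 * q%:R ^+ 2 * q%:R ^+ I * tau <= q%:R ^+ n.

(** A disagreement on the codimension-2 intersection, pulled back along the projection [p], is a
    nonzero polynomial of degree [d] on the whole space. By [min_dist] it has at least [q^(n-I)]
    nonzeros, but the fibres of [p] have at most [q^2] points and fewer than [2 tau] points of the
    intersection are available. *)
Lemma hyp_consistent (h h' : hyp F n) (P P' : V -> F) :
  dotp (hw h) (hy h) = 1 -> dotp (hw h') (hy h') = 1 -> dotp (hw h') (hy h) = 0 ->
  deg_le d P -> deg_le d P' ->
  (hcount (hw h) (hc h) P)%:R < tau -> (hcount (hw h') (hc h') P')%:R < tau ->
  forall x, hlam h x = 0 -> hlam h' x = 0 -> P x = P' x.
Proof.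
move=> h1 h'1 hh' Pd P'd cP cP' x hx h'x.
(* The order matters: projecting on [h] preserves [hlam h'], not conversely. *)
pose p x := hproj h (hproj h' x).
pose D x := P (p x) - P' (p x).
have Dd : deg_le d D.
  apply: deg_leB; apply: (deg_le_comp (affine_map_comp (affine_hproj h') (affine_hproj h)));
  by [].
suff : D x = 0 by rewrite /D /p (hproj_on h'x) (hproj_on hx) => /eqP; rewrite subr_eq0 => /eqP.
apply/eqP/negP => /negP Dx.
have := min_dist Dd dI (ex_intro _ x Dx).
pose Z := [set z | [&& hlam h z == 0, hlam h' z == 0 & P z != P' z]].
have pZ z : D z != 0 -> p z \in Z.
  rewrite inE /D subr_eq0 => ->; rewrite /p hlam_hproj h1 mulr1 subrr eqxx.
  by rewrite hlam_hproj hh' mulr0 subr0 hlam_hproj h'1 mulr1 subrr eqxx.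
have sZ : (#|[set z | D z != 0%R]| <= q ^ 2 * #|Z|)%N.
  pose g z := (p z, (hlam h' z, hlam h (hproj h' z))).
  have gi : injective g.
    move=> a b [pab l1 l2].
    have : hproj h' a = hproj h' b.
      by move: pab; rewrite /p /hproj l2 => /addIr.
    by rewrite /hproj l1 => /addIr.
  rewrite -(card_imset _ gi); have -> : (q ^ 2 * #|Z| = #|setX Z (setX [set: F] [set: F])|)%N.
    by rewrite !cardsX !cardsT mulnC -mulnn.
  apply/subset_leq_card/subsetP => g0 /imsetP[z]; rewrite inE => /pZ zZ ->.
  by rewrite !inE /= !andbT; move: zZ; rewrite !inE.
have ZZ : (#|Z| <= hcount (hw h) (hc h) P + hcount (hw h') (hc h') P')%N.
  apply: leq_trans (leq_card_setU _ _).
  apply/subset_leq_card/subsetP => z; rewrite !inE /hlam !subr_eq0.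
  by case/and3P=> -> -> PP /=; case: eqP => //= ->.
move=> /leq_trans /(_ (leq_mul (leqnn _) (leq_trans sZ (leq_mul (leqnn _) ZZ)))).
rewrite -(ler_nat rat) !natrM !natrX natrD => H.
move: (le_trans tauI H); apply/negP; rewrite -ltNge.
have q0 : 0 < q%:R :> rat by rewrite ltr0n ltnW // card_field_gt1.
have -> : q%:R ^+ I * (q%:R ^+ 2 * ((hcount (hw h) (hc h) P)%:R + (hcount (hw h') (hc h') P')%:R))
    = q%:R ^+ 2 * q%:R ^+ I * ((hcount (hw h) (hc h) P)%:R + (hcount (hw h') (hc h') P')%:R) :> rat
  by ring.
have -> : 2 * q%:R ^+ 2 * q%:R ^+ I * tau = q%:R ^+ 2 * q%:R ^+ I * (tau + tau) :> rat by ring.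
by rewrite ltr_pM2l ?mulr_gt0 ?exprn_gt0 // ltrD.
Qed.

Definition hpoly (h : hyp F n) : V -> F :=
  odflt [ffun=> 0] [pick P : {ffun V -> F} |
    (P \in rm F n d) && ((hcount (hw h) (hc h) P)%:R < tau)].

Lemma hpolyP h : hclose (hw h) (hc h) ->
  deg_le d (hpoly h) /\ (hcount (hw h) (hc h) (hpoly h))%:R < tau.
Proof.
move=> /existsP[P HP]; rewrite /hpoly; case: pickP => [P' /andP[/rmP ? ?] //|/(_ P)].
by rewrite HP.
Qed.

Definition hgood (s : seq (hyp F n)) := tri s && all (fun h => hclose (hw h) (hc h)) s.

Lemma hgood_glue s : hgood s ->
  exists2 G, deg_le d G & forall h x, h \in s -> hlam h x = 0 -> G x = hpoly h x.
Proof.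
move=> /andP[ts /allP gs]; apply: glue => // [h /gs /hpolyP[]//|].
move: ts; rewrite /tri => /andP[/allP s1 /(pairwiseP (0, 0, 0)) ps].
have key a b x : (a < b < size s)%N -> hlam (nth (0,0,0) s a) x = 0 ->
    hlam (nth (0,0,0) s b) x = 0 -> hpoly (nth (0,0,0) s a) x = hpoly (nth (0,0,0) s b) x.
  case/andP=> ab bs; have as_ := ltn_trans ab bs.
  have ma := mem_nth (0,0,0) as_; have mb := mem_nth (0,0,0) bs.
  have [da ca] := hpolyP (gs _ ma); have [db cb] := hpolyP (gs _ mb).
  apply: hyp_consistent => //; first exact/eqP/s1; first exact/eqP/s1.
  by apply/eqP; apply: ps.
move=> h h' x /(nthP (0,0,0))[a sa <-] /(nthP (0,0,0))[b sb <-] ha hb.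
case: (ltngtP a b) => [ab|ba|->//]; first by apply: key => //; rewrite ab.
by apply/esym; apply: key => //; rewrite ba.
Qed.

Definition hcovered : Prop := exists r (W : 'M[F]_(r, n)) P,
  [/\ (r <= d.+1)%N, deg_le d P &
      forall w c, hclose w c -> ~~ (w <= W)%MS -> (hcount w c P)%:R < tau].

(** Extend a good list greedily. Once it has [d + 1] members with glued polynomial [G], adding any
    further close hyperplane gives a [G'] that agrees with [G] on [d + 1] hyperplanes, hence
    everywhere; so [G] fits the new one as well. *)
Lemma hyp_cover : hcovered.
Proof.
pose Wof (s : seq (hyp F n)) : 'M[F]_(size s, n) := \matrix_(i < size s) hw (nth (0,0,0) s i).
have ext s w c : hgood s -> hclose w c -> ~~ (w <= Wof s)%MS -> exists y, hgood ((w, c, y) :: s).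
  move=> gs wc /hyp_extend[y wy Wy]; exists y; move: gs; rewrite /hgood /tri /= wc wy eqxx /=.
  case/andP=> /andP[-> ->] ->; rewrite !andbT; apply/allP => h /(nthP (0,0,0))[i si <-].
  by have := Wy (Ordinal si); rewrite rowK => /eqP.
have step i : (i <= d.+1)%N -> (exists2 s, hgood s & size s = i) \/ hcovered.
  elim: i => [|i IH] id; first by left; exists [::].
  case: (IH (ltnW id)) => [[s gs ss]|]; last by right.
  have [/existsP[w /existsP[c /andP[wc nW]]]|H] :=
      boolP [exists w, [exists c, hclose w c && ~~ (w <= Wof s)%MS]].
    by have [y gy] := ext s w c gs wc nW; left; exists ((w, c, y) :: s) => //=; rewrite ss.
  (* The extension is stuck: every close hyperplane has its normal in the span, so the condition on
     [P] is vacuous and 0 will do. *)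
  right; exists (size s), (Wof s), (fun=> 0); split=> [||w c wc nW]; first by rewrite ss ltnW.
    exact: deg_le_const.
  by case/existsP: H; exists w; apply/existsP; exists c; rewrite wc.
case: (step d.+1 (leqnn _)) => // -[s gs ss].
have [G dG GE] := hgood_glue gs.
exists (size s), (Wof s), G; split=> [||w c wc nW] //; first by rewrite ss.
have [y gy] := ext s w c gs wc nW.
have [G' dG' G'E] := hgood_glue gy.
have GG' x : G' x = G x.
  apply/eqP; rewrite -subr_eq0; apply/eqP.
  have /andP[ts _] := gs.
  apply: (deg_le_vanish (f := fun x => G' x - G x) ts (d := d)) => //; first by rewrite ss.
    exact: deg_leB.
  by move=> h z hs hz; rewrite (GE h) // (G'E h) ?subrr // inE hs orbT.
have [_] := hpolyP (h := (w, c, y)) wc.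
rewrite (_ : hcount w c G = hcount w c (hpoly (w, c, y))) //.
apply: eq_card => x; rewrite !inE; case: eqP => //= wx.
by rewrite -GG' (G'E (w, c, y)) ?mem_head // /hlam /hw /hc /= wx subrr.
Qed.

End HyperplaneCover.

(** * Variance of the intersection of a set with a random hyperplane *)

Section SecondMoment.
Variables (F : finFieldType) (n : nat).
Local Open Scope ring_scope.
Local Notation q := #|F|.
Local Notation V := 'rV[F]_n.

Lemma dotpC (w x : V) : dotp w x = dotp x w.
Proof. by apply: eq_bigr => i _; rewrite mulrC. Qed.

Lemma card_orth (z : V) : z != 0 -> (q * #|[set w | dotp w z == 0%R]| = q ^ n)%N.
Proof.
move=> nz; have [i zi] : exists i, z ord0 i != 0.
  apply/existsP; apply: contraNT nz => /existsPn H.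
  by apply/eqP/rowP => i; rewrite mxE; apply/eqP; rewrite -[_ == _]negbK.
have E a : #|[set w : V | dotp w z == a]| = #|[set w : V | dotp w z == 0]|.
  pose v : V := \row_j (if j == i then a / z ord0 i else 0).
  have vz : dotp v z = a.
    rewrite /dotp (bigD1 i) //= mxE eqxx divfK // big1 ?addr0 // => j /negPf ji.
    by rewrite mxE ji mul0r.
  rewrite -(card_shift v (fun w => dotp w z == a)); apply: eq_card => w.
  by rewrite !inE dotpC dotpD ![dotp z _]dotpC vz -{2}[a]add0r (inj_eq (addIr a)).
rewrite -card_rV -[RHS]sum1_card (partition_big (fun w => dotp w z) xpredT) //=.
rewrite -sum_nat_const; apply: eq_bigr => a _.
by rewrite -(E a) -sum1_card; apply: eq_bigl => w; rewrite inE.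
Qed.

Variable B : {set V}.
Local Notation b := (#|B|%:R : rat).
Definition hcap (w : V) (c : F) : nat := #|[set x in B | dotp w x == c]|.

Lemma sum_hcap w : \sum_c (hcap w c)%:R = b.
Proof.
rewrite -natr_sum -sum1_card (partition_big (dotp w) xpredT) //=; congr _%:R.
by apply: eq_bigr => c _; rewrite /hcap -sum1_card; apply: eq_bigl => x; rewrite inE.
Qed.

Lemma hcapE w c : (hcap w c)%:R = \sum_(x in B) (dotp w x == c)%:R :> rat.
Proof.
rewrite /hcap -sum1_card natr_sum big_mkcond [RHS]big_mkcond /=.
by apply: eq_bigr => x _; rewrite inE; case: (x \in B); case: eqP.
Qed.

(** Counts triples [(w, x, y)] with [w.x = w.y]: all [q^n] normals if [x = y], and [q^(n-1)] of them
    otherwise. *)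
Lemma sum_hcap2 : q%:R * \sum_w \sum_c (hcap w c)%:R ^+ 2
  = b * (q%:R - 1) * q%:R ^+ n + b ^+ 2 * q%:R ^+ n :> rat.
Proof.
have E w : \sum_c (hcap w c)%:R ^+ 2 =
    \sum_(x in B) \sum_(y in B) (dotp w (x - y) == 0)%:R :> rat.
  under eq_bigr => c _ do rewrite hcapE expr2 big_distrl /=.
  rewrite exchange_big /=; apply: eq_bigr => x xB.
  under eq_bigr => c _ do rewrite big_distrr /=.
  rewrite exchange_big /=; apply: eq_bigr => y yB.
  rewrite (bigD1 (dotp w x)) //= eqxx mul1r big1 ?addr0.
    by rewrite -scaleN1r dotpD dotpZ mulN1r subr_eq0 eq_sym; case: eqP.
  by move=> c; rewrite eq_sym => /negPf ->; rewrite mul0r.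
rewrite (eq_bigr _ (fun w _ => E w)) exchange_big /= big_distrr /=.
rewrite (eq_bigr (fun=> (q%:R - 1) * q%:R ^+ n + b * q%:R ^+ n)); last first.
  move=> x xB; rewrite exchange_big /= (bigD1 x) //= subrr.
  rewrite (eq_bigr (fun=> 1)); last first.
    by move=> w _; rewrite [dotp _ _]big1 ?eqxx // => i _; rewrite mxE mulr0.
  rewrite sumr_const card_rV natrX mulrDr big_distrr /=.
  rewrite (eq_bigr (fun=> q%:R ^+ n)); last first.
    move=> y /andP[yB yx]; rewrite -natr_sum -natrM -natrX; congr _%:R.
    rewrite -(@card_orth (x - y)) ?subr_eq0 1?eq_sym //; congr (_ * _)%N.
    by rewrite -[RHS]sum1_card [RHS]big_mkcond /=; apply: eq_bigr => w _; rewrite inE; case: eqP.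
  rewrite sumr_const; have -> : b = #|[pred i in B | i != x]|.+1%:R.
    by rewrite (cardD1 x) xB; congr (_.+1)%:R; apply: eq_card => y; rewrite !inE andbC.
  by rewrite -mulr_natl -natr1; ring.
by rewrite sumr_const -mulr_natl; ring.
Qed.

Lemma hcap_variance : q%:R * \sum_w \sum_c ((hcap w c)%:R - b / q%:R) ^+ 2
  = b * (q%:R - 1) * q%:R ^+ n.
Proof.
have q0 : q%:R != 0 :> rat by rewrite pnatr_eq0 -lt0n ltnW // card_field_gt1.
have E w : \sum_c ((hcap w c)%:R - b / q%:R) ^+ 2 = \sum_c (hcap w c)%:R ^+ 2 - b ^+ 2 / q%:R.
  rewrite (eq_bigr (fun c => (hcap w c)%:R ^+ 2 - 2 * (b / q%:R) * (hcap w c)%:R + (b / q%:R) ^+ 2)).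
    rewrite big_split sumrB /= -big_distrr /= sum_hcap sumr_const -mulr_natl; field.
    by [].
  by move=> c _; ring.
rewrite (eq_bigr _ (fun w _ => E w)) sumrB mulrBr sum_hcap2 sumr_const card_rV -[_ *+ (q ^ n)%N]mulr_natl natrX.
field. by [].
Qed.

(** Chebyshev's inequality for a uniform pair [(w, c)]. *)
Lemma few_light_hyperplanes (tau : rat) : tau <= b / q%:R ->
  #|[set wc : V * F | (hcap wc.1 wc.2)%:R < tau]|%:R * (b / q%:R - tau) ^+ 2 <= b * q%:R ^+ n.
Proof.
move=> tb; have q0 : 0 < q%:R :> rat by rewrite ltr0n ltnW // card_field_gt1.
rewrite -(ler_pM2l q0); apply: (@le_trans _ _ (b * (q%:R - 1) * q%:R ^+ n)); last first.
  rewrite mulrA [_ * b]mulrC ler_wpM2r ?exprn_ge0 ?ler0n // ler_wpM2l ?ler0n //.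
  by rewrite gerBl.
rewrite -hcap_variance ler_wpM2l ?ler0n // pair_big /=.
rewrite mulr_natl -sumr_const [X in _ <= X](bigID (mem [set wc : V * F | (hcap wc.1 wc.2)%:R < tau])) /=.
rewrite -[X in X <= _]addr0; apply: lerD; last by apply: sumr_ge0 => i _; exact: sqr_ge0.
apply: ler_sum => -[w c]; rewrite inE /= => wc.
rewrite -[X in _ <= X]sqrrN opprB ler_sqr ?nnegrE ?subr_ge0 //; first by rewrite lerD2l lerN2 ltW.
by apply: le_trans tb; apply: ltW.
Qed.

End SecondMoment.

(** * A function far from degree [d] is close to it on few hyperplanes *)

Section HyperplaneStep.
Variables (F : finFieldType) (j d I : nat) (f : 'rV[F]_j.+1 -> F) (theta theta' : rat).
Local Open Scope ring_scope.
Local Notation q := #|F|.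
Hypothesis dI : (d < I * q.-1)%N.
Hypothesis thetaI : 2 * q%:R ^+ I.+1 * theta <= 1.
Hypothesis theta0 : 0 <= theta.
Hypothesis theta_lt : theta < theta'.
Hypothesis ffar : forall P, deg_le d P -> theta' * q%:R ^+ j.+1 <= (ndiff f P)%:R.

(** The first term counts pairs whose normal lies in the exceptional span, of dimension at most
    [d + 1], which includes [w = 0]. The second counts hyperplanes that meet [{f <> P}] too
    rarely. *)
Lemma few_close_hyperplanes :
  #|[set wc : 'rV[F]_j.+1 * F | (wc.1 == 0) || hclose d f (theta * q%:R ^+ j) wc.1 wc.2]|%:R
   <= q%:R ^+ d.+2 + q%:R ^+ 2 * theta' / (theta' - theta) ^+ 2.
Proof.
have q0 : 0 < q%:R :> rat by rewrite ltr0n ltnW // card_field_gt1.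
have [|r [W [P [rd Pd PW]]]] := @hyp_cover F j.+1 d I f (theta * q%:R ^+ j) dI.
  have -> : 2 * q%:R ^+ 2 * q%:R ^+ I * (theta * q%:R ^+ j)
     = q%:R ^+ j.+1 * (2 * q%:R ^+ I.+1 * theta) :> rat by rewrite !exprS; ring.
  by rewrite -[X in _ <= X]mulr1 ler_wpM2l // exprn_ge0 ?ler0n.
pose B := [set x | f x != P x].
pose S1 := [set wc : 'rV[F]_j.+1 * F | (wc.1 <= W)%MS].
pose S2 := [set wc : 'rV[F]_j.+1 * F | (hcap B wc.1 wc.2)%:R < theta * q%:R ^+ j].
have sub : [set wc : 'rV[F]_j.+1 * F | (wc.1 == 0) || hclose d f (theta * q%:R ^+ j) wc.1 wc.2] \subset S1 :|: S2.
  apply/subsetP => -[w c]; rewrite !inE /=.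
  case: eqP => [->|_ /= wc]; first by rewrite sub0mx.
  case: (boolP (w <= W)%MS) => //= nW; move: (PW w c wc nW).
  rewrite (_ : hcount f w c P = hcap B w c) //.
  by apply: eq_card => x; rewrite !inE andbC.
have := leq_trans (subset_leq_card sub) (leq_card_setU S1 S2).
rewrite -(ler_nat rat) natrD => /le_trans; apply; apply: lerD.
  have H : (#|S1| <= q ^ d.+2)%N.
    have sub1 : S1 \subset [set (p.1 *m W, p.2) | p : 'rV[F]_r * F].
      apply/subsetP => -[w c]; rewrite inE /= => /submxP[D ->].
      by apply/imsetP; exists (D, c).
    apply: leq_trans (subset_leq_card sub1) (leq_trans (leq_imset_card _ _) _).
    by rewrite card_prod card_rV -expnSr leq_exp2l ?card_field_gt1.
  by rewrite -natrX ler_nat.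
have bE : ndiff f P = #|B| by [].
have bf := ffar Pd; rewrite bE in bf.
set b := #|B|%:R in bf; pose be := b / q%:R ^+ j.+1.
have qn0 : 0 < q%:R ^+ j.+1 :> rat by rewrite exprn_gt0.
have qj0 : 0 < q%:R ^+ j :> rat by rewrite exprn_gt0.
have bb : b = be * q%:R ^+ j.+1 by rewrite /be divfK ?gt_eqF.
have be1 : theta' <= be by rewrite /be ler_pdivlMr.
have H := @few_light_hyperplanes F j.+1 B (theta * q%:R ^+ j).
rewrite -/b -/S2 bb in H.
have E1 : be * q%:R ^+ j.+1 / q%:R = be * q%:R ^+ j by rewrite exprS; field; rewrite gt_eqF.
rewrite E1 -mulrBl in H.
have {H} := H _; rewrite ler_pM2r // => /(_ (ltW (lt_le_trans theta_lt be1))).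
have d0 : 0 < theta' - theta by rewrite subr_gt0.
rewrite ler_pdivlMr ?exprn_gt0 //.
set K := #|S2|%:R; move=> H.
have {}H : K * (be - theta) ^+ 2 <= q%:R ^+ 2 * be.
  have qq0 : 0 < (q%:R ^+ j) ^+ 2 :> rat by rewrite exprn_gt0.
  rewrite -(ler_pM2r qq0) -mulrA -exprMn; apply: le_trans H _.
  by rewrite le_eqVlt; apply/orP; left; apply/eqP; rewrite exprS; ring.
have K0 : 0 <= K by rewrite ler0n.
have t'0 : 0 < theta' by apply: le_lt_trans theta0 theta_lt.
have be0 : 0 < be by apply: lt_le_trans be1.
(* Chebyshev gives a bound proportional to [be / (be - theta)^2], which decreases in [be]; its value
   at the least possible [be = theta'] is the worst. *)
have key : be * (theta' - theta) ^+ 2 <= theta' * (be - theta) ^+ 2.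
  rewrite -subr_ge0.
  have -> : theta' * (be - theta) ^+ 2 - be * (theta' - theta) ^+ 2
    = (be - theta') * (be * theta' - theta ^+ 2) by ring.
  rewrite mulr_ge0 ?subr_ge0 // expr2 ler_pM //; last exact: ltW.
  by apply: le_trans be1; apply: ltW.
rewrite -(ler_pM2l be0).
apply: (@le_trans _ _ (K * (theta' * (be - theta) ^+ 2))).
  by rewrite mulrCA ler_wpM2l.
rewrite [K * _]mulrCA [X in _ <= X](_ : _ = theta' * (q%:R ^+ 2 * be)); last by ring.
by rewrite ler_pM2l.
Qed.

End HyperplaneStep.

(** * Random restrictions *)

Section HyperplaneChart.
Variables (F : finFieldType) (j : nat) (w : 'rV[F]_j.+1) (c : F).
Local Open Scope ring_scope.

Definition hpivot : 'I_j.+1 := odflt ord0 [pick i | w ord0 i != 0].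

(** For [w = 0] the pivot defaults to [ord0] and its inverse is 0: the chart is still an affine
    injection but no longer parametrizes [w.x = c]. The case [w = 0] is therefore counted as a
    failure below. *)
Definition hchart (u : 'rV[F]_j) : 'rV[F]_j.+1 :=
  \row_i oapp (u ord0)
    ((w ord0 hpivot)^-1 * (c - \sum_l w ord0 (lift hpivot l) * u ord0 l)) (unlift hpivot i).

Definition hdrop (x : 'rV[F]_j.+1) : 'rV[F]_j := \row_l x ord0 (lift hpivot l).

Lemma affine_hchart : affine_map hchart.
Proof.
move=> i; case: (unliftP hpivot i) => [l|] ->.
  by apply: deg_le_ext (deg_le_coord _ l) => u; rewrite mxE liftK.
have D : deg_le 1 (fun u : 'rV[F]_j => \sum_l w ord0 (lift hpivot l) * u ord0 l).
  by apply: deg_le_sum => l _; apply/deg_leZ/deg_le_coord.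
apply: deg_le_ext (deg_leZ (w ord0 hpivot)^-1 (deg_leB (deg_le_const j 1 c) D)) => u.
by rewrite mxE unlift_none.
Qed.

Lemma affine_hdrop : affine_map hdrop.
Proof. by move=> l; apply: deg_le_ext (deg_le_coord _ (lift hpivot l)) => x; rewrite mxE. Qed.

Lemma hchartK : cancel hchart hdrop.
Proof. by move=> u; apply/rowP => l; rewrite !mxE liftK. Qed.

Lemma hdropK x : w != 0 -> dotp w x = c -> hchart (hdrop x) = x.
Proof.
move=> w0 wx.
have wp : w ord0 hpivot != 0.
  rewrite /hpivot; case: pickP => // H; case/eqP: w0; apply/rowP => i.
  by rewrite mxE; apply/eqP; rewrite -[_ == _]negbK H.
apply/rowP => i; rewrite mxE; case: (unliftP hpivot i) => [l|] -> /=.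
  by rewrite mxE.
apply: (mulfI wp); rewrite mulVKf // -wx /dotp (bigD1_ord hpivot) //=.
rewrite [X in _ - X](eq_bigr (fun l => w ord0 (lift hpivot l) * x ord0 (lift hpivot l))); last first.
  by move=> l _; rewrite mxE.
by rewrite addrK.
Qed.

End HyperplaneChart.

(** * Composition of random hyperplane charts *)

Section Chain.
Variables (F : finFieldType) (d I k E : nat).
Local Open Scope ring_scope.
Local Notation q := #|F|.

Definition rfar n (th : rat) (f : 'rV[F]_n -> F) : bool :=
  [forall P, (P \in rm F n d) ==> (th * q%:R ^+ n <= (ndiff f P)%:R)].

Lemma rfarP n th (f : 'rV[F]_n -> F) :
  reflect (forall P, deg_le d P -> th * q%:R ^+ n <= (ndiff f P)%:R) (rfar th f).
Proof.
apply: (iffP forallP) => [H P Pd|H P]; last by apply/implyP => /rmP; apply: H.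
have /implyP/(_ (rm_fun Pd)) := H [ffun x => P x].
rewrite (_ : ndiff _ _ = ndiff f P) //.
by apply: eq_card => x; rewrite !inE ffunE.
Qed.

Definition eta : rat := E%:R^-1.
(* The distance thresholds decrease from [2 eta] to [eta] along the chain, slowly enough
   for the failure probabilities of the second moment method to be summable. *)
Definition thr (s : nat) : rat := eta * (2 - (3 / 4) ^+ s).
(** Step [s] fails with probability at most [(q^d + 32 E) (8/9)^s / q^k], and 9 is the sum of the
    powers of [8/9]. *)
Definition chain_err : rat := 9 * (q%:R ^+ d + 32 * E%:R) / q%:R ^+ k.

Hypothesis dI : (d < I * q.-1)%N.
Hypothesis EI : (4 * q ^ I.+1 <= E)%N.

Let q2 : 2 <= q%:R :> rat.
Proof. by rewrite (ler_nat _ 2); exact: card_field_gt1. Qed.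
Let q0 : 0 < q%:R :> rat. Proof. exact: lt_le_trans q2. Qed.
Let E0 : 0 < E%:R :> rat.
Proof. by rewrite ltr0n; apply: leq_trans EI; rewrite muln_gt0 expn_gt0 (ltnW (card_field_gt1 F)). Qed.

Lemma close_hchart n th (f : 'rV[F]_n.+1 -> F) w c : w != 0 ->
  ~~ rfar th (fun u => f (hchart w c u)) -> hclose d f (th * q%:R ^+ n) w c.
Proof.
move=> w0; rewrite negb_forall => /existsP[P]; rewrite negb_imply -ltNge => /andP[/rmP Pd cP].
apply/existsP; exists [ffun x => P (hdrop w x)]; rewrite rm_fun /=; last first.
  exact: (deg_le_comp (affine_hdrop w) Pd).
apply: le_lt_trans cP; rewrite ler_nat /ndiff
  -(card_imset (mem [set u | f (hchart w c u) != P u]) (can_inj (hchartK w c))).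
apply/subset_leq_card/subsetP => x; rewrite inE ffunE => /andP[/eqP wx fx].
by apply/imsetP; exists (hdrop w x); rewrite ?inE hdropK.
Qed.

(** The gap between consecutive thresholds is [eta (3/4)^s / 4], so the second-moment term grows
    like [(16/9)^s]. The number of hyperplanes grows like [q^s] with [q >= 2], which leaves the
    ratio [8/9]. *)
Lemma step_count n s (f : 'rV[F]_n.+1 -> F) : n = (s + k)%N -> rfar (thr s.+1) f ->
  #|[set wc : 'rV[F]_n.+1 * F | (wc.1 == 0) || ~~ rfar (thr s) (fun u => f (hchart wc.1 wc.2 u))]|%:R
  <= chain_err * ((8 / 9) ^+ s - (8 / 9) ^+ s.+1) * q%:R ^+ n.+2.
Proof.
move=> nE /rfarP ff.
have p1 m : 0 < (3 / 4 : rat) ^+ m <= 1 by rewrite exprn_gt0 //= exprn_ile1.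
have eta0 : 0 < eta by rewrite invr_gt0.
have thr0 m : 0 <= thr m by apply: mulr_ge0; [exact: ltW | have := p1 m; lra].
have thrlt : thr s < thr s.+1.
  by rewrite /thr ltr_pM2l // exprS; have := p1 s; lra.
have thr2 m : thr m <= 2 * eta.
  by rewrite /thr mulrC ler_pM2r //; have := p1 m; lra.
have tI : 2 * q%:R ^+ I.+1 * thr s <= 1.
  apply: (@le_trans _ _ (2 * q%:R ^+ I.+1 * (2 * eta))).
    by rewrite ler_wpM2l // mulr_ge0 // exprn_ge0 // ltW.
  rewrite /eta mulrA ler_pdivrMr // mul1r; move: EI; rewrite -(ler_nat rat) natrM natrX.
  by apply: le_trans; rewrite le_eqVlt; apply/orP; left; apply/eqP; ring.
have H := few_close_hyperplanes dI tI (thr0 s) thrlt ff.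
have sub : [set wc : 'rV[F]_n.+1 * F | (wc.1 == 0) || ~~ rfar (thr s) (fun u => f (hchart wc.1 wc.2 u))]
   \subset [set wc : 'rV[F]_n.+1 * F | (wc.1 == 0) || hclose d f (thr s * q%:R ^+ n) wc.1 wc.2].
  apply/subsetP => -[w c]; rewrite !inE /=; case: eqP => //= /eqP w0.
  exact: close_hchart.
have := subset_leq_card sub; rewrite -(ler_nat rat) => /le_trans; apply.
apply: le_trans H _.
have -> : thr s.+1 - thr s = eta * (3 / 4) ^+ s / 4 by rewrite /thr exprS; field.
have x0 : 0 < (3 / 4 : rat) ^+ s by rewrite exprn_gt0.
apply: (@le_trans _ _ (q%:R ^+ d.+2 + q%:R ^+ 2 * (2 * eta) / (eta * (3 / 4) ^+ s / 4) ^+ 2)).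
  rewrite lerD2l; apply: ler_wpM2r; first by rewrite invr_ge0 exprn_even_ge0.
  by rewrite ler_wpM2l // exprn_even_ge0.
have -> : q%:R ^+ 2 * (2 * eta) / (eta * (3 / 4) ^+ s / 4) ^+ 2
    = q%:R ^+ 2 * (32 * E%:R) * (16 / 9) ^+ s.
  have -> : (16 / 9 : rat) ^+ s = ((3 / 4) ^+ s) ^- 2.
    by rewrite -exprM mulnC exprM -exprVn; congr (_ ^+ _).
  by rewrite /eta; field; rewrite ?gt_eqF.
have -> : chain_err * ((8 / 9) ^+ s - (8 / 9) ^+ s.+1) * q%:R ^+ n.+2
    = (q%:R ^+ d.+2 + q%:R ^+ 2 * (32 * E%:R)) * ((8 / 9) * q%:R) ^+ s.
  have -> : q%:R ^+ n.+2 = q%:R ^+ s * q%:R ^+ k * q%:R ^+ 2 :> rat.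
    by rewrite nE -!exprD addn2.
  rewrite /chain_err [(8 / 9 * _) ^+ s]exprMn -[d.+2]addn2 exprD [(8 / 9) ^+ s.+1]exprS.
  have : q%:R ^+ k != 0 :> rat by rewrite gt_eqF // exprn_gt0.
  move: (q%:R ^+ k) ((8 / 9) ^+ s) (q%:R ^+ s) (q%:R ^+ d) => a x y z a0.
  by field.
rewrite [X in _ <= X]mulrDl; apply: lerD.
  rewrite -[X in X <= _]mulr1 ler_wpM2l ?exprn_ge0 ?ler0n //.
  by apply: exprn_ege1; move: q2; lra.
rewrite ler_wpM2l ?mulr_ge0 ?exprn_ge0 ?ler0n //.
by apply: lerXn2r; rewrite ?nnegrE; move: q2; lra.
Qed.

(** The chart from the top dimension is drawn first. A bad one forfeits all choices below it; after
    a good one the pullback is [thr s]-far and the induction hypothesis applies. *)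
Lemma chain s : exists (Om : finType) (phi : Om -> 'rV[F]_k -> 'rV[F]_(s + k)),
  [/\ (0 < #|Om|)%N, forall om, affine_map (phi om), forall om, injective (phi om) &
      forall f, rfar (thr s) f ->
        #|[set om | ~~ rfar eta (fun u => f (phi om u))]|%:R
          <= chain_err * (1 - (8 / 9) ^+ s) * #|Om|%:R].
Proof.
elim: s => [|s [Om [phi [Om0 aphi iphi Hphi]]]].
  exists unit, (fun _ u => u); split=> //.
  - by rewrite card_unit.
  - by move=> _; apply: affine_map_id.
  - by move=> _ u v.
  move=> f; rewrite /thr expr0 (_ : eta * (2 - 1) = eta); last by ring.
  move=> ff; rewrite expr0 subrr mulr0 mul0r (_ : [set _ | _] = set0) ?cards0 //.
  apply/setP => om; rewrite !inE; apply/negbTE; rewrite negbK; exact: ff.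
exists (('rV[F]_(s + k).+1 * F) * Om)%type, (fun p u => hchart p.1.1 p.1.2 (phi p.2 u)).
have S0 : (0 < #|{: 'rV[F]_(s + k).+1 * F}|)%N.
  by rewrite card_prod card_rV -expnSr expn_gt0 (ltnW (card_field_gt1 F)).
split.
- by rewrite card_prod muln_gt0 S0.
- by move=> p; apply: affine_map_comp (aphi _) (affine_hchart _ _).
- by move=> p; apply: inj_comp (can_inj (hchartK _ _)) (iphi _).
move=> f ff.
set B1 := [set wc : 'rV[F]_(s + k).+1 * F | (wc.1 == 0) ||
  ~~ rfar (thr s) (fun u => f (hchart wc.1 wc.2 u))].
have HB1 : #|B1|%:R <= _ := step_count (erefl _) ff.
set bad := fun wc : 'rV[F]_(s + k).+1 * F =>
  [set om | ~~ rfar eta (fun u => f (hchart wc.1 wc.2 (phi om u)))].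
have -> : #|[set p : ('rV[F]_(s + k).+1 * F) * Om |
     ~~ rfar eta (fun u => f (hchart p.1.1 p.1.2 (phi p.2 u)))]| = (\sum_wc #|bad wc|)%N.
  rewrite -sum1_card (eq_bigr (fun wc => \sum_(om in bad wc) 1)%N); last by move=> wc _; rewrite sum1_card.
  rewrite pair_big_dep /=; apply: eq_bigl => p; by rewrite !inE.
rewrite natr_sum (bigID (mem B1)) /= card_prod.
have e0 : 0 <= chain_err by rewrite divr_ge0 ?mulr_ge0 ?addr_ge0 ?mulr_ge0 ?exprn_ge0 ?ler0n.
pose N : rat := #|Om|%:R; have N0 : 0 <= N by rewrite ler0n.
set M := #|{: 'rV[F]_(s + k).+1 * F}|.
have ME : M%:R = q%:R ^+ (s + k).+2 :> rat by rewrite /M card_prod card_rV -expnSr natrX.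
apply: (@le_trans _ _ (chain_err * ((8 / 9) ^+ s - (8 / 9) ^+ s.+1) * M%:R * N +
    chain_err * (1 - (8 / 9) ^+ s) * N * M%:R)); last first.
  by rewrite natrM -/N le_eqVlt; apply/orP; left; apply/eqP; ring.
apply: lerD.
  apply: (@le_trans _ _ (\sum_(i in B1) N)).
    by apply: ler_sum => i _; rewrite ler_nat max_card.
  by rewrite sumr_const -[_ *+ #|B1|]mulr_natl ler_wpM2r // ME.
apply: (@le_trans _ _ (\sum_(i : 'rV[F]_(s + k).+1 * F) chain_err * (1 - (8 / 9) ^+ s) * N)); last first.
  by rewrite sumr_const mulr_natr.
have x1 : 0 <= chain_err * (1 - (8 / 9) ^+ s) * N.
  rewrite mulr_ge0 // mulr_ge0 // subr_ge0; apply: exprn_ile1; lra.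
rewrite [X in _ <= X](bigID (mem B1)) /= -[X in X <= _]add0r; apply: lerD; first exact: sumr_ge0.
apply: ler_sum => wc; rewrite inE negb_or negbK => /andP[_ wcf].
exact: (Hphi (fun u => f (hchart wc.1 wc.2 u))).
Qed.

End Chain.

(** * Polynomials of small weight *)

Section MonomialCount.
Variable F : finFieldType.
Local Notation q := #|F|.

Definition nmono k m : nat := #|[set e : expvec F k | expdeg e <= m]|.

Lemma nmono_gt0 k m : 0 < nmono k m.
Proof.
have o : (0 < q)%N by apply: ltnW (card_field_gt1 F).
apply/card_gt0P; exists [ffun=> Ordinal o]; rewrite inE /expdeg big1 // => i _.
by rewrite ffunE.
Qed.

Lemma card_rm k m : #|rm F k m| <= q ^ nmono k m.
Proof.
pose S := [set e : expvec F k | expdeg e <= m].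
rewrite /nmono -/S -(card_pffun_on (0%R : F) (mem S) (mem F)).
pose ev (C : {ffun expvec F k -> F}) : {ffun 'rV[F]_k -> F} :=
  [ffun x => \sum_e C e * monomial e x]%R.
apply: leq_trans (leq_image_card ev _).
apply/subset_leq_card/subsetP => g; rewrite inE => /existsP[C /andP[/forallP C0 /forallP CE]].
apply/imageP; exists C; last by apply/ffunP => x; rewrite ffunE; apply/eqP.
apply/pffun_onP; split=> //; apply/supportP => e; rewrite !inE -ltnNge.
by move=> me; apply/eqP; move: (C0 e); rewrite me.
Qed.

(** The right side is the generating function of exponent vectors by degree; each of those counted
    contributes at least [z^m]. *)
Lemma nmono_gen (K : realFieldType) k m (z : K) : (0 <= z <= 1 ->
  (nmono k m)%:R * z ^+ m <= (\sum_(a < q) z ^+ a) ^+ k)%R.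
Proof.
move=> /andP[z0 z1].
have -> : ((\sum_(a < q) z ^+ a) ^+ k = \sum_(e : expvec F k) z ^+ expdeg e)%R.
  rewrite -[k in LHS]card_ord -prodr_const bigA_distr_bigA /=.
  by apply: eq_bigr => e _; rewrite /expdeg expr_sum.
rewrite (bigID (mem [set e : expvec F k | expdeg e <= m])) /=.
rewrite -[X in (X <= _)%R]addr0; apply: lerD; last first.
  by apply: sumr_ge0 => e _; apply: exprn_ge0.
rewrite mulr_natl -sumr_const; apply: ler_sum => e; rewrite inE => em.
exact: ler_wiXn2l.
Qed.

End MonomialCount.

(** * Recovering a function of small weight from iterated line sums *)

Section WeightCount.
Variables (F : finFieldType) (k : nat).
Local Open Scope ring_scope.
Local Notation q := #|F|.
Local Notation V := 'rV[F]_k.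

Fixpoint dirs (i : nat) : finType := if i is i'.+1 then (V * dirs i')%type else unit.

Fixpoint msum (i : nat) : dirs i -> (V -> F) -> V -> F :=
  match i with
  | 0 => fun _ f => f
  | i'.+1 => fun Y f => lsum Y.1 (msum Y.2 f)
  end.

Lemma deg_le_msum i d (Y : dirs i) f : (i * q.-1 <= d)%N -> deg_le d f ->
  deg_le (d - i * q.-1) (msum Y f).
Proof.
elim: i Y => [|i IH] Y id df; first by rewrite mul0n subn0.
have id' : (i * q.-1 <= d)%N by apply: leq_trans id; rewrite leq_mul2r leqnSn orbT.
rewrite mulSnr subnDA; apply: deg_le_lsum; last exact: IH.
by rewrite leq_subRL // addnC -mulSn.
Qed.

Variable f : V -> F.
Definition wt : nat := #|[set x | f x != 0]|.
Definition zcount i : nat := #|[set p : V * dirs i | msum p.2 f p.1 != 0]|.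
Definition ecount i x : nat := #|[set Y : dirs i | msum Y f x != f x]|.

Lemma leq_card_inj (A B : finType) (g : A -> B) (S : {set A}) (T : {set B}) :
  injective g -> (forall x, x \in S -> g x \in T) -> (#|S| <= #|T|)%N.
Proof.
move=> gi gS; rewrite -(card_imset S gi); apply/subset_leq_card/subsetP => y.
by move=> /imsetP[x /gS ? ->].
Qed.

Lemma zcount_le i : (zcount i <= q ^ i * wt * #|dirs i|)%N.
Proof.
elim: i => [|i IH].
  rewrite mul1n card_unit muln1; apply: (@leq_card_inj _ _ fst).
    by move=> [x []] [y []] /= ->.
  by move=> [x []]; rewrite !inE.
have Z a : (#|[set p : V * dirs i.+1 | msum p.2.2 f (p.1 + a *: p.2.1) != 0%R]| <=
    zcount i * q ^ k)%N.
  rewrite -card_rV -cardsT -cardsX.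
  apply: (@leq_card_inj _ _ (fun p => ((p.1 + a *: p.2.1, p.2.2), p.2.1))).
    by move=> [x [y Y]] [x' [y' Y']] /= [e -> yy]; move: e; rewrite yy => /addIr ->.
  by move=> p; rewrite !inE /= andbT.
have sub : [set p : V * dirs i.+1 | msum p.2 f p.1 != 0] \subset
  \bigcup_(a : F) [set p : V * dirs i.+1 | msum p.2.2 f (p.1 + a *: p.2.1) != 0].
  apply/subsetP => p; rewrite inE => nz; apply/bigcupP.
  have [/existsP[a az]|/existsPn H] := boolP [exists a, msum p.2.2 f (p.1 + a *: p.2.1) != 0].
    by exists a => //; rewrite inE.
  by case/eqP: nz; apply: big1 => a _; apply/eqP; rewrite -[_ == _]negbK.
apply: leq_trans (subset_leq_card sub) (leq_trans (card_bigcup_leq _ _) _).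
apply: (@leq_trans (\sum_(a : F) (q ^ i * wt * #|dirs i|) * q ^ k)%N).
  by apply: leq_sum => a _; apply: leq_trans (Z a) _; rewrite leq_mul2r IH orbT.
rewrite sum_nat_const card_prod card_rV expnS.
by apply/eq_leq; ring.
Qed.

(** The sum ranges over [q^i] points, one of which is [x]; each of the others is uniform and hits
    the support with probability [wt / q^k]. The bound [(q^i - 1) wt / q^k] is written additively to
    avoid truncated subtraction. *)
Lemma ecount_le i x : (ecount i x * q ^ k + wt * #|dirs i| <= q ^ i * wt * #|dirs i|)%N.
Proof.
elim: i => [|i IH].
  rewrite mul1n (_ : ecount 0 x = 0%N) ?mul0n //.
  by apply/eqP; rewrite cards_eq0; apply/eqP/setP => Y; rewrite !inE /= eqxx.
pose A := [set p : dirs i.+1 | msum p.2 f x != f x].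
pose Bs (a : F) := [set p : dirs i.+1 | msum p.2 f (x + a *: p.1) != 0].
have sub : [set Y : dirs i.+1 | msum Y f x != f x] \subset A :|: \bigcup_(a | a != 0) Bs a.
  apply/subsetP => p; rewrite !inE => nz.
  case: (eqVneq (msum p.2 f x) (f x)) => //= e; apply/bigcupP.
  have [/existsP[a /andP[a0 az]]|/existsPn H] :=
      boolP [exists a, (a != 0) && (msum p.2 f (x + a *: p.1) != 0)].
    by exists a => //; rewrite inE.
  case/eqP: nz; rewrite /= /lsum (bigD1 0) //= scale0r addr0 e big1 ?addr0 // => a a0.
  by have := H a; rewrite a0 /= negbK => /eqP.
have cA : (#|A| <= q ^ k * ecount i x)%N.
  rewrite -card_rV -cardsT -cardsX; apply: (@leq_card_inj _ _ id) => // p.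
  by rewrite !inE.
have cB a : a != 0 -> (#|Bs a| <= zcount i)%N.
  move=> a0; apply: (@leq_card_inj _ _ (fun p => (x + a *: p.1, p.2))).
    by move=> [y Y] [y' Y'] /= [/addrI /(scalerI a0) -> ->].
  by move=> p; rewrite !inE.
have cE : (ecount i.+1 x <= q ^ k * ecount i x + q.-1 * zcount i)%N.
  apply: leq_trans (subset_leq_card sub) (leq_trans (leq_card_setU _ _) (leq_add cA _)).
  apply: leq_trans (card_bigcup_leq _ _) _.
  apply: leq_trans (leq_sum _ cB) _; rewrite sum_nat_const leq_mul2r; apply/orP; right.
  by rewrite -(cardC1 (0 : F)); apply/subset_leq_card/subsetP => a; rewrite !inE.
have zi := zcount_le i.
rewrite card_prod card_rV.
have -> : (q ^ i.+1 = q ^ i * q.-1 + q ^ i)%N.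
  by rewrite -mulnSr prednK ?expnSr // ltnW // card_field_gt1.
move: IH zi cE; move: (ecount i.+1 x) (ecount i x) (zcount i) (q ^ k)%N (q ^ i)%N q.-1 wt #|dirs i|.
move=> e1 e z Q Qi q' W Y IH zi cE.
have H1 : (e1 * Q <= (Q * e + q' * z) * Q)%N by rewrite leq_mul2r cE orbT.
have H2 : (q' * z * Q <= q' * (Qi * W * Y) * Q)%N.
  by rewrite leq_mul2r leq_mul2l zi !orbT.
have H3 : (Q * (e * Q + W * Y) <= Q * (Qi * W * Y))%N by rewrite leq_mul2l IH orbT.
nia.
Qed.

(** At each point a random sum errs with probability at most 1/16, so [16^errors] has mean at most
    [2^s] over [s] independent draws. At least [s/2] errors would make it [4^s]; hence the majority
    fails with probability at most [2^-s], and the union bound over [q^k < 2^s] points leaves a good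
    draw. *)
Lemma msum_majority i s : (16 * q ^ i * wt <= q ^ k)%N -> (q ^ k < 2 ^ s)%N ->
  exists G : {ffun 'I_s -> dirs i},
    forall x, (2 * #|[set l | msum (G l) f x != f x]| < s)%N.
Proof.
move=> w16 ks.
have q0 : (0 < q ^ k)%N by rewrite expn_gt0 (ltnW (card_field_gt1 F)).
have e16 x : (16 * ecount i x <= #|dirs i|)%N.
  have H1 := ecount_le i x; rewrite -(leq_pmul2r q0).
  have := leq_mul w16 (leqnn #|dirs i|); move: H1.
  by move: (q ^ i)%N (q ^ k)%N => a b; nia.
pose cnt (G : {ffun 'I_s -> dirs i}) x := #|[set l | msum (G l) f x != f x]|.
pose bad x := [set G : {ffun 'I_s -> dirs i} | (s <= 2 * cnt G x)%N].
have cb x : (#|bad x| * 2 ^ s <= #|dirs i| ^ s)%N.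
  have H : (\sum_(G : {ffun 'I_s -> dirs i}) 16 ^ cnt G x <= (2 * #|dirs i|) ^ s)%N.
    have -> : (\sum_(G : {ffun 'I_s -> dirs i}) 16 ^ cnt G x =
       (\sum_(Y : dirs i) 16 ^ (msum Y f x != f x)) ^ s)%N.
      rewrite -[s in RHS]card_ord -prod_nat_const bigA_distr_bigA /=.
      apply: eq_bigr => G _; rewrite /cnt -sum1_card expn_sum big_mkcond /=.
      by apply: eq_bigr => l _; rewrite inE; case: (_ != _).
    case: (posnP s) => [->//|s0]; rewrite leq_exp2r //.
    rewrite (bigID (fun Y => msum Y f x != f x)) /=.
    rewrite (eq_bigr (fun=> 16)) => [|Y ->//]; rewrite sum_nat_const.
    rewrite [X in (_ + X)%N](eq_bigr (fun=> 1)) => [|Y /negbNE/eqP ->]; last by rewrite eqxx.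
    rewrite sum_nat_const muln1 mul2n -addnn.
    apply: leq_add; last exact: max_card.
    apply: leq_trans (e16 x); rewrite mulnC leq_mul2l; apply/orP; right.
    by apply/subset_leq_card/subsetP => Y; rewrite inE.
  have s2 : (0 < 2 ^ s)%N by rewrite expn_gt0.
  rewrite -(leq_pmul2r s2) -mulnA -expnMn [X in (_ <= X)%N]mulnC -expnMn.
  apply: leq_trans H; rewrite (bigID (mem (bad x))) /=; apply: leq_trans (leq_addr _ _).
  rewrite -sum_nat_const; apply: leq_sum => G; rewrite inE => sG.
  by rewrite (_ : 16 = 4 ^ 2)%N // -expnM leq_exp2l.
have [/existsP[G HG]|/existsPn H] := boolP [exists G : {ffun 'I_s -> dirs i},
    [forall x, (2 * cnt G x < s)%N]].
  by exists G; apply/forallP.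
have sub : [set: {ffun 'I_s -> dirs i}] \subset \bigcup_(x : V) bad x.
  apply/subsetP => G _; have := H G; rewrite negb_forall => /existsP[x].
  by rewrite -leqNgt => sG; apply/bigcupP; exists x; rewrite ?inE.
have := leq_trans (subset_leq_card sub) (card_bigcup_leq _ _).
rewrite cardsT card_ffun card_ord => H1.
have Y0 : (0 < #|dirs i| ^ s)%N.
  rewrite expn_gt0; apply/orP; left.
  elim: (i) => [|i' IH]; first by rewrite card_unit.
  by rewrite card_prod card_rV muln_gt0 q0.
have : (#|dirs i| ^ s * 2 ^ s <= q ^ k * #|dirs i| ^ s)%N.
  apply: leq_trans (leq_mul H1 (leqnn _)) _; rewrite big_distrl /=.
  by apply: leq_trans (leq_sum _ (fun x _ => cb x)) _; rewrite sum_nat_const card_rV.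
by rewrite mulnC leq_pmul2r // leqNgt ks.
Qed.

End WeightCount.

(** * Sampling *)

Section CloseCodewords.
Variables (F : finFieldType) (k d : nat) (h : 'rV[F]_k -> F).
Local Open Scope ring_scope.
Local Notation q := #|F|.
Local Notation V := 'rV[F]_k.

(** With 32 here, a difference of two members has weight below [q^(k-i) / 16], as [msum_majority]
    requires. *)
Definition near i : {set {ffun V -> F}} :=
  [set g in rm F k d | (32 * q ^ i * ndiff h g < q ^ k)%N].

Lemma wt_sub i g g' : g \in near i -> g' \in near i ->
  (16 * q ^ i * wt (fun x => (g x - g' x)%R) < q ^ k)%N.
Proof.
rewrite !inE => /andP[_ ng] /andP[_ ng'].
have : (wt (fun x => (g x - g' x)%R) <= ndiff h g + ndiff h g')%N.
  apply: leq_trans (leq_card_setU _ _); apply/subset_leq_card/subsetP => x.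
  by rewrite !inE subr_eq0; case: (eqVneq (h x) (g x)) => //= ->.
by move: ng ng'; move: (q ^ i)%N (q ^ k)%N => a b; nia.
Qed.

Lemma card_near1 I : (d < I * q.-1)%N -> (#|near I| <= 1)%N.
Proof.
move=> dI; apply/card_le1_eqP => g' g g'n gn.
have w := wt_sub gn g'n; apply/ffunP => x; apply/eqP; rewrite -subr_eq0.
apply: contraLR w => nz; rewrite -leqNgt.
have D : deg_le d (fun x => g x - g' x).
  by apply: deg_leB; apply/rmP; [move: gn | move: g'n]; rewrite inE => /andP[].
have ex : exists x, g x - g' x != 0 by exists x.
apply: leq_trans (min_dist D dI ex) _.
by rewrite -mulnA leq_pmull.
Qed.

(** Fix one member [g0] and encode [g] by [s] iterated line sums of [g - g0], which have lower
    degree and determine [g] by majority. *)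
Lemma card_near i s : (i * q.-1 <= d)%N -> (q ^ k < 2 ^ s)%N ->
  (#|near i| <= #|rm F k (d - i * q.-1)| ^ s)%N.
Proof.
move=> id ks; have [->|[g0 g0n]] := set_0Vmem (near i); first by rewrite cards0.
set R := rm F k (d - i * q.-1).
pose ok (g : {ffun V -> F}) (c : {ffun 'I_s -> {ffun V -> F}}) :=
  [forall x, (2 * #|[set l | c l x != (g x - g0 x)%R]| < s)%N].
pose code (g : {ffun V -> F}) : {ffun 'I_s -> {ffun V -> F}} :=
  odflt [ffun=> [ffun=> 0]] [pick c | (c \in ffun_on (mem R)) && ok g c].
have codeP g : g \in near i -> (code g \in ffun_on (mem R)) && ok g (code g).
  move=> gn; rewrite /code; case: pickP => // H.
  have D : deg_le d (fun x => g x - g0 x).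
    by apply: deg_leB; apply/rmP; [move: gn | move: g0n]; rewrite inE => /andP[].
  have [G HG] := msum_majority (ltnW (wt_sub gn g0n)) ks.
  have := H [ffun l => [ffun x => msum (G l) (fun x => g x - g0 x) x]].
  move/negbT; rewrite negb_and => /orP[] /negP[].
    apply/ffun_onP => l; rewrite ffunE; apply: rm_fun; exact: deg_le_msum.
  apply/forallP => x; apply: leq_ltn_trans (HG x); rewrite leq_mul2l /=.
  by apply/subset_leq_card/subsetP => l; rewrite !inE !ffunE.
have inj : {in near i &, injective code}.
  move=> g g' gn g'n e; apply/ffunP => x.
  have /andP[_ /forallP/(_ x) c1] := codeP g gn.
  have /andP[_ /forallP/(_ x) c2] := codeP g' g'n.
  rewrite -e in c2; set A := [set l | _] in c1; set B := [set l | _] in c2.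
  (* Two minorities of positions cannot cover all of them, so at some position both codes are
     right. *)
  have AB : (#|A :|: B| < s)%N by apply: leq_ltn_trans (leq_card_setU A B) _; move: c1 c2; move: #|A| #|B| => a b; lia.
  have : ~~ ([set: 'I_s] \subset A :|: B).
    by apply: contraL AB => /subset_leq_card; rewrite cardsT card_ord -leqNgt.
  case/subsetPn=> l _; rewrite !inE negb_or !negbK => /andP[/eqP -> /eqP].
  by move/addIr.
rewrite -(card_in_imset inj).
rewrite -[s in X in (_ <= X)%N]card_ord -card_ffun_on.
apply/subset_leq_card/subsetP => c /imsetP[g gn ->].
by have /andP[] := codeP g gn.
Qed.

End CloseCodewords.

(** * Lower tail of the number of hits *)

Section Chernoff.
Variables (T : finType) (Q : nat) (B : {set T}).
Local Open Scope ring_scope.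

Lemma bernoulli (R : realFieldType) (x : R) m : 0 <= x -> 1 + m%:R * x <= (1 + x) ^+ m.
Proof.
move=> x0; elim: m => [|m IH]; first by rewrite mul0r addr0.
rewrite exprS; apply: le_trans (_ : (1 + x) * (1 + m%:R * x) <= _); last first.
  by rewrite ler_wpM2l // addr_ge0.
rewrite -natr1; have : 0 <= m%:R * (x * x) by rewrite !mulr_ge0.
by move: m%:R => z; lra.
Qed.

Lemma expr_half (y : rat) m : 0 <= y <= 1 -> 1 <= m%:R * y -> (1 - y) ^+ m <= 1 / 2.
Proof.
move=> /andP[y0 y1] my.
have H : (1 - y) ^+ m * (1 + y) ^+ m <= 1.
  by rewrite -exprMn exprn_ile1 //; nra.
have B2 : 2 <= (1 + y) ^+ m by apply: le_trans (bernoulli m y0); lra.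
have p0 : 0 <= (1 - y) ^+ m by rewrite exprn_ge0 // subr_ge0.
by nra.
Qed.

Definition hits_before j (u : {ffun 'I_Q -> T}) : nat :=
  #|[set l : 'I_Q | (l < j)%N && (u l \in B)]|.

(** The mean of [2^-hits] is [(1 - p/2)^j]. Since [m p >= 2], every [m] samples halve it, so [6 b]
    blocks give [2^(-6b)]; Markov at [2 b] hits leaves [2^(-4b) = 16^-b]. *)
Lemma chernoff m b : (0 < #|T|)%N -> (2 * #|T| <= m * #|B|)%N -> (m * (6 * b) <= Q)%N ->
  (#|[set u : {ffun 'I_Q -> T} | hits_before (m * (6 * b)) u <= 2 * b]| * 16 ^ b <= #|T| ^ Q)%N.
Proof.
move=> T0 mB; set j := (m * (6 * b))%N => jQ; set S := [set u | _].
have T0r : 0 < #|T|%:R :> rat by rewrite ltr0n.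
pose p : rat := #|B|%:R / #|T|%:R.
have p01 : 0 <= p <= 1.
  by rewrite /p divr_ge0 ?ler0n //= ler_pdivrMr // mul1r ler_nat max_card.
have H : \sum_(u : {ffun 'I_Q -> T}) (1 / 2 : rat) ^+ hits_before j u
    = #|T|%:R ^+ Q * (1 - p / 2) ^+ j.
  pose w (l : 'I_Q) (x : T) : rat := if (l < j)%N && (x \in B) then 1 / 2 else 1.
  rewrite (eq_bigr (fun u : {ffun 'I_Q -> T} => \prod_l w l (u l))); last first.
    move=> u _; rewrite -prodr_const big_mkcond /=; apply: eq_bigr => l _.
    by rewrite inE.
  rewrite -bigA_distr_bigA /=.
  rewrite (eq_bigr (fun l : 'I_Q => #|T|%:R * (if (l < j)%N then 1 - p / 2 else 1))); last first.
    move=> l _; rewrite /w; case: (l < j)%N => /=; last by rewrite sumr_const mulr1.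
    rewrite (eq_bigr (fun x => 1 - (if x \in B then 1 / 2 else 0))); last first.
      by move=> x _; case: ifP => _; lra.
    rewrite sumrB sumr_const -big_mkcond sumr_const /p -[(1 / 2) *+ _]mulr_natr.
    by field; rewrite gt_eqF.
  rewrite big_split /= prodr_const card_ord; congr (_ * _).
  rewrite -big_mkcond /= prodr_const; congr (_ ^+ _).
  rewrite -[RHS]card_ord -[RHS]sum1_card (big_ord_widen Q (fun=> 1%N) jQ) -[LHS]sum1_card.
  by apply: eq_bigl.
have half : (1 - p / 2) ^+ j <= (1 / 2) ^+ (6 * b).
  rewrite /j exprM; apply: lerXn2r; rewrite ?nnegrE ?exprn_ge0 //; [lra|].
  apply: expr_half; first by lra.
  rewrite /p mulrA ler_pdivlMr // mulrA ler_pdivlMr //.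
  by move: mB; rewrite -(ler_nat rat) !natrM; lra.
have : #|S|%:R * (1 / 2) ^+ (2 * b) <= #|T|%:R ^+ Q * (1 / 2) ^+ (6 * b) :> rat.
  apply: (@le_trans _ _ (#|T|%:R ^+ Q * (1 - p / 2) ^+ j)); last first.
    by rewrite ler_wpM2l ?exprn_ge0 ?ler0n.
  rewrite -H (bigID (mem S)) /= -[X in X <= _]addr0; apply: lerD; last first.
    by apply: sumr_ge0 => u _; rewrite exprn_ge0.
  rewrite mulr_natl -sumr_const; apply: ler_sum => u; rewrite inE => ub.
  by apply: ler_wiXn2l => //; lra.
have x0 : 0 < (1 / 2 : rat) ^+ (2 * b) by apply: exprn_gt0; lra.
have -> : (1 / 2 : rat) ^+ (6 * b) = (1 / 2) ^+ (4 * b) * (1 / 2) ^+ (2 * b).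
  by rewrite -exprD -mulnDl.
rewrite mulrA (ler_pM2r x0) => H1.
rewrite -(ler_nat rat) natrM !natrX.
have e16 : (1 / 2 : rat) ^+ (4 * b) * 16 ^+ b = 1.
  have e : (1 / 2 : rat) ^+ 4 * 16 = 1 by field.
  by rewrite exprM -exprMn e expr1n.
apply: (@le_trans _ _ (#|T|%:R ^+ Q * (1 / 2) ^+ (4 * b) * 16 ^+ b)).
  by rewrite ler_pM2r // exprn_gt0.
by rewrite -mulrA e16 mulr1.
Qed.

End Chernoff.

(** * Scales of distance and the polynomials that could fool the test *)

Section Scales.
Variables (F : finFieldType) (k d E : nat).
Local Notation q := #|F|.
Local Notation V := 'rV[F]_k.

Definition nscale : nat := (d %/ q.-1).+1.
(* [allow i] errors are tolerated among the first [nsample i] answers.  The scale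
   [i < nscale] eliminates the polynomials at distance about [q^-i], the scale [nscale]
   the unique polynomial within the decoding radius, if any. *)
Definition allow i : nat :=
  if i < nscale then i.+1 * q ^ 2 * k * nmono F k (d - i * q.-1) else 1.
(** These are [6 * allow i] blocks for [chernoff], of length [64 q^(i+1)] for polynomials at
    distance at least [q^-(i+1) / 32], and of length [2 E] for functions that are [1/E]-far. *)
Definition nsample i : nat := if i < nscale then 384 * q ^ i.+1 * allow i else 12 * E.

Lemma q1_gt0 : 0 < q.-1.
Proof. by rewrite -ltnS prednK ?card_field_gt1 // ltnW // card_field_gt1. Qed.

Lemma nscaleP : d < nscale * q.-1.
Proof. by rewrite ltn_ceil // q1_gt0. Qed.

Lemma lt_nscale i : i < nscale -> i * q.-1 <= d.
Proof.
rewrite ltnS => id; apply: leq_trans (leq_trunc_div d q.-1).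
by rewrite leq_mul2r id orbT.
Qed.

Hypothesis k0 : 0 < k.

Lemma allow_gt0 i : 0 < allow i.
Proof.
rewrite /allow; case: ifP => // _.
by rewrite !muln_gt0 nmono_gt0 k0 (ltnW (card_field_gt1 F)).
Qed.

Lemma allow_ge i : i < nscale -> i + 3 <= allow i.
Proof.
move=> il; rewrite /allow il.
have n0 := nmono_gt0 F k (d - i * q.-1).
have q4 : 4 <= q ^ 2 by rewrite (_ : 4 = 2 ^ 2)%N // leq_exp2r // card_field_gt1.
apply: (@leq_trans (i.+1 * 4 * 1 * 1)); first by lia.
by rewrite !leq_mul.
Qed.

Variables (Q : nat) (h : V -> F).
Hypothesis hfar : rfar d (eta E) h.
Hypothesis E0 : 0 < E.
Hypothesis sQ : forall i, i <= nscale -> nsample i <= Q.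

(** The factor 2 adds the errors that the test forgives to the answers that the adversary may have
    corrected. *)
Definition fooled : {set {ffun 'I_Q -> V}} :=
  [set u | [exists g, (g \in rm F k d) && [forall i : 'I_nscale.+1,
     hits_before [set x | h x != g x] (nsample i) u <= 2 * allow i]]].

Definition class i : {set {ffun V -> F}} :=
  if i < nscale then
    [set g in (if i == 0 then rm F k d else near d h i) | q ^ k <= 32 * q ^ i.+1 * ndiff h g]
  else near d h nscale.

Definition fooled_by i (g : {ffun V -> F}) : {set {ffun 'I_Q -> V}} :=
  [set u | hits_before [set x | h x != g x] (nsample i) u <= 2 * allow i].

(** Take the least [i] with [q^k <= 32 q^i * ndiff h g]; minimality puts [g] in [near] at the
    preceding scale. Scale 0 has no preceding one and admits every polynomial. *)
Lemma in_class g : g \in rm F k d -> exists2 i, i < nscale.+1 & g \in class i.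
Proof.
move=> gr; case: (boolP (g \in near d h nscale)) => [gn|].
  by exists nscale => //; rewrite /class ltnn.
rewrite inE gr /= -leqNgt => far.
have [i Hi imin] := ex_minnP (ex_intro (fun i => q ^ k <= 32 * q ^ i * ndiff h g) _ far).
have il := imin _ far.
case: i => [|i] in Hi imin il *.
  exists 0 => //; rewrite /class /= inE gr /=; apply: leq_trans Hi _.
  by rewrite leq_mul2r leq_mul2l expn1 expn0 (ltnW (card_field_gt1 F)) !orbT.
exists i; first exact: ltnW.
rewrite /class il inE Hi andbT; case: eqP => // _; rewrite inE gr /= ltnNge.
by apply/negP => /imin; rewrite ltnn.
Qed.

Lemma card_fooled_by i g : g \in class i -> i <= nscale ->
  #|fooled_by i g| * 16 ^ allow i <= (q ^ k) ^ Q.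
Proof.
move=> gc ile; have V0 : 0 < #|{: V}| by rewrite card_rV expn_gt0 (ltnW (card_field_gt1 F)).
have qpos := ltnW (card_field_gt1 F).
pose M := if i < nscale then 64 * q ^ i.+1 else 2 * E.
have nE : nsample i = M * (6 * allow i).
  rewrite /nsample /M; case: ifP => il; first by ring.
  by rewrite /allow il; ring.
have := @chernoff V Q [set x | h x != g x] M (allow i) V0.
rewrite -nE /fooled_by card_rV => H; apply: H; last exact: sQ.
rewrite -[#|[set x | _]|]/(ndiff h g) /M; case: ifP => il.
  move: gc; rewrite /class il inE => /andP[_].
  by move: (q ^ k) (q ^ i.+1) (ndiff h g) => a b c; nia.
move: gc; rewrite /class il inE => /andP[/rmP gd _].
have /rfarP/(_ g gd) := hfar.
rewrite /eta mulrC ler_pdivrMr ?ltr0n // -natrX -natrM ler_nat mulnC => H.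
by rewrite -mulnA leq_mul2l.
Qed.

(** Codes have length [k q], which suffices since [q < 2^q], and each entry takes at most
    [q^D <= 2^(q D)] values, [D] being the monomial count. This is the origin of [q^2 k D] in
    [allow]. *)
Lemma card_class i : i < nscale -> #|class i| <= 2 ^ allow i.
Proof.
move=> il; have id := lt_nscale il; have q1 := card_field_gt1 F.
have ks : q ^ k < 2 ^ (k * q).
  by rewrite mulnC expnM ltn_exp2r // ltn_expl.
apply: (@leq_trans (#|rm F k (d - i * q.-1)| ^ (k * q))).
  apply: (@leq_trans #|if i == 0 then rm F k d else near d h i|).
    by rewrite /class il; apply/subset_leq_card/subsetP => g; rewrite inE => /andP[].
  case: eqP => [->|_]; last exact: card_near.
  rewrite mul0n subn0; have kq : 0 < k * q by rewrite muln_gt0 k0 ltnW.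
  case: (posnP #|rm F k d|) => [->|r0]; first by rewrite exp0n.
  by rewrite -{1}[#|rm F k d|]expn1 leq_pexp2l.
apply: (@leq_trans ((q ^ nmono F k (d - i * q.-1)) ^ (k * q))).
  by rewrite leq_exp2r ?card_rm // muln_gt0 k0 ltnW.
rewrite -expnM; apply: (@leq_trans ((2 ^ q) ^ (nmono F k (d - i * q.-1) * (k * q)))).
  have e0 : 0 < nmono F k (d - i * q.-1) * (k * q) by rewrite !muln_gt0 k0 nmono_gt0 ltnW.
  by rewrite leq_exp2r //; apply: ltnW (ltn_expl _ _).
rewrite -expnM leq_exp2l // /allow il.
move: (nmono _ _ _) => D; rewrite -mulnn; apply: (@leq_trans (1 * (q * (D * (k * q))))).
  by rewrite mul1n.
apply: (@leq_trans (i.+1 * (q * (D * (k * q))))); first by rewrite leq_mul2r orbT.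
by apply/eq_leq; ring.
Qed.

(** A class of at most [2^a] polynomials, each fooling with probability [16^-a], fails with
    probability [8^-a]. The factor [i + 1] in [allow] makes these summable, to at most 1/256; the
    single polynomial of the last scale adds 1/16. *)
Lemma card_fooled : 10 * #|fooled| <= (q ^ k) ^ Q.
Proof.
have sub : fooled \subset \bigcup_(i < nscale.+1) \bigcup_(g in class i) fooled_by i g.
  apply/subsetP => u; rewrite inE => /existsP[g /andP[gr /forallP H]].
  have [i il gc] := in_class gr.
  by apply/bigcupP; exists (Ordinal il) => //; apply/bigcupP; exists g => //; rewrite inE (H (Ordinal il)).
have c1 := leq_trans (subset_leq_card sub) (card_bigcup_leq _ _).
set N := (q ^ k) ^ Q.
have N0 : (0 <= N%:R :> rat)%R by rewrite ler0n.
have cI : (#|\bigcup_(g in class nscale) fooled_by nscale g|%:R <= N%:R / 16 :> rat)%R.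
  have c2 : #|\bigcup_(g in class nscale) fooled_by nscale g| * 16 <= N.
    apply: leq_trans (leq_mul (card_bigcup_leq _ _) (leqnn _)) _; rewrite big_distrl /=.
    apply: (@leq_trans (\sum_(g in class nscale) N)).
      apply: leq_sum => g gc; have := card_fooled_by gc (leqnn _).
      by rewrite /allow ltnn expn1.
    rewrite sum_nat_const -[X in _ <= X]mul1n leq_mul2r; apply/orP; right.
    by rewrite /class ltnn; apply: card_near1; exact: nscaleP.
  by rewrite ler_pdivlMr // -natrM ler_nat.
have ci i : i < nscale ->
  (#|\bigcup_(g in class i) fooled_by i g|%:R <= N%:R / 256 * (1 / 2) ^+ i.+1 :> rat)%R.
  move=> il.
  have c2 : #|\bigcup_(g in class i) fooled_by i g| * 8 ^ allow i <= N.
    have p2 : 0 < 2 ^ allow i by rewrite expn_gt0.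
    rewrite -(leq_pmul2r p2) -mulnA -expnMn.
    apply: leq_trans (leq_mul (card_bigcup_leq _ _) (leqnn _)) _; rewrite big_distrl /=.
    apply: leq_trans (leq_sum _ (fun g gc => card_fooled_by gc (ltnW il))) _.
    by rewrite sum_nat_const mulnC leq_mul2l card_class ?orbT.
  have c3 : 512 * 2 ^ i <= 8 ^ allow i.
    apply: (@leq_trans (8 ^ (i + 3))); last by rewrite leq_exp2l // allow_ge.
    rewrite expnD mulnC leq_mul2r /=; apply: leq_trans (_ : 2 ^ (3 * i) <= _); last by rewrite expnM.
    by rewrite leq_exp2l // leq_pmull.
  have c4 := leq_trans (leq_mul (leqnn _) c3) c2.
  have -> : (N%:R / 256 * (1 / 2) ^+ i.+1 = N%:R / (512 * 2 ^ i)%:R :> rat)%R.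
    rewrite natrM natrX exprS div1r exprVn; field.
    by rewrite expf_neq0.
  by rewrite ler_pdivlMr ?ltr0n ?muln_gt0 ?expn_gt0 // -natrM ler_nat.
have geo m : (\sum_(i < m) (1 / 2) ^+ i.+1 <= 1 :> rat)%R.
  suff -> : (\sum_(i < m) (1 / 2) ^+ i.+1 = 1 - (1 / 2) ^+ m :> rat)%R.
    by rewrite lerBlDr lerDl; apply: exprn_ge0; lra.
  elim: m => [|m IH]; first by rewrite big_ord0 expr0 subrr.
  by rewrite big_ord_recr /= IH exprS; field.
move: c1; rewrite big_ord_recr /= -(ler_nat rat) natrD natr_sum => c1.
have c5 : (\sum_(i < nscale) (#|\bigcup_(g in class i) fooled_by i g|%:R : rat) <= N%:R / 256)%R.
  apply: le_trans (ler_sum _ (fun (i : 'I_nscale) _ => ci i (ltn_ord i))) _.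
  rewrite -big_distrr /=; move: (geo nscale) N0.
  move: (\sum_(i < nscale) _)%R (N%:R : rat)%R => x y x1 y0; nra.
rewrite -(ler_nat rat) natrM.
have : (#|fooled|%:R <= N%:R / 256 + N%:R / 16 :> rat)%R.
  by apply: le_trans c1 (lerD c5 cI).
by move: N0; move: (N%:R : rat)%R (#|fooled|%:R : rat)%R => x y; lra.
Qed.

End Scales.

(** * Online corruptions *)

Section NonAdaptiveRun.
Variables (F : finFieldType) (n t : nat) (adv : adversary F n) (f : 'rV[F]_n -> F).
Hypothesis tadv : t_adversary t adv.
Local Notation X := 'rV[F]_n.

Fixpoint state (x : nat -> X) (l : nat) : seq X * (X -> F) :=
  if l is l'.+1 then
    let qs := rcons (state x l').1 (x l') in (qs, adv qs (state x l').2)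
  else ([::], f).

Lemma runE (S : Type) (query : S -> seq F -> X) s x l :
  (forall a, query s a = x (size a)) ->
  run query adv f s l =
    ((state x l).1, mkseq (fun j => (state x j).2 (x j)) l, (state x l).2).
Proof. by move=> qx; elim: l => //= l ->; rewrite qx size_mkseq mkseqS. Qed.

(** The table facing query [l] depends on earlier points only, hence is independent of the [l]-th
    one for a non-adaptive tester. *)
Lemma state_ext x y l : (forall j, j < l -> x j = y j) -> state x l = state y l.
Proof.
elim: l => //= l IH xy; rewrite IH ?xy //.
by move=> j jl; apply: xy; apply: ltnW.
Qed.

Lemma ndiff_trans (g1 g2 g3 : X -> F) : ndiff g1 g3 <= ndiff g1 g2 + ndiff g2 g3.
Proof.
apply: leq_trans (leq_card_setU _ _); apply/subset_leq_card/subsetP => x.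
by rewrite !inE; case: (eqVneq (g1 x) (g2 x)) => //= ->.
Qed.

Lemma ndiff_state x l : ndiff (state x l).2 f <= t * l.
Proof.
elim: l => [|l IH]; first by rewrite muln0 leqn0 cards_eq0; apply/eqP/setP => z; rewrite !inE eqxx.
by rewrite mulnS; apply: leq_trans (ndiff_trans _ (state x l).2 _) (leq_add (tadv _ _) IH).
Qed.

End NonAdaptiveRun.

(** * Number of corrupted answers in a prefix *)

Section Hits.
Variables (F : finFieldType) (n k t Q : nat) (adv : adversary F n) (f : 'rV[F]_n -> F).
Variable phi : 'rV[F]_k -> 'rV[F]_n.
Hypothesis tadv : t_adversary t adv.
Hypothesis phi_inj : injective phi.
Local Notation q := #|F|.
Local Notation V := 'rV[F]_k.

Definition point (u : {ffun 'I_Q -> V}) (l : nat) : 'rV[F]_n :=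
  phi (oapp u 0%R (insub l)).

Lemma pointE u (l : 'I_Q) : point u l = phi (u l).
Proof. by rewrite /point valK. Qed.

Definition corrupted (u : {ffun 'I_Q -> V}) (l : 'I_Q) : bool :=
  (state adv f (point u) l).2 (point u l) != f (point u l).

Definition ncorrupted j u : nat := #|[set l : 'I_Q | (l < j) && corrupted u l]|.

Definition upd (u : {ffun 'I_Q -> V}) (l : 'I_Q) v : {ffun 'I_Q -> V} :=
  [ffun i => if i == l then v else u i].

Lemma card_corrupted (l : 'I_Q) :
  #|[set u | corrupted u l]| * q ^ k <= t * l * (q ^ k) ^ Q.
Proof.
(* Resampling the [l]-th point: the table in force when it is queried does not depend on it. *)
pose swap (p : {ffun 'I_Q -> V} * V) := (upd p.1 l p.2, p.1 l).
have swapK : involutive swap.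
  move=> [u v]; congr pair; last by rewrite /= ffunE eqxx.
  by apply/ffunP => i; rewrite !ffunE /=; case: eqP => // ->.
have -> : #|[set u | corrupted u l]| * q ^ k = \sum_u \sum_v corrupted (upd u l v) l.
  rewrite pair_big /= (reindex_inj (inv_inj swapK)) /=.
  transitivity (\sum_(p : {ffun 'I_Q -> V} * V) corrupted p.1 l)%N; last first.
    by apply: eq_bigr => p _; rewrite -{1}(swapK p).
  rewrite -(pair_bigA _ (fun u v => nat_of_bool (corrupted u l))) /=.
  under eq_bigr do rewrite sum_nat_const card_rV.
  rewrite -big_distrr /= mulnC; congr (_ * _)%N.
  by rewrite -sum1_card big_mkcond /=; apply: eq_bigr => u _; rewrite inE; case: (corrupted u l).
have -> : (q ^ k) ^ Q = #|{: {ffun 'I_Q -> V}}| by rewrite card_ffun card_rV card_ord.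
rewrite mulnC -sum_nat_const; apply: leq_sum => u _.
set st := (state adv f (point u) l).2.
apply: leq_trans (ndiff_state f tadv (point u) l).
rewrite -/st (eq_bigr (fun v => nat_of_bool (st (phi v) != f (phi v)))).
  apply: (@leq_trans #|[set v | st (phi v) != f (phi v)]|).
    by rewrite -sum1_card [X in _ <= X]big_mkcond; apply: leq_sum => v _; rewrite inE; case: (_ != _).
  by apply: (@leq_card_inj _ _ phi) => // v; rewrite !inE.
move=> v _; rewrite /corrupted pointE ffunE eqxx; congr (nat_of_bool (_ != _)).
rewrite /st (@state_ext _ _ _ _ (point (upd u l v)) (point u)) // => j jl.
have jQ := ltn_trans jl (ltn_ord l).
rewrite -[j]/(val (Ordinal jQ)) !pointE ffunE.
by case: eqP => // e; move: jl; rewrite -e /= ltnn.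
Qed.

(** Markov's inequality: the expected number is at most the sum of [t l / q^k] over [l < j], which
    is at most [t j^2 / (2 q^k)]. *)
Lemma card_ncorrupted j b : 0 < b ->
  2 * b * q ^ k * #|[set u | b < ncorrupted j u]| <= t * j ^ 2 * (q ^ k) ^ Q.
Proof.
move=> b0.
have H1 : b * #|[set u | b < ncorrupted j u]| <= \sum_u ncorrupted j u.
  rewrite (bigID (mem [set u | b < ncorrupted j u])) /=; apply: leq_trans (leq_addr _ _).
  by rewrite mulnC -sum_nat_const; apply: leq_sum => u; rewrite inE => /ltnW.
have H2 : (\sum_u ncorrupted j u) * q ^ k <= \sum_(l < Q | l < j) t * l * (q ^ k) ^ Q.
  have -> : \sum_u ncorrupted j u = \sum_(l < Q | l < j) #|[set u | corrupted u l]|.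
    rewrite (eq_bigr (fun u => \sum_(l < Q | l < j) corrupted u l)); last first.
      move=> u _; rewrite /ncorrupted -sum1_card big_mkcond [RHS]big_mkcond /=.
      by apply: eq_bigr => l _; rewrite inE; case: (l < j); case: corrupted.
    rewrite exchange_big /=; apply: eq_bigr => l _.
    by rewrite -sum1_card [RHS]big_mkcond; apply: eq_bigr => u _; rewrite inE; case: corrupted.
  by rewrite big_distrl /=; apply: leq_sum => l _; apply: card_corrupted.
have H3 : \sum_(l < Q | l < j) t * l * (q ^ k) ^ Q <= t * (q ^ k) ^ Q * \sum_(0 <= l < j) l.
  rewrite big_mkord big_distrr /=.
  case: (leqP j Q) => jQ.
    rewrite [X in _ <= X](big_ord_widen Q (fun l => t * (q ^ k) ^ Q * l)%N jQ).
    by apply: leq_sum => l _; apply/eq_leq; ring.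
  rewrite -(big_mkord xpredT (fun l => t * (q ^ k) ^ Q * l)%N) (big_cat_nat (n := Q)) //=; last exact: ltnW.
  apply: leq_trans (leq_addr _ _); rewrite big_mkord big_mkcond /=.
  apply: leq_sum => l _; case: ifP => // _; apply/eq_leq; ring.
have H4 : 2 * \sum_(0 <= l < j) l <= j ^ 2.
  elim: (j) => [|i IH]; first by rewrite big_geq.
  by rewrite big_nat_recr //= mulnDr; move: IH; rewrite -!mulnn; lia.
set a := #|_| in H1 *; set s1 := (\sum_u _)%N in H1 H2.
set s2 := (\sum_(l < Q | l < j) _)%N in H2 H3; set s3 := (\sum_(0 <= l < j) l)%N in H3 H4.
set N := (q ^ k) ^ Q in H3 *; set K := q ^ k in H2 *.
apply: (@leq_trans (2 * (s1 * K))).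
  have -> : 2 * b * K * a = 2 * (b * a * K) by ring.
  by rewrite leq_mul2l leq_mul2r H1 orbT.
apply: (@leq_trans (t * N * (2 * s3))).
  have -> : t * N * (2 * s3) = 2 * (t * N * s3) by ring.
  by rewrite leq_mul2l (leq_trans H2 H3).
have -> : t * j ^ 2 * N = t * N * j ^ 2 by ring.
by rewrite leq_mul2l H4 orbT.
Qed.

End Hits.

(** * The tester and its three sources of failure *)

Section Tester.
Variables (F : finFieldType) (d k s t m E Q : nat).
Local Notation q := #|F|.
Local Notation V := 'rV[F]_k.
Local Notation n := (s + k).
Local Notation L := (nscale F d).

Hypothesis k0 : 0 < k.
Hypothesis m0 : 0 < m.
Hypothesis mE : 2 * m <= E.
Hypothesis EL : 4 * q ^ L.+1 <= E.
Hypothesis sk : s = 0 \/ 90 * (q ^ d + 32 * E) <= q ^ k.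
Hypothesis tk : forall i, i <= L ->
  5 * L.+1 * t * nsample F k d E i ^ 2 <= q ^ k * allow F k d i.
Hypothesis sQ : forall i, i <= L -> nsample F k d E i <= Q.

Let q0 : 0 < q. Proof. exact: ltnW (card_field_gt1 F). Qed.
Let E0 : 0 < E. Proof. by apply: leq_trans mE; rewrite muln_gt0. Qed.

(** By [tk], each of the [L + 1] scales is overcorrupted with probability at most
    [1 / (10 (L + 1))]. *)
Lemma card_overcorrupted (phi : V -> 'rV[F]_n) adv f :
  t_adversary t adv -> injective phi ->
  10 * #|[set u : {ffun 'I_Q -> V} | [exists i : 'I_L.+1,
     allow F k d i < ncorrupted adv f phi (nsample F k d E i) u]]| <= (q ^ k) ^ Q.
Proof.
move=> tadv iphi.
set B := fun i : nat => [set u : {ffun 'I_Q -> V} |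
  allow F k d i < ncorrupted adv f phi (nsample F k d E i) u].
have sub : [set u : {ffun 'I_Q -> V} | [exists i : 'I_L.+1,
     allow F k d i < ncorrupted adv f phi (nsample F k d E i) u]] \subset
   \bigcup_(i < L.+1) B i.
  apply/subsetP => u; rewrite inE => /existsP[i Hi].
  by apply/bigcupP; exists i => //; rewrite inE.
have cB (i : 'I_L.+1) : 10 * L.+1 * #|B i| <= (q ^ k) ^ Q.
  have iL : i <= L by rewrite -ltnS.
  move: (i : nat) iL => {}i iL.
  have a0 := allow_gt0 F d k0 i.
  have := card_ncorrupted Q f tadv iphi (nsample F k d E i) a0; rewrite -/(B i).
  have := tk iL; have K0 : 0 < q ^ k by rewrite expn_gt0 q0.
  move: K0; move: (nsample F k d E i ^ 2) (allow F k d i) a0 #|B i| (q ^ k) (_ ^ Q) => j b b0 c K N K0.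
  move: L.+1 => l H1 H2.
  have p0 : 0 < 2 * b * K by rewrite !muln_gt0 b0 K0.
  rewrite -(leq_pmul2l p0).
  apply: (@leq_trans (10 * l * (t * j * N))).
    have -> : 2 * b * K * (10 * l * c) = 10 * l * (2 * b * K * c) by ring.
    by rewrite leq_mul2l H2 orbT.
  have -> : 10 * l * (t * j * N) = 2 * N * (5 * l * t * j) by ring.
  have -> : 2 * b * K * N = 2 * N * (K * b) by ring.
  by rewrite leq_mul2l H1 orbT.
rewrite -(leq_pmul2r (ltn0Sn L)).
apply: (@leq_trans (\sum_(i < L.+1) 10 * L.+1 * #|B i|)); last first.
  apply: leq_trans (leq_sum _ (fun i _ => cB i)) _.
  by rewrite sum_nat_const card_ord mulnC.
rewrite -big_distrr /= mulnAC leq_mul2l; apply/orP; right.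
exact: leq_trans (subset_leq_card sub) (card_bigcup_leq _ _).
Qed.

(** Wrong acceptance needs a bad restriction, a fooling sample or too many corruptions, each of
    probability at most 1/10; wrong rejection needs the last. Here [1/m] is the distance of [f],
    [2 m <= E] puts it above every threshold, and [sk] bounds the failure of the chain. *)
Lemma tester : exists (S : finType) (query : S -> seq F -> 'rV[F]_n)
    (decide : S -> seq F -> bool),
  [/\ 0 < #|S|,
      forall f, deg_le d f -> forall adv, t_adversary t adv ->
        2 * #|S| <= 3 * #|[set x | accepts query decide Q adv f x]| &
      forall f, (forall g, deg_le d g -> q ^ n <= m * ndiff f g) ->
        forall adv, t_adversary t adv ->
        3 * #|[set x | accepts query decide Q adv f x]| <= #|S|].
Proof.
have [Om [phi [Om0 aphi iphi Hphi]]] := chain k (nscaleP F d) EL s.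
pose S : finType := (Om * {ffun 'I_Q -> V})%type.
pose query (x : S) (a : seq F) := point (phi x.1) x.2 (size a).
pose err (x : S) (a : seq F) (g : {ffun V -> F}) (i : nat) :=
  #|[set l : 'I_Q | (l < nsample F k d E i) && (nth 0%R a l != g (x.2 l))]|.
pose decide (x : S) (a : seq F) :=
  [exists g, (g \in rm F k d) && [forall i : 'I_L.+1, err x a g i <= allow F k d i]].
have cS : #|S| = #|Om| * (q ^ k) ^ Q by rewrite card_prod card_ffun card_rV card_ord.
have ansE adv f (x : S) (l : 'I_Q) :
    nth 0%R (run query adv f x Q).1.2 l =
    (state adv f (point (phi x.1) x.2) l).2 (phi x.1 (x.2 l)).
  rewrite (@runE _ _ adv f S query x (point (phi x.1) x.2) Q (fun=> erefl)) /=.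
  by rewrite nth_mkseq // pointE.
pose over adv f := [set x : S | [exists i : 'I_L.+1,
  allow F k d i < ncorrupted adv f (phi x.1) (nsample F k d E i) x.2]].
have card_fib (P : Om -> {set {ffun 'I_Q -> V}}) :
    (forall om, 10 * #|P om| <= (q ^ k) ^ Q) -> 10 * #|[set x : S | x.2 \in P x.1]| <= #|S|.
  move=> HP; rewrite cS -sum_nat_const.
  have -> : #|[set x : S | x.2 \in P x.1]| = \sum_om #|P om|.
    rewrite -sum1_card (eq_bigr (fun om => \sum_(u in P om) 1)); last by move=> om _; rewrite sum1_card.
    by rewrite pair_big_dep /=; apply: eq_bigl => p; rewrite !inE.
  by rewrite big_distrr /=; apply: leq_sum.
have card_over adv f : t_adversary t adv -> 10 * #|over adv f| <= #|S|.
  move=> tadv.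
  have := card_fib (fun om => [set u | [exists i : 'I_L.+1,
    allow F k d i < ncorrupted adv f (phi om) (nsample F k d E i) u]])
    (fun om => card_overcorrupted f tadv (iphi om)).
  by rewrite (_ : [set x : S | _] = over adv f) //; apply/setP => x; rewrite !inE.
exists S, query, decide; split.
- by rewrite cS muln_gt0 Om0 !expn_gt0 q0.
- move=> f fd adv tadv.
  set A := [set x | _].
  have sub : ~: A \subset over adv f.
    apply/subsetP => x; rewrite !inE; apply: contraR => /existsPn H.
    rewrite /accepts /decide; apply/existsP.
    exists [ffun v => f (phi x.1 v)]; rewrite rm_fun /=; last exact: (deg_le_comp (aphi x.1) fd).
    apply/forallP => i; have := H i; rewrite -leqNgt; apply: leq_trans.
    apply/subset_leq_card/subsetP => l; rewrite !inE ansE ffunE /corrupted pointE.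
    by [].
  have := leq_trans (leq_mul (leqnn 10) (subset_leq_card sub)) (card_over adv f tadv).
  by have := cardsC A; move: #|A| #|~: A| #|S| => a b c; lia.
move=> f ff adv tadv.
pose nf := [set om | ~~ rfar d (eta E) (fun u => f (phi om u))].
pose fool om : {set {ffun 'I_Q -> V}} :=
  if rfar d (eta E) (fun u => f (phi om u)) then fooled d E Q (fun u => f (phi om u)) else set0.
have c1 : 10 * #|[set x : S | x.2 \in fool x.1]| <= #|S|.
  apply: card_fib => om; rewrite /fool; case: ifP => [fr|_]; last by rewrite cards0 muln0.
  exact: card_fooled.
have c2 : 10 * #|[set x : S | x.1 \in nf]| <= #|S|.
  have -> : [set x : S | x.1 \in nf] = setX nf [set: {ffun 'I_Q -> V}].
    by apply/setP => x; rewrite !inE andbT.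
  rewrite cardsX cardsT card_ffun card_rV card_ord cS mulnA leq_mul2r; apply/orP; right.
  have fr : rfar d (thr E s) f.
    apply/rfarP => P Pd; have := ff P Pd; rewrite -(ler_nat rat) natrM natrX => H.
    have m0r : (0 < m%:R :> rat)%R by rewrite ltr0n.
    rewrite -(ler_pM2l m0r); apply: le_trans H.
    have K0 : (0 < q%:R ^+ n :> rat)%R by rewrite exprn_gt0 // ltr0n.
    rewrite mulrA -[X in (_ <= X)%R]mul1r ler_pM2r //.
    have E0r : (0 < E%:R :> rat)%R by rewrite ltr0n.
    rewrite /thr /eta mulrCA mulrC ler_pdivrMr // mul1r.
    move: mE; rewrite -(ler_nat rat) natrM; apply: le_trans; rewrite mulrC ler_pM2r //.
    by rewrite lerBlDr lerDl exprn_ge0 //; lra.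
  have := Hphi f fr; rewrite -/nf.
  have e1 : (chain_err F d k E * (1 - (8 / 9) ^+ s) <= 1 / 10)%R.
    case: sk => [->|H]; first by rewrite expr0 subrr mulr0; lra.
    have K0 : (0 < q%:R ^+ k :> rat)%R by rewrite exprn_gt0 // ltr0n.
    have e0 : (0 <= (8 / 9 : rat) ^+ s <= 1)%R.
      by apply/andP; split; [apply: exprn_ge0; lra | apply: exprn_ile1; lra].
    have : (chain_err F d k E <= 1 / 10)%R.
      rewrite /chain_err ler_pdivrMr //; move: H; rewrite -(ler_nat rat) natrM natrD natrM !natrX.
      by move: (q%:R ^+ k)%R (q%:R ^+ d)%R (E%:R : rat)%R => a b c; lra.
    have : (0 <= chain_err F d k E)%R.
      by rewrite divr_ge0 ?mulr_ge0 ?addr_ge0 ?mulr_ge0 ?exprn_ge0 ?ler0n.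
    by move: (chain_err _ _ _ _) ((8 / 9) ^+ s)%R e0 => a b; nra.
  move=> H; rewrite -(ler_nat rat) natrM.
  have : (#|nf|%:R <= 1 / 10 * #|Om|%:R :> rat)%R.
    by apply: le_trans H _; rewrite ler_wpM2r ?ler0n.
  by move: (#|nf|%:R : rat)%R (#|Om|%:R : rat)%R => a b; lra.
have sub : [set x | accepts query decide Q adv f x] \subset
    [set x : S | x.2 \in fool x.1] :|: ([set x : S | x.1 \in nf] :|: over adv f).
  apply/subsetP => x; rewrite inE => acc; rewrite !in_setU.
  case: (boolP (x \in over adv f)) => [_|xo]; first by rewrite !orbT.
  rewrite [x \in [set x | x.1 \in nf]]inE.
  case: (boolP (x.1 \in nf)) => [_|]; first by rewrite orbT.
  rewrite [x.1 \in nf]in_set negbK !orbF => fr; rewrite inE /fool fr inE.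
  (* Each disagreement of [g] with the restriction of [f] is either an error seen by the test or a
     corrupted answer. *)
  case/existsP: acc => g /andP[gr /forallP Hg]; apply/existsP; exists g; rewrite gr /=.
  apply/forallP => i; rewrite mul2n -addnn.
  move: xo; rewrite inE => /existsPn/(_ i); rewrite -leqNgt => Hi.
  apply: leq_trans (leq_add (Hg i) Hi); apply: leq_trans (leq_card_setU _ _).
  apply/subset_leq_card/subsetP => l; rewrite !inE ansE /corrupted pointE.
  case/andP=> -> /= fg; case: eqP => //= e; rewrite -e in fg.
  by rewrite eq_sym.
have := leq_trans (subset_leq_card sub) (leq_trans (leq_card_setU _ _) (leq_add (leqnn _) (leq_card_setU _ _))).
have := card_over adv f tadv; move: c1 c2.
move: #|[set x | accepts _ _ _ _ _ _]| #|[set x : S | x.2 \in _]| #|[set x : S | x.1 \in _]|.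
by move: #|over _ _| #|S| => a b c e g; lia.
Qed.

End Tester.

(** * Choice of the parameters *)

Section Absorption.
Variable K : realFieldType.
Local Open Scope ring_scope.

(** This and the next bounds trade [d + 2] and [k] for exponentials with bases near 1, small enough
    for the slack left in [room_bound] and [budget_small]. *)
Lemma shift_le_exp d : (d%:R + 2 <= 34 * (103 / 100) ^+ d :> K)%R.
Proof.
have p3 : 0 <= 3 / 100 :> K by lra.
have := bernoulli d p3.
rewrite (_ : 1 + 3 / 100 = 103 / 100 :> K); last by field.
have : 0 <= d%:R :> K by rewrite ler0n.
by move: (_ ^+ d) (d%:R : K) => a b; lra.
Qed.

Lemma dim_le_exp d x k : (4 * k <= 13 * d + 4 * 121 + 4 * 5 * x)%N ->
  (k%:R <= 121 * (103 / 100) ^+ d * (21 / 20) ^+ x :> K)%R.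
Proof.
rewrite -(ler_nat K) !natrD !natrM => H.
have p3 : 0 <= 3 / 100 :> K by lra.
have p1 : 0 <= 1 / 20 :> K by lra.
have := bernoulli d p3; have := bernoulli x p1.
rewrite (_ : 1 + 3 / 100 = 103 / 100 :> K); last by field.
rewrite (_ : 1 + 1 / 20 = 21 / 20 :> K); last by field.
have : 0 <= d%:R :> K by rewrite ler0n.
have : 0 <= x%:R :> K by rewrite ler0n.
move: (_ ^+ d) (_ ^+ x) H; move: (d%:R : K) (x%:R : K) (k%:R : K) => D X k' a b H X0 D0 hb ha.
have : (1 + D * (3 / 100)) * (1 + X * (1 / 20)) <= a * b by apply: ler_pM => //; lra.
have : 0 <= D * X by apply: mulr_ge0.
by lra.
Qed.

Lemma square_dim_le_exp d x k : (4 * k <= 13 * d + 4 * 121 + 4 * 5 * x)%N ->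
  ((d%:R + 2) ^+ 2 * k%:R <= 64 * 64 * 64 * (11 / 10) ^+ d * (21 / 20) ^+ x :> K)%R.
Proof.
move=> /dim_le_exp H2; have H1 := shift_le_exp d.
have d0 : 0 <= d%:R + 2 :> K by rewrite addr_ge0 ?ler0n.
have x0 : 0 <= (21 / 20) ^+ x :> K by apply: exprn_ge0; lra.
have a0 : 0 <= (103 / 100) ^+ d :> K by apply: exprn_ge0; lra.
have k0 : 0 <= k%:R :> K by rewrite ler0n.
have e3 : ((103 / 100) ^+ d) ^+ 3 <= (11 / 10) ^+ d :> K.
  by rewrite exprAC; apply: lerXn2r; rewrite ?nnegrE; lra.
move: H1 H2 d0 k0 x0 a0 e3; move: (k%:R : K) (d%:R + 2 : K).
move: ((21 / 20 : K) ^+ x) ((103 / 100 : K) ^+ d) ((11 / 10 : K) ^+ d).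
move=> b a c k' D H1 H2 d0 k0 x0 a0 e3.
have D2 : D ^+ 2 <= (34 * a) ^+ 2 by apply: lerXn2r; rewrite ?nnegrE //; lra.
have H : D ^+ 2 * k' <= (34 * a) ^+ 2 * (121 * a * b).
  by apply: ler_pM => //; apply: exprn_ge0.
apply: le_trans H _.
have -> : (34 * a) ^+ 2 * (121 * a * b) = 34 * 34 * 121 * (a ^+ 3 * b) by ring.
have ab : a ^+ 3 * b <= c * b by apply: ler_wpM2r.
have a3 : 0 <= a ^+ 3 * b by apply: mulr_ge0 => //; apply: exprn_ge0.
by move: (a ^+ 3 * b) ab a3 => w; lra.
Qed.

Lemma shift_dim_le_exp d x k : (4 * k <= 13 * d + 4 * 121 + 4 * 5 * x)%N ->
  ((d%:R + 2) * k%:R <= 128 * 64 * (16 / 15) ^+ d * (21 / 20) ^+ x :> K)%R.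
Proof.
move=> /dim_le_exp H2; have H1 := shift_le_exp d.
have d0 : 0 <= d%:R + 2 :> K by rewrite addr_ge0 ?ler0n.
have x0 : 0 <= (21 / 20) ^+ x :> K by apply: exprn_ge0; lra.
have a0 : 0 <= (103 / 100) ^+ d :> K by apply: exprn_ge0; lra.
have k0 : 0 <= k%:R :> K by rewrite ler0n.
have e3 : ((103 / 100) ^+ d) ^+ 2 <= (16 / 15) ^+ d :> K.
  by rewrite exprAC; apply: lerXn2r; rewrite ?nnegrE; lra.
move: H1 H2 d0 k0 x0 a0 e3; move: (k%:R : K) (d%:R + 2 : K).
move: ((21 / 20 : K) ^+ x) ((103 / 100 : K) ^+ d) ((16 / 15 : K) ^+ d).
move=> b a c k' D H1 H2 d0 k0 x0 a0 e3.
have H : D * k' <= (34 * a) * (121 * a * b) by apply: ler_pM.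
apply: le_trans H _.
have -> : (34 * a) * (121 * a * b) = 34 * 121 * (a ^+ 2 * b) by ring.
have ab : a ^+ 2 * b <= c * b by apply: ler_wpM2r.
have a3 : 0 <= a ^+ 2 * b by apply: mulr_ge0 => //; apply: exprn_ge0.
by move: (a ^+ 2 * b) ab a3 => w; lra.
Qed.

(** Fourth powers clear the denominator in [e >= c d / 4], as it occurs for the rounded [kbase]. *)
Lemma pow_quarter (a b : K) d e c : 0 <= a -> 1 <= b -> a ^+ 4 <= b ^+ c ->
  (c * d <= 4 * e)%N -> a ^+ d <= b ^+ e.
Proof.
move=> a0 b1 ab ce; have b0 : 0 <= b by lra.
rewrite -(@ler_pXn2r _ 4%N) ?nnegrE ?exprn_ge0 //.
rewrite -!exprM mulnC exprM [(e * 4)%N]mulnC.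
apply: (@le_trans _ _ (b ^+ (c * d))); last exact: ler_weXn2l.
by rewrite exprM; apply: lerXn2r; rewrite ?nnegrE ?exprn_ge0.
Qed.

Lemma pow_quarter_up (a b : K) d e c : 1 <= a -> 0 <= b -> a ^+ c <= b ^+ 4 ->
  (4 * e <= c * d)%N -> a ^+ e <= b ^+ d.
Proof.
move=> a1 b0 ab ce; have a0 : 0 <= a by lra.
rewrite -(@ler_pXn2r _ 4%N) ?nnegrE ?exprn_ge0 //.
rewrite -!exprM [(d * 4)%N]mulnC [X in _ <= X]exprM [(e * 4)%N]mulnC.
apply: (@le_trans _ _ (a ^+ (c * d))); first exact: ler_weXn2l.
by rewrite exprM; apply: lerXn2r; rewrite ?nnegrE ?exprn_ge0.
Qed.

End Absorption.

(** * Weighted counts of monomials of lowered degree *)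

Section MonomialBounds.
Variables (F : finFieldType) (K : realFieldType) (k d i : nat).
Local Open Scope ring_scope.
Local Notation q := #|F|.
Local Notation D := (nmono F k (d - i * q.-1)).
Hypothesis id : (i * q.-1 <= d)%N.

(** Lowering the degree by [i (q - 1)] gains [z^(i (q - 1))], which pays for the weight [c^i].
    Below, [c] is [q^2] for the corruptions and [q] for the query count. *)
Lemma gen_bound (c z : K) : 0 <= z <= 1 -> 0 <= c -> c * z ^+ q.-1 <= 1 ->
  c ^+ i * D%:R * z ^+ d <= (\sum_(a < q) z ^+ a) ^+ k.
Proof.
move=> z01 c0 cz; have z0 : 0 <= z by case/andP: z01.
apply: le_trans (nmono_gen F k (d - i * q.-1) z01).
have -> : c ^+ i * D%:R * z ^+ d = (c * z ^+ q.-1) ^+ i * (D%:R * z ^+ (d - i * q.-1)).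
  have -> : z ^+ d = z ^+ (i * q.-1) * z ^+ (d - i * q.-1) by rewrite -exprD subnKC.
  by rewrite exprMn -exprM [(q.-1 * i)%N]mulnC; ring.
rewrite -[X in _ <= X]mul1r; apply: ler_wpM2r; first by rewrite mulr_ge0 ?exprn_ge0 ?ler0n.
by apply: exprn_ile1 => //; rewrite mulr_ge0 // exprn_ge0.
Qed.

Lemma geo_bound (z : K) : 0 <= z < 1 -> \sum_(a < q) z ^+ a <= (1 - z)^-1.
Proof.
case/andP=> z0 z1; rewrite -[X in _ <= X]mul1r ler_pdivlMr ?subr_gt0 //.
have := subrX1 z q; rewrite -[X in X = _]opprB -[X in _ = X * _]opprB mulNr => /oppr_inj.
by rewrite mulrC => <-; rewrite gerBl exprn_ge0.
Qed.

Lemma gen_bound_geo (c z : K) : 0 < z < 1 -> 0 <= c -> c * z ^+ q.-1 <= 1 ->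
  c ^+ i * D%:R <= z^-1 ^+ d * (1 - z)^-1 ^+ k.
Proof.
case/andP=> z0 z1 c0 cz; have zz : 0 <= z <= 1 by rewrite !ltW.
have H := gen_bound zz c0 cz; have G : \sum_(a < q) z ^+ a <= (1 - z)^-1.
  by apply: geo_bound; rewrite ltW.
rewrite [z^-1 ^+ d]exprVn [X in _ <= X]mulrC ler_pdivlMr ?exprn_gt0 //; apply: le_trans H _.
apply: lerXn2r G; rewrite nnegrE; last by rewrite invr_ge0 subr_ge0 ltW.
by apply: sumr_ge0 => a _; apply: exprn_ge0; apply: ltW.
Qed.

Lemma q_leq_pow : (q <= 2 ^ q.-1)%N.
Proof. by rewrite -{1}(prednK (ltnW (card_field_gt1 F))) ltn_expl. Qed.

Lemma q2_leq_pow : (2 < q)%N -> (q ^ 2 <= 3 ^ q.-1)%N.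
Proof.
move: q => [|[|[|m]]] // _; elim: m => [//|m IH].
have H : (m.+4 ^ 2 <= 3 * m.+3 ^ 2)%N by rewrite -!mulnn; nia.
by apply: leq_trans H _; rewrite [(m.+4).-1]/= expnS leq_mul2l.
Qed.

Lemma square_bound2 : q = 2 -> q%:R ^+ (2 * i) * D%:R <= 4 ^+ d * (5 / 4) ^+ k :> K.
Proof.
move=> q2; have := @gen_bound 4 4^-1.
rewrite q2 /= expr1 big_ord_recr big_ord_recr big_ord0 /= add0r expr0 expr1 => H.
have {}H : 4 ^+ i * (nmono F k (d - i * 1))%:R * 4^-1 ^+ d <= (1 + 4^-1) ^+ k :> K by apply: H; lra.
have -> : 5 / 4 = 1 + 4^-1 :> K by field.
rewrite exprM (_ : 2%:R ^+ 2 = 4 :> K); last by ring.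
move: H; rewrite exprVn ler_pdivrMr ?exprn_gt0 //.
by rewrite [X in _ <= X]mulrC.
Qed.

Lemma square_bound3 : (2 < q)%N -> q%:R ^+ (2 * i) * D%:R <= 3 ^+ d * (3 / 2) ^+ k :> K.
Proof.
move=> q2; rewrite exprM.
have -> : 3 / 2 = (1 - 3^-1)^-1 :> K by field.
rewrite -[X in _ <= X ^+ d * _]invrK; apply: gen_bound_geo; rewrite ?exprn_ge0 ?ler0n //; first lra.
by rewrite exprVn ler_pdivrMr ?exprn_gt0 // mul1r -!natrX ler_nat q2_leq_pow.
Qed.

Lemma linear_bound2 : q = 2 -> q%:R ^+ i * D%:R <= 2 ^+ d * (3 / 2) ^+ k :> K.
Proof.
move=> q2; have := @gen_bound 2 2^-1.
rewrite q2 /= expr1 big_ord_recr big_ord_recr big_ord0 /= add0r expr0 expr1 => H.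
have {}H : 2 ^+ i * (nmono F k (d - i * 1))%:R * 2^-1 ^+ d <= (1 + 2^-1) ^+ k :> K by apply: H; lra.
have -> : 3 / 2 = 1 + 2^-1 :> K by field.
move: H; rewrite exprVn ler_pdivrMr ?exprn_gt0 //.
by rewrite [X in _ <= X]mulrC.
Qed.

Lemma linear_bound : q%:R ^+ i * D%:R <= 2 ^+ d * 2 ^+ k :> K.
Proof.
have -> : 2 = (1 - 2^-1)^-1 :> K by field.
rewrite -[X in _ <= X ^+ d * _]invrK.
have -> : ((1 - 2^-1)^-1)^-1 = 2^-1 :> K by field.
apply: gen_bound_geo; rewrite ?ler0n //; first lra.
by rewrite exprVn ler_pdivrMr ?exprn_gt0 // mul1r -!natrX ler_nat q_leq_pow.
Qed.

(** [z = 1 / (2 k)] makes [(1 - z)^k] at least 1/2, which gives a bound polynomial in [k] of degree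
    [d]. *)
Lemma poly_bound : (0 < k)%N -> q%:R ^+ i * D%:R <= 2 * (2 * k%:R) ^+ d :> K.
Proof.
move=> k0; have k1 : 1 <= k%:R :> K by rewrite ler1n.
pose z : K := (2 * k%:R)^-1.
have kz : k%:R * z = 2^-1 by rewrite /z; field; lra.
have z0 : 0 < z by rewrite invr_gt0; lra.
have z2 : z <= 2^-1 by rewrite lef_pV2 ?posrE; lra.
have H := @gen_bound_geo q%:R z.
have {}H : q%:R ^+ i * D%:R <= z^-1 ^+ d * (1 - z)^-1 ^+ k.
  apply: H; rewrite ?ler0n //; first lra.
  rewrite exprVn ler_pdivrMr ?mul1r; last by apply: exprn_gt0; lra.
  apply: (@le_trans _ _ (2 ^+ q.-1)); first by rewrite -natrX ler_nat q_leq_pow.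
  by apply: lerXn2r; rewrite ?nnegrE; lra.
apply: le_trans H _; rewrite /z invrK mulrC; apply: ler_wpM2r; first by apply: exprn_ge0; lra.
have lb m : 1 - m%:R * z <= (1 - z) ^+ m.
  elim: m => [|m IH]; first by rewrite mul0r subr0.
  rewrite exprS; apply: (@le_trans _ _ ((1 - z) * (1 - m%:R * z))).
    rewrite -natr1; have : 0 <= m%:R * (z * z) by rewrite mulr_ge0 ?ler0n // mulr_ge0 // ltW.
    by move: m%:R => x; lra.
  by apply: ler_wpM2l => //; lra.
have := lb k; rewrite kz => H; rewrite exprVn -[X in _ <= X]invrK.
by rewrite lef_pV2 ?posrE; lra.
Qed.

End MonomialBounds.

(** * Choice of the dimension: room for the corruptions *)

Section Room.
Variables (F : finFieldType) (K : realFieldType).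
Local Open Scope ring_scope.
Local Notation q := #|F|.

(* For [q = 2] the slope must satisfy both [(8/5)^slope > 4], which leaves room for the
   corruptions, and [(3/2)^slope < 4], which keeps the number of samples below [8^d]. *)
Definition kbase d : nat := (if q == 2 then 13 * d %/ 4 else 7 * d %/ 4)%N.
Definition kpar d x : nat := (kbase d + 121 + 5 * x)%N.

Lemma kpar_le d x : (4 * kpar d x <= 13 * d + 4 * 121 + 4 * 5 * x)%N.
Proof. by rewrite /kpar /kbase; case: ifP => _; lia. Qed.

Lemma kbase_ge d : (d <= kbase d)%N.
Proof. by rewrite /kbase; case: ifP => _; lia. Qed.

Lemma q_gt2 : q != 2 -> (2 < q)%N.
Proof. by move=> q2; rewrite ltn_neqAle eq_sym q2 card_field_gt1. Qed.

Lemma exprX5 (g : K) x : g ^+ (5 * x) = g ^+ x * (g ^+ 2) ^+ (2 * x).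
Proof. by rewrite -exprM -exprD mulnA -mulSn. Qed.

(** Divide [q^k] by the factor [(5/4)^k] or [(3/2)^k] of the monomial count. In the quotient, the
    [kbase + 1] part of [k] pays for the powers [^ d], 120 for the constants and [q^4], and [5 x]
    for [T] and the leftover [(21/20)^x]. *)
Lemma room_bound d x i (T : K) : (i * q.-1 <= d)%N -> 0 <= T <= q%:R ^+ (2 * x) ->
  2 ^+ 20 * (d%:R + 2) ^+ 2 * T * (kpar d x)%:R * q%:R ^+ 4 *
    (q%:R ^+ (2 * i) * (nmono F (kpar d x) (d - i * q.-1))%:R) <= q%:R ^+ kpar d x.
Proof.
move=> id /andP[T0 Tx]; set k := kpar d x; set y := q%:R ^+ (2 * i) * _.
have y0 : 0 <= y by rewrite mulr_ge0 ?exprn_ge0 ?ler0n.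
have A := square_dim_le_exp K (kpar_le d x); rewrite -/k in A.
set a := (d%:R + 2) ^+ 2 * k%:R in A; have a0 : 0 <= a by rewrite mulr_ge0 ?exprn_ge0 ?ler0n // addr_ge0 ?ler0n.
have -> : 2 ^+ 20 * (d%:R + 2) ^+ 2 * T * k%:R * q%:R ^+ 4 * y = 2 ^+ 20 * q%:R ^+ 4 * (a * T * y).
  by rewrite /a; ring.
have kE : k = ((kbase d).+1 + 120 + 5 * x)%N by rewrite /k /kpar; lia.
have e2 : 64 * 64 * 64 = 2 ^+ 18 :> K by ring.
rewrite e2 in A.
case: (eqVneq q 2) => [q2|/q_gt2 q3].
- have Y : y <= _ := square_bound2 K k id q2.
  have kb : kbase d = (13 * d %/ 4)%N by rewrite /kbase q2.
  have P1 : (23 / 5) ^+ d <= (8 / 5) ^+ (kbase d).+1 :> K.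
    apply: (@pow_quarter _ _ _ _ _ 13); [lra | lra | | by rewrite kb; lia].
    by rewrite !exprS expr0; lra.
  have P2 : 2 ^+ 60 <= (8 / 5) ^+ 120 :> K.
    have -> : (8 / 5) ^+ 120 = ((8 / 5) ^+ 2) ^+ 60 :> K by rewrite -exprM.
    by apply: lerXn2r; rewrite ?nnegrE; lra.
  have P3 : (21 / 5) ^+ x <= (8 / 5) ^+ (5 * x) :> K.
    rewrite exprM; apply: lerXn2r; rewrite ?nnegrE; [lra | apply: exprn_ge0; lra |].
    by rewrite !exprS expr0; lra.
  have Tx' : T <= 4 ^+ x by rewrite q2 exprM (_ : 2%:R ^+ 2 = 4 :> K) in Tx; last by ring.
  apply: (@le_trans _ _ (2 ^+ 20 * q%:R ^+ 4 *
    (2 ^+ 18 * (11 / 10) ^+ d * (21 / 20) ^+ x * 4 ^+ x * (4 ^+ d * (5 / 4) ^+ k)))).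
    apply: ler_wpM2l; first by rewrite mulr_ge0 ?exprn_ge0 ?ler0n.
    by apply: ler_pM => //; [apply: mulr_ge0 | apply: ler_pM].
  have -> : 2 ^+ 20 * q%:R ^+ 4 *
    (2 ^+ 18 * (11 / 10) ^+ d * (21 / 20) ^+ x * 4 ^+ x * (4 ^+ d * (5 / 4) ^+ k))
    = (5 / 4) ^+ k * (((11 / 10) ^+ d * 4 ^+ d) * 2 ^+ 42 * ((21 / 20) ^+ x * 4 ^+ x)) :> K.
    by rewrite q2; move: (_ ^+ d) (_ ^+ d) (_ ^+ x) (_ ^+ x) (_ ^+ k) => ? ? ? ? ?; ring.
  have -> : q%:R ^+ k = (5 / 4) ^+ k * ((8 / 5) ^+ (kbase d).+1 * (8 / 5) ^+ 120 * (8 / 5) ^+ (5 * x)) :> K.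
    by rewrite -!exprD -kE -exprMn q2; congr (_ ^+ _); field.
  apply: ler_wpM2l; first by apply: exprn_ge0; lra.
  rewrite -!exprMn; apply: ler_pM; [apply: mulr_ge0; apply: exprn_ge0; lra | apply: exprn_ge0; lra | |].
    apply: ler_pM; [apply: exprn_ge0; lra | apply: exprn_ge0; lra | |].
      by apply: le_trans P1; apply: lerXn2r; rewrite ?nnegrE; lra.
    by apply: le_trans P2; apply: ler_weXn2l; rewrite ?ler1n.
  by apply: le_trans P3; apply: lerXn2r; rewrite ?nnegrE; lra.
have Y : y <= _ := square_bound3 K k id q3.
have kb : kbase d = (7 * d %/ 4)%N by rewrite /kbase; case: eqP q3 => // ->.
(* As [g^2 >= q], four of every five factors [g] pay for [q^2], and the fifth is spare. *)
pose g : K := 2 * q%:R / 3.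
have q3r : 3 <= q%:R :> K by rewrite (ler_nat _ 3).
have g2 : 2 <= g by rewrite /g; lra.
have gq : q%:R <= g ^+ 2.
  have -> : g ^+ 2 = q%:R * (4 * q%:R / 9) by rewrite /g; field.
  by rewrite -{1}[q%:R]mulr1; apply: ler_wpM2l; lra.
have P1 : (84 / 25) ^+ d <= g ^+ (kbase d).+1.
  apply: (@le_trans _ _ (2 ^+ (kbase d).+1)); last by apply: lerXn2r; rewrite ?nnegrE; lra.
  apply: (@pow_quarter _ _ _ _ _ 7); [lra | lra | | by rewrite kb; lia].
  by rewrite !exprS expr0; lra.
have P2 : 2 ^+ 112 * q%:R ^+ 4 <= g ^+ 120.
  have -> : g ^+ 120 = g ^+ 112 * (g ^+ 2) ^+ 4 by rewrite -exprM -exprD.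
  have g0 : 0 <= g ^+ 2 by apply: exprn_ge0; lra.
  apply: ler_pM; [apply: exprn_ge0; lra | apply: exprn_ge0; lra | |].
    by apply: lerXn2r; rewrite ?nnegrE; lra.
  by apply: lerXn2r; rewrite ?nnegrE //; lra.
have P3 : (21 / 20) ^+ x * q%:R ^+ (2 * x) <= g ^+ (5 * x).
  rewrite exprX5; apply: ler_pM; [apply: exprn_ge0; lra | apply: exprn_ge0; lra | |].
    by apply: lerXn2r; rewrite ?nnegrE; lra.
  by apply: lerXn2r; rewrite ?nnegrE ?exprn_ge0 //; lra.
apply: (@le_trans _ _ (2 ^+ 20 * q%:R ^+ 4 *
  (2 ^+ 18 * (11 / 10) ^+ d * (21 / 20) ^+ x * q%:R ^+ (2 * x) * (3 ^+ d * (3 / 2) ^+ k)))).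
  apply: ler_wpM2l; first by rewrite mulr_ge0 ?exprn_ge0 ?ler0n.
  by apply: ler_pM => //; [apply: mulr_ge0 | apply: ler_pM].
have -> : 2 ^+ 20 * q%:R ^+ 4 *
    (2 ^+ 18 * (11 / 10) ^+ d * (21 / 20) ^+ x * q%:R ^+ (2 * x) * (3 ^+ d * (3 / 2) ^+ k))
    = (3 / 2) ^+ k * (((11 / 10) ^+ d * 3 ^+ d) * (2 ^+ 38 * q%:R ^+ 4) *
        ((21 / 20) ^+ x * q%:R ^+ (2 * x))) :> K.
  by move: (_ ^+ d) (_ ^+ d) (_ ^+ x) (_ ^+ (2 * x)) (_ ^+ k) => ? ? ? ? ?; ring.
have -> : q%:R ^+ k = (3 / 2) ^+ k * (g ^+ (kbase d).+1 * g ^+ 120 * g ^+ (5 * x)).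
  by rewrite -!exprD -kE -exprMn; congr (_ ^+ _); rewrite /g; field.
apply: ler_wpM2l; first by apply: exprn_ge0; lra.
have p38 : 2 ^+ 38 <= 2 ^+ 112 :> K by apply: ler_weXn2l; rewrite ?ler1n.
rewrite -[(11 / 10) ^+ d * _]exprMn; apply: ler_pM => //.
- by apply: mulr_ge0; [apply: exprn_ge0; lra | rewrite mulr_ge0 ?exprn_ge0 ?ler0n].
- by apply: mulr_ge0; apply: exprn_ge0; lra.
apply: ler_pM; [apply: exprn_ge0; lra | by rewrite mulr_ge0 ?exprn_ge0 ?ler0n | |].
  by apply: le_trans P1; apply: lerXn2r; rewrite ?nnegrE; lra.
by apply: le_trans P2; apply: ler_wpM2r => //; rewrite exprn_ge0 ?ler0n.
Qed.

End Room.

(** * Corruption condition and query count for the chosen dimension *)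

Section Budget.
Variables (F : finFieldType) (K : realFieldType).
Local Open Scope ring_scope.
Local Notation q := #|F|.

Let q2 : 2 <= q%:R :> K. Proof. by rewrite (ler_nat _ 2) card_field_gt1. Qed.

Lemma nscale_le d : (nscale F d <= d.+1)%N.
Proof. by rewrite /nscale ltnS leq_div. Qed.

Lemma expr_split (a : K) l : a ^+ 4 * a ^+ (2 * l) = (a ^+ l.+2) ^+ 2.
Proof. by rewrite -exprD -exprM; congr (_ ^+ _); lia. Qed.

(** One factor [allow] of [nsample^2] cancels; the other, times [q^(2 i)], is the weighted count of
    [room_bound]. *)
Lemma room_nsample d x m t i : (0 < m)%N -> (t * m ^ 2 <= q ^ (2 * x))%N ->
  (i <= nscale F d)%N ->
  5 * (nscale F d).+1%:R * t%:R *
    (nsample F (kpar F d x) d (8 * m * q ^ (nscale F d).+1) i)%:R ^+ 2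
  <= q%:R ^+ kpar F d x * (allow F (kpar F d x) d i)%:R :> K.
Proof.
move=> m0 tmx iL; set k := kpar F d x; set L := nscale F d.
have L1 : L.+1%:R <= d%:R + 2 :> K by rewrite -(natrD _ d 2) ler_nat addn2 ltnS nscale_le.
have d2 : 2 <= d%:R + 2 :> K by rewrite lerDr ler0n.
have m1 : 1 <= m%:R :> K by rewrite ler1n.
have t0 : 0 <= t%:R :> K by rewrite ler0n.
have k1 : 1 <= k%:R :> K by rewrite ler1n /k /kpar; lia.
have Tx : 0 <= (t%:R * m%:R ^+ 2 : K) <= q%:R ^+ (2 * x).
  by rewrite mulr_ge0 ?exprn_ge0 ?ler0n //= -!natrX -natrM ler_nat.
have L0 : 0 <= L.+1%:R :> K by rewrite ler0n.
have c20 : 5 * 384 * 384 <= 2 ^+ 20 :> K.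
  have -> : 2 ^+ 20 = 32 * 32 * 32 * 32 :> K by ring.
  by lra.
rewrite /nsample /allow; case: (ltnP i L) => il.
  have id := lt_nscale il.
  have := room_bound id Tx; rewrite -/k.
  set D := nmono F k _; have D0 : 0 <= D%:R :> K by rewrite ler0n.
  have i1 : i.+1%:R <= d%:R + 2 :> K.
    by apply: le_trans L1; rewrite ler_nat ltnW.
  have i0 : 0 <= i.+1%:R :> K by rewrite ler0n.
  have y0 : 0 <= q%:R ^+ (2 * i) :> K by rewrite exprn_ge0 // ler0n.
  have z0 : 0 <= q%:R ^+ 4 :> K by rewrite exprn_ge0 // ler0n.
  move=> H.
  have -> : (384 * q ^ i.+1 * (i.+1 * q ^ 2 * k * D))%:R ^+ 2 =
    (384 * 384 * (q%:R ^+ (2 * i) * D%:R) * (i.+1%:R * k%:R * q%:R ^+ 4)) *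
      (i.+1 * q ^ 2 * k * D)%:R :> K.
    rewrite !natrM !natrX exprM (exprS q%:R i).
    have -> : (q%:R ^+ 2) ^+ i = (q%:R ^+ i) ^+ 2 :> K by rewrite exprAC.
    by move: (q%:R ^+ i) (i.+1%:R : K) => u v; ring.
  rewrite mulrA; apply: ler_wpM2r; first by rewrite ler0n.
  apply: le_trans H.
  set Y := q%:R ^+ (2 * i) * D%:R in y0 *; have Y0 : 0 <= Y by rewrite mulr_ge0.
  set W := q%:R ^+ 4 in z0 *.
  have -> : 5 * L.+1%:R * t%:R * (384 * 384 * Y * (i.+1%:R * k%:R * W)) =
    (5 * 384 * 384) * (L.+1%:R * i.+1%:R) * (t%:R * 1) * k%:R * W * Y by ring.
  apply: ler_wpM2r => //; apply: ler_wpM2r => //; apply: ler_wpM2r; first by lra.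
  have m2 : 1 <= m%:R ^+ 2 :> K by apply: exprn_ege1.
  apply: ler_pM; [by rewrite !mulr_ge0 | by lra | | by apply: ler_wpM2l].
  apply: ler_pM; [lra | by apply: mulr_ge0 | exact: c20 |].
  by rewrite expr2; apply: ler_pM.
(* The last scale is paid for by the estimate at [L - 1], since
   [q^(2 (L + 1)) = q^4 q^(2 (L - 1))]. *)
have {}il : (L.-1 < L)%N by [].
have := room_bound (lt_nscale il) Tx; rewrite -/k.
set D := nmono F k _; have D1 : 1 <= D%:R :> K by rewrite ler1n nmono_gt0.
rewrite mulr1; apply: le_trans.
have -> : (12 * (8 * m * q ^ L.+1))%:R ^+ 2 = 96 * 96 * m%:R ^+ 2 * (q%:R ^+ 4 * q%:R ^+ (2 * L.-1)) :> K.
  rewrite expr_split -[L.-1.+2]/(L.+1) (natrM _ 12) (natrM _ (8 * m)) (natrM _ 8) natrX.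
  by move: (q%:R ^+ L.+1) (m%:R : K) => u v; ring.
have y0 : 0 <= q%:R ^+ (2 * L.-1) :> K by rewrite exprn_ge0 // ler0n.
have z0 : 0 <= q%:R ^+ 4 :> K by rewrite exprn_ge0 // ler0n.
set Y := q%:R ^+ (2 * L.-1) in y0 *; set W := q%:R ^+ 4 in z0 *.
have -> : 5 * L.+1%:R * t%:R * (96 * 96 * m%:R ^+ 2 * (W * Y)) =
  (5 * 96 * 96) * (L.+1%:R * 1) * (t%:R * m%:R ^+ 2) * 1 * W * (Y * 1) by ring.
have T0 : 0 <= t%:R * m%:R ^+ 2 :> K by case/andP: Tx.
set T := t%:R * m%:R ^+ 2 in T0 *.
have LT : 0 <= (5 * 96 * 96) * (L.+1%:R * 1) * T by rewrite !mulr_ge0.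
apply: ler_pM; [by rewrite mulr_ge0 // mulr1 | by rewrite mulr1 | | by apply: ler_wpM2l].
apply: ler_wpM2r => //; apply: ler_pM => //.
apply: ler_wpM2r => //; apply: ler_pM; [lra | by rewrite mulr1 | lra |].
by rewrite expr2; apply: ler_pM => //; lra.
Qed.

Lemma nsample_le d k E i : (i < nscale F d)%N ->
  (nsample F k d E i)%:R <=
    384 * q%:R ^+ 3 * ((d%:R + 2) * k%:R) * (q%:R ^+ i * (nmono F k (d - i * q.-1))%:R) :> K.
Proof.
move=> il; rewrite /nsample /allow il !natrM !natrX (exprS _ i).
have i1 : i.+1%:R <= d%:R + 2 :> K.
  rewrite -(natrD _ d 2) ler_nat; apply: (leq_trans il); apply: (leq_trans (nscale_le d)); lia.
set D := (nmono _ _ _)%:R; have D0 : 0 <= D by rewrite ler0n.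
have -> : 384%:R * (q%:R * q%:R ^+ i) * (i.+1%:R * q%:R ^+ 2 * k%:R * D)
   = 384 * q%:R ^+ 3 * (i.+1%:R * k%:R) * (q%:R ^+ i * D) :> K.
  by move: (q%:R ^+ i) (i.+1%:R : K) => u v; ring.
apply: ler_wpM2r; first by rewrite mulr_ge0 ?exprn_ge0 ?ler0n.
apply: ler_wpM2l; first by rewrite mulr_ge0 ?exprn_ge0 ?ler0n.
by apply: ler_wpM2r; rewrite ?ler0n.
Qed.

Lemma nsample_last k d m :
  (nsample F k d (8 * m * q ^ (nscale F d).+1) (nscale F d))%:R <= 96 * m%:R * q%:R ^+ 2 * 2 ^+ d :> K.
Proof.
rewrite /nsample ltnn (natrM _ 12) (natrM _ (8 * m)) (natrM _ 8) natrX.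
have -> : 12%:R * (8%:R * m%:R * q%:R ^+ (nscale F d).+1) =
   96 * m%:R * q%:R ^+ 2 * q%:R ^+ (nscale F d).-1 :> K.
  by rewrite /nscale /= !exprS; ring.
apply: ler_wpM2l; first by rewrite !mulr_ge0 ?exprn_ge0 ?ler0n.
rewrite -!natrX ler_nat /nscale /=.
apply: (@leq_trans ((2 ^ q.-1) ^ (d %/ q.-1))).
  case: (posnP (d %/ q.-1)) => [->//|e0]; by rewrite leq_exp2r // q_leq_pow.
by rewrite -expnM leq_exp2l // mulnC leq_trunc_div.
Qed.

Definition growth : K := if q == 2 then 3 / 2 else 2.

Lemma linear_growth k d i : (i * q.-1 <= d)%N ->
  q%:R ^+ i * (nmono F k (d - i * q.-1))%:R <= 2 ^+ d * growth ^+ k :> K.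
Proof.
move=> id; rewrite /growth; case: eqP => q2'; first exact: linear_bound2.
exact: linear_bound.
Qed.

(** The factor [k] is absorbed by [(5/4)^k]; as [5/4 * growth] is at most [q] and at most [5/2], the
    [y] part costs [q m] and the [d] part leaves [(d + 2) 5^d <= 2 * 8^d]. *)
Lemma budget_classical d k m y E i : (i < nscale F d)%N -> (k <= d + 18 + y)%N ->
  (q ^ y <= q * m)%N ->
  (nsample F k d E i)%:R <= 384 * 8 * 3 ^+ 18 * m%:R * q%:R ^+ 4 * 8 ^+ d :> K.
Proof.
move=> il ky qy; apply: le_trans (nsample_le k E il) _.
have Y := linear_growth k (lt_nscale il); set y1 := q%:R ^+ i * _ in Y *.
have y10 : 0 <= y1 by rewrite mulr_ge0 ?exprn_ge0 ?ler0n.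
pose sg : K := 5 / 4 * growth.
have r0 : 3 / 2 <= growth <= 2 by rewrite /growth; case: ifP => _; lra.
have sq : sg <= q%:R.
  rewrite /sg /growth; case: eqP => [_|/eqP/q_gt2 q3]; first by move: q2; lra.
  by have : 3 <= q%:R :> K by [rewrite (ler_nat _ 3)]; lra.
have s1 : 1 <= sg <= 5 / 2 by rewrite /sg; lra.
have k4 : k%:R <= 4 * (5 / 4) ^+ k :> K.
  have p : 0 <= 1 / 4 :> K by lra.
  have := bernoulli k p; rewrite (_ : 1 + 1 / 4 = 5 / 4 :> K); last by field.
  by move: (_ ^+ k) => w; have : 0 <= k%:R :> K by [rewrite ler0n]; lra.
have ky1 : k%:R * y1 <= 4 * (2 ^+ d * sg ^+ k).
  have -> : 4 * (2 ^+ d * sg ^+ k) = 4 * (5 / 4) ^+ k * (2 ^+ d * growth ^+ k) by rewrite /sg exprMn; ring.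
  by apply: ler_pM; rewrite ?ler0n.
have sk : sg ^+ k <= 3 ^+ 18 * (5 / 2) ^+ d * (q%:R * m%:R).
  apply: (@le_trans _ _ (sg ^+ (d + 18 + y))); first by apply: ler_weXn2l => //; lra.
  rewrite !exprD [_ * sg ^+ 18]mulrC; apply: ler_pM; [by rewrite mulr_ge0 // exprn_ge0; lra| by apply: exprn_ge0; lra| |].
    apply: ler_pM; [apply: exprn_ge0; lra | apply: exprn_ge0; lra | |];
      by apply: lerXn2r; rewrite ?nnegrE; lra.
  apply: (@le_trans _ _ (q%:R ^+ y)); first by apply: lerXn2r; rewrite ?nnegrE; move: q2; lra.
  by rewrite -natrX -natrM ler_nat.
have d5 : (d%:R + 2) * 5 ^+ d <= 2 * 8 ^+ d :> K.
  have p : 0 <= 3 / 5 :> K by lra.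
  have := bernoulli d p; rewrite (_ : 1 + 3 / 5 = 8 / 5 :> K); last by field.
  have -> : 8 ^+ d = (8 / 5) ^+ d * 5 ^+ d :> K by rewrite -exprMn; congr (_ ^+ _); field.
  move=> b; rewrite mulrA; apply: ler_wpM2r; first by apply: exprn_ge0; lra.
  by move: (_ ^+ d) b => w; have : 0 <= d%:R :> K by [rewrite ler0n]; lra.
have -> : 384 * q%:R ^+ 3 * ((d%:R + 2) * k%:R) * y1
  = 384 * q%:R ^+ 3 * ((d%:R + 2) * (k%:R * y1)) by ring.
have -> : 384 * 8 * 3 ^+ 18 * m%:R * q%:R ^+ 4 * 8 ^+ d
  = 384 * q%:R ^+ 3 * (4 * (3 ^+ 18 * (q%:R * m%:R)) * (2 * 8 ^+ d)) :> K.
  by move: (8 ^+ d) (3 ^+ 18) => u v; ring.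
apply: ler_wpM2l; first by rewrite mulr_ge0 ?exprn_ge0 ?ler0n.
apply: (@le_trans _ _ ((d%:R + 2) * (4 * (2 ^+ d * (3 ^+ 18 * (5 / 2) ^+ d * (q%:R * m%:R)))))).
  apply: ler_wpM2l; first by rewrite addr_ge0 ?ler0n.
  apply: le_trans ky1 _; apply: ler_wpM2l => //.
  by apply: ler_wpM2l sk; rewrite exprn_ge0.
have -> : (d%:R + 2) * (4 * (2 ^+ d * (3 ^+ 18 * (5 / 2) ^+ d * (q%:R * m%:R)))) =
  4 * (3 ^+ 18 * (q%:R * m%:R)) * ((d%:R + 2) * 5 ^+ d) :> K.
  have -> : 5 ^+ d = 2 ^+ d * (5 / 2) ^+ d :> K by rewrite -exprMn; congr (_ ^+ _); field.
  by move: (2 ^+ d) ((5 / 2) ^+ d) (3 ^+ 18) => u v w; ring.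
by apply: ler_wpM2l d5; rewrite !mulr_ge0 ?exprn_ge0 ?ler0n.
Qed.

End Budget.

Section BudgetOnline.
Variables (F : finFieldType) (K : realFieldType).
Local Open Scope ring_scope.
Local Notation q := #|F|.
Local Notation rho := (growth F K).

(** The bases multiply to exactly [8 = 16/15 * 2 * 15/4]: polynomial factors, degree weight and
    [growth^kbase]. All else is bounded in terms of [X]. *)
Lemma budget_small d x X E i : (i < nscale F d)%N -> (x <= X)%N ->
  (nsample F (kpar F d x) d E i)%:R <=
    384 * (128 * 64 * 2 ^+ X * 2 ^+ 121 * 2 ^+ (5 * X)) * q%:R ^+ 3 * 8 ^+ d :> K.
Proof.
move=> il xX; set k := kpar F d x; apply: le_trans (nsample_le K k E il) _.
have Y := linear_growth K k (lt_nscale il); set y1 := q%:R ^+ i * _ in Y *.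
have y10 : 0 <= y1 by rewrite mulr_ge0 ?exprn_ge0 ?ler0n.
have A := shift_dim_le_exp K (kpar_le F d x); rewrite -/k in A.
have r0 : 3 / 2 <= rho <= 2 by rewrite /growth; case: ifP => _; lra.
have rb : rho ^+ kbase F d <= (15 / 4) ^+ d.
  rewrite /growth /kbase; case: ifP => _.
    apply: (@pow_quarter_up _ _ _ _ _ 13); [lra | lra | | lia].
    by rewrite !exprS expr0; lra.
  apply: (@pow_quarter_up _ _ _ _ _ 7); [lra | lra | | lia].
  by rewrite !exprS expr0; lra.
have rx : rho ^+ (5 * x) <= 2 ^+ (5 * X).
  apply: (@le_trans _ _ (2 ^+ (5 * x))); first by apply: lerXn2r; rewrite ?nnegrE; lra.
  by apply: ler_weXn2l; [lra | rewrite leq_mul2l xX orbT].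
have r121 : rho ^+ 121 <= 2 ^+ 121 by apply: lerXn2r; rewrite ?nnegrE; lra.
have xx : (21 / 20) ^+ x <= 2 ^+ X :> K.
  apply: (@le_trans _ _ (2 ^+ x)); first by apply: lerXn2r; rewrite ?nnegrE; lra.
  by apply: ler_weXn2l => //; lra.
have rk : rho ^+ k = rho ^+ kbase F d * rho ^+ 121 * rho ^+ (5 * x) by rewrite -!exprD.
have rn n : 0 <= rho ^+ n by apply: exprn_ge0; lra.
have -> : 384 * q%:R ^+ 3 * ((d%:R + 2) * k%:R) * y1
  = 384 * q%:R ^+ 3 * ((d%:R + 2) * k%:R * y1) by ring.
have -> : 384 * (128 * 64 * 2 ^+ X * 2 ^+ 121 * 2 ^+ (5 * X)) * q%:R ^+ 3 * 8 ^+ d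
  = 384 * q%:R ^+ 3 * (128 * 64 * (16 / 15) ^+ d * 2 ^+ X *
      (2 ^+ d * ((15 / 4) ^+ d * 2 ^+ 121 * 2 ^+ (5 * X)))) :> K.
  have -> : 8 ^+ d = (16 / 15) ^+ d * 2 ^+ d * (15 / 4) ^+ d :> K.
    by rewrite -!exprMn; congr (_ ^+ _); field.
  move: (2 ^+ X) (2 ^+ 121) (2 ^+ (5 * X)) (2 ^+ d) ((15 / 4) ^+ d) ((16 / 15) ^+ d).
  by move=> ? ? ? ? ? ?; ring.
apply: ler_wpM2l; first by rewrite mulr_ge0 ?exprn_ge0 ?ler0n.
apply: ler_pM => //; first by rewrite mulr_ge0 ?ler0n // addr_ge0 ?ler0n.
  apply: le_trans A _; apply: ler_wpM2l => //.
  by apply: mulr_ge0; [lra | apply: exprn_ge0; lra].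
apply: le_trans Y _; apply: ler_wpM2l; first by apply: exprn_ge0; lra.
rewrite rk; apply: ler_pM => //; first by apply: mulr_ge0.
by apply: ler_pM.
Qed.

(** If [M <= d], then [k <= 15 d], everything is below [60 * 2^(18 d)], and [M >= 2^10]. If [d < M],
    then [k <= 15 M] and [poly_bound] gives [2 (30 M)^d <= 2 M^(2 d)]. *)
Lemma budget_large d x M E i : (i < nscale F d)%N -> (0 < d)%N -> (1024 <= M)%N ->
  (x <= 2 * M + 3)%N ->
  (nsample F (kpar F d x) d E i)%:R <= 384 * 60 * q%:R ^+ 3 * M%:R ^+ (3 * d + 3 * q) :> K.
Proof.
move=> il d0 M1 xM; set k := kpar F d x; apply: le_trans (nsample_le K k E il) _.
have id := lt_nscale il; have q1 := card_field_gt1 F.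
have k15 : (k <= 4 * d + 11 * M)%N.
  by have := kpar_le F d x; rewrite -/k; lia.
have k0 : (0 < k)%N by rewrite /k /kpar; lia.
have M1r : 1 <= M%:R :> K by rewrite ler1n; lia.
have Mmono a b : (a <= b)%N -> M%:R ^+ a <= M%:R ^+ b :> K by apply: ler_weXn2l.
suff H : (d%:R + 2) * k%:R * (q%:R ^+ i * (nmono F k (d - i * q.-1))%:R)
    <= 60 * M%:R ^+ (3 * d + 3 * q) :> K.
  have -> : 384 * q%:R ^+ 3 * ((d%:R + 2) * k%:R) * (q%:R ^+ i * (nmono F k (d - i * q.-1))%:R)
    = 384 * q%:R ^+ 3 * ((d%:R + 2) * k%:R * (q%:R ^+ i * (nmono F k (d - i * q.-1))%:R)) :> K.
    by rewrite !mulrA.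
  have -> : 384 * 60 * q%:R ^+ 3 * M%:R ^+ (3 * d + 3 * q)
    = 384 * q%:R ^+ 3 * (60 * M%:R ^+ (3 * d + 3 * q)) :> K.
    by move: (_ ^+ (3 * d + 3 * q)) => u; ring.
  by apply: ler_wpM2l H; rewrite mulr_ge0 ?exprn_ge0 ?ler0n.
have y0 : 0 <= q%:R ^+ i * (nmono F k (d - i * q.-1))%:R :> K.
  by rewrite mulr_ge0 ?exprn_ge0 ?ler0n.
case: (leqP M d) => Md.
  have d2 : (d.+1 <= 2 ^ d)%N by apply: ltn_expl.
  have Y : q%:R ^+ i * (nmono F k (d - i * q.-1))%:R <= 2 ^+ (16 * d) :> K.
    apply: le_trans (linear_bound K k id) _; rewrite -exprD; apply: ler_weXn2l; first by lra.
    by move: k15 Md; clear; lia.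
  have P : (d%:R + 2) * k%:R <= 60 * 2 ^+ (2 * d) :> K.
    rewrite mulrC (mulnC 2) exprM -(natrD _ d 2) -!natrX -!natrM ler_nat -mulnn.
    apply: (@leq_trans (15 * d * (2 * d.+1))); first by apply: leq_mul; move: k15 Md; clear; lia.
    apply: (@leq_trans (15 * d.+1 * (4 * d.+1))); first by apply: leq_mul; clear; lia.
    apply: (@leq_trans (60 * (d.+1 * d.+1))); first by apply: eq_leq; ring.
    by rewrite leq_mul2l leq_mul.
  apply: (@le_trans _ _ (60 * 2 ^+ (2 * d) * 2 ^+ (16 * d))).
    by apply: ler_pM => //; rewrite mulr_ge0 ?ler0n // addr_ge0 ?ler0n.
  rewrite -mulrA -exprD; apply: ler_wpM2l; first by lra.
  apply: (@le_trans _ _ (M%:R ^+ (2 * d))); last by apply: Mmono; clear; lia.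
  rewrite -!natrX ler_nat.
  apply: (@leq_trans ((2 ^ 10) ^ (2 * d))).
    by rewrite -expnM leq_exp2l //; clear; lia.
  by rewrite leq_exp2r // muln_gt0 d0.
have kM : (k <= 15 * M)%N by move: k15 Md; clear; lia.
have Y : q%:R ^+ i * (nmono F k (d - i * q.-1))%:R <= 2 * M%:R ^+ (2 * d) :> K.
  apply: le_trans (poly_bound K id k0) _; apply: ler_wpM2l => //.
  rewrite exprM; apply: lerXn2r; rewrite ?nnegrE ?mulr_ge0 ?exprn_ge0 ?ler0n //.
  rewrite -natrX -(natrM _ 2) ler_nat -mulnn.
  apply: (@leq_trans (30 * M)); first by move: kM; clear; lia.
  by rewrite leq_mul2r; apply/orP; right; move: M1; clear; lia.
have P : (d%:R + 2) * k%:R <= 30 * M%:R ^+ 2 :> K.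
  rewrite -(natrD _ d 2) -!natrX -!natrM ler_nat -mulnn.
  apply: (@leq_trans (2 * M * (15 * M))); first by apply: leq_mul => //; move: Md M1; clear; lia.
  by apply: eq_leq; ring.
apply: (@le_trans _ _ (30 * M%:R ^+ 2 * (2 * M%:R ^+ (2 * d)))).
  by apply: ler_pM => //; rewrite mulr_ge0 ?ler0n // addr_ge0 ?ler0n.
have -> : 30 * M%:R ^+ 2 * (2 * M%:R ^+ (2 * d)) = 60 * M%:R ^+ (2 + 2 * d) :> K.
  by rewrite exprD; move: (_ ^+ (2 * d)) => u; ring.
by apply: ler_wpM2l => //; apply: Mmono; move: q1; move: #|F|; clear; lia.
Qed.

End BudgetOnline.

(** * Existence of testers, stated in natural numbers *)

Section Conclusion.

Definition has_tester (F : finFieldType) (n d m t Q : nat) : Prop :=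
  exists (S : finType) (query : S -> seq F -> 'rV[F]_n) (decide : S -> seq F -> bool),
  [/\ 0 < #|S|,
      forall f, deg_le d f -> forall adv, t_adversary t adv ->
        2 * #|S| <= 3 * #|[set x | accepts query decide Q adv f x]| &
      forall f, (forall g, deg_le d g -> #|F| ^ n <= m * ndiff f g) ->
        forall adv, t_adversary t adv ->
        3 * #|[set x | accepts query decide Q adv f x]| <= #|S|].

(** [C] is fixed before all parameters, which makes the final constants uniform in the field, [n],
    [d], [delta] and [t]. *)
Lemma leq_nat_bound (c : rat) : exists C : nat, forall a q e b f : nat,
  (a%:R <= c * q%:R ^+ e * b%:R ^+ f :> rat)%R -> a <= C * (q ^ e * b ^ f).
Proof.
exists (Num.bound `|c|%R) => a q e b f; rewrite -!natrX -mulrA -natrM => H.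
rewrite -(ler_nat rat) natrM.
apply: le_trans H _; apply: ler_wpM2r; first by rewrite ler0n.
by apply: le_trans (ler_norm c) _; apply/ltW/archi_boundP.
Qed.

Lemma leq_nat_boundM (c : rat) : exists C : nat, forall a m q e b f : nat,
  (a%:R <= c * m%:R * q%:R ^+ e * b%:R ^+ f :> rat)%R -> a <= C * (m * (q ^ e * b ^ f)).
Proof.
exists (Num.bound `|c|%R) => a m q e b f; rewrite -!natrX -!mulrA -!natrM => H.
rewrite -(ler_nat rat) natrM.
apply: le_trans H _; apply: ler_wpM2r; first by rewrite ler0n.
by apply: le_trans (ler_norm c) _; apply/ltW/archi_boundP.
Qed.

Lemma nsample_last_nat (F : finFieldType) k d m :
  nsample F k d (8 * m * #|F| ^ (nscale F d).+1) (nscale F d) <= 96 * m * #|F| ^ 2 * 2 ^ d.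
Proof.
have := nsample_last F rat k d m; set a := nsample _ _ _ _ _.
by rewrite -!natrX -!natrM ler_nat.
Qed.

Lemma budget_classical_nat : exists C, forall (F : finFieldType) d k m y E i,
  i < nscale F d -> k <= d + 18 + y -> #|F| ^ y <= #|F| * m ->
  nsample F k d E i <= C * (m * (#|F| ^ 4 * 8 ^ d)).
Proof.
have [C CE] := leq_nat_boundM (384 * 8 * 3 ^+ 18)%R; exists C => F d k m y E i il ky qy.
exact: CE (budget_classical rat E il ky qy).
Qed.

Lemma budget_small_nat X : exists C, forall (F : finFieldType) d x E i,
  i < nscale F d -> x <= X ->
  nsample F (kpar F d x) d E i <= C * (#|F| ^ 3 * 8 ^ d).
Proof.
have [C CE] := leq_nat_bound (384 * (128 * 64 * 2 ^+ X * 2 ^+ 121 * 2 ^+ (5 * X)))%R.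
exists C => F d x E i il xX; exact: CE (budget_small rat E il xX).
Qed.

Lemma budget_large_nat : exists C, forall (F : finFieldType) d x M E i,
  i < nscale F d -> 0 < d -> 1024 <= M -> x <= 2 * M + 3 ->
  nsample F (kpar F d x) d E i <= C * (#|F| ^ 3 * M ^ (3 * d + 3 * #|F|)).
Proof.
have [C CE] := leq_nat_bound (384 * 60)%R; exists C => F d x M E i il d0 M1 xM.
exact: CE (budget_large rat E il d0 M1 xM).
Qed.

Lemma max_nsample (F : finFieldType) k d E B :
  (forall i, i <= nscale F d -> nsample F k d E i <= B) ->
  exists2 Q, Q <= B & forall i, i <= nscale F d -> nsample F k d E i <= Q.
Proof.
move=> HB; exists (\max_(i < (nscale F d).+1) nsample F k d E i).
  by apply/bigmax_leqP => i _; apply: HB; rewrite -ltnS.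
move=> i; rewrite -ltnS => iL.
exact: (leq_bigmax (F := fun i : 'I_(nscale F d).+1 => nsample F k d E i) (Ordinal iL)).
Qed.

Lemma q_pow_nscale (F : finFieldType) d : #|F| ^ (nscale F d).+1 <= #|F| ^ d.+2.
Proof. by rewrite leq_exp2l ?card_field_gt1 // ltnS nscale_le. Qed.

(** The offset 18 is [16 + 2]: [90 * 257 <= 2^16], and [q^(nscale + 1) <= q^(d + 2)]. *)
Lemma chain_room (F : finFieldType) d m a k : m <= #|F| ^ a -> d + 18 + a <= k -> 0 < m ->
  90 * (#|F| ^ d + 32 * (8 * m * #|F| ^ (nscale F d).+1)) <= #|F| ^ k.
Proof.
move=> ma dk m0; have q1 := card_field_gt1 F.
have q0 := ltnW q1.
apply: (@leq_trans (90 * (257 * (m * #|F| ^ d.+2)))).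
  rewrite leq_mul2l /= (_ : 257 = 1 + 256) // mulnDl mul1n leq_add //.
    rewrite -[X in X <= _]mul1n; apply: leq_mul => //.
    by rewrite leq_exp2l // -addn2 leq_addr.
  apply: (@leq_trans (256 * (m * #|F| ^ (nscale F d).+1))); first by apply: eq_leq; ring.
  by rewrite leq_mul2l /= leq_mul2l q_pow_nscale orbT.
apply: (@leq_trans (#|F| ^ 16 * (#|F| ^ a * #|F| ^ d.+2))).
  rewrite mulnA; apply: leq_mul; last by rewrite leq_mul2r ma orbT.
  apply: (@leq_trans (2 ^ 16)); first by [].
  by rewrite leq_exp2r.
rewrite -!expnD leq_exp2l //; move: dk; clear; lia.
Qed.

Lemma scale_room (F : finFieldType) d m : 0 < m ->
  2 * m <= 8 * m * #|F| ^ (nscale F d).+1 /\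
  4 * #|F| ^ (nscale F d).+1 <= 8 * m * #|F| ^ (nscale F d).+1.
Proof.
move=> m0; have q0 : 0 < #|F| ^ (nscale F d).+1 by rewrite expn_gt0 (ltnW (card_field_gt1 F)).
split; last by rewrite leq_mul2r; apply/orP; right; move: m0; clear; lia.
by apply: (@leq_trans (8 * m * 1)); [clear; lia | rewrite leq_mul2l q0 orbT].
Qed.

Lemma last_room (F : finFieldType) d m M : 1 < M ->
  96 * m * #|F| ^ 2 * 2 ^ d <= 96 * (m * (#|F| ^ 4 * M ^ (3 * d + 3 * #|F|))).
Proof.
move=> M1; have q0 := ltnW (card_field_gt1 F).
rewrite -(mulnA (96 * m)) -(mulnA 96 m) leq_mul2l /= leq_mul2l; apply/orP; right.
apply: leq_mul; first by rewrite leq_pexp2l.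
apply: (@leq_trans (M ^ d)); first by case: d => // d; rewrite leq_exp2r.
by rewrite leq_pexp2l ?(ltnW M1) //; clear; lia.
Qed.

(** Nothing is assumed on the size of [n]: when [n <= d + 18 + y] the test runs on the whole space
    with an empty chain. *)
Lemma tester_classical : exists C, forall (F : finFieldType) n d m,
  0 < n -> 0 < m ->
  exists2 Q, Q <= C * (m * (#|F| ^ 4 * 2 ^ (3 * d + 3 * #|F|))) & has_tester F n d m 0 Q.
Proof.
have [C CE] := budget_classical_nat; exists (C + 96) => F n d m n0 m0.
have q1 := card_field_gt1 F.
pose y := up_log #|F| m.
have my : m <= #|F| ^ y by apply: up_logP.
have ym : #|F| ^ y <= #|F| * m.
  case: (ltnP 1 m) => m1; last first.
    have -> : m = 1 by apply/eqP; rewrite eqn_leq m1.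
    by rewrite /y (_ : m = 1) ?up_log1 ?muln1 ?(ltnW q1) //; apply/eqP; rewrite eqn_leq m1.
  have y0 : 0 < y by rewrite up_log_gt0 q1.
  by rewrite -(prednK y0) expnS leq_mul2l (ltnW (up_log_gtn q1 m1)) orbT.
pose k := minn (d + 18 + y) n.
have k0 : 0 < k by rewrite leq_min n0 andbT addn_gt0 addn_gt0 /= orbT.
have kn : k <= n by apply: geq_minr.
have ky : k <= d + 18 + y by apply: geq_minl.
set E := 8 * m * #|F| ^ (nscale F d).+1.
have [mE EL] := scale_room F d m0.
have [|Q QB sQ] := @max_nsample F k d E ((C + 96) * (m * (#|F| ^ 4 * 2 ^ (3 * d + 3 * #|F|)))).
  move=> i; rewrite leq_eqVlt => /orP[/eqP ->|il]; rewrite mulnDl.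
    by apply: leq_trans (nsample_last_nat F k d m) (leq_trans (last_room F d m _) (leq_addl _ _)).
  apply: leq_trans (CE F d k m y E i il ky ym) (leq_trans _ (leq_addr _ _)).
  rewrite leq_mul2l; apply/orP; right; rewrite leq_mul2l; apply/orP; right.
  rewrite leq_mul2l; apply/orP; right.
  by rewrite expnD (expnM 2 3) leq_pmulr // expn_gt0.
exists Q => //; rewrite /has_tester -(subnK kn); apply: (tester k0 m0 mE EL) => //; last first.
  by move=> i iL; rewrite muln0 mul0n.
case: (leqP n (d + 18 + y)) => nk.
  by left; rewrite /k (minn_idPr nk) subnn.
right; apply: (chain_room my) => //.
by rewrite /k (minn_idPl (ltnW nk)).
Qed.

(** [M] stands for the logarithm: 2 while [x] is bounded, and a true fraction of [x] afterwards. *)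
Lemma tester_online X : exists C, forall (F : finFieldType) n d m t x M,
  0 < d -> 0 < m -> 0 < t -> t * m <= #|F| ^ x -> kpar F d x <= n ->
  (x <= X /\ M = 2) \/ (1024 <= M /\ x <= 2 * M + 3) ->
  exists2 Q, Q <= C * (m * (#|F| ^ 4 * M ^ (3 * d + 3 * #|F|))) & has_tester F n d m t Q.
Proof.
have [C1 CE1] := budget_small_nat X; have [C2 CE2] := budget_large_nat.
exists (C1 + C2 + 96) => F n d m t x M d0 m0 t0 tmx kn HM.
have q1 := card_field_gt1 F; have q0 := ltnW q1.
have M1 : 1 < M by case: HM => [[_ ->]//|[]]; clear; lia.
set k := kpar F d x in kn *.
have k0 : 0 < k by rewrite /k /kpar; clear; lia.
set E := 8 * m * #|F| ^ (nscale F d).+1.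
have [mE EL] := scale_room F d m0.
have mx : m <= #|F| ^ x by apply: leq_trans tmx; rewrite leq_pmull.
have tmx2 : t * m ^ 2 <= #|F| ^ (2 * x).
  rewrite mulnC [2 * x]mulnC expnM; apply: (@leq_trans ((t * m) ^ 2)); last by rewrite leq_exp2r.
  by rewrite expnMn mulnC leq_mul2r -mulnn leq_pmulr // orbT.
have [|Q QB sQ] := @max_nsample F k d E ((C1 + C2 + 96) * (m * (#|F| ^ 4 * M ^ (3 * d + 3 * #|F|)))).
  move=> i; rewrite leq_eqVlt => /orP[/eqP ->|il]; rewrite !mulnDl.
    by apply: leq_trans (nsample_last_nat F k d m) (leq_trans (last_room F d m M1) (leq_addl _ _)).
  apply: leq_trans (leq_addr _ _).
  have q34 : #|F| ^ 3 <= m * #|F| ^ 4.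
    by apply: (@leq_trans (1 * #|F| ^ 4)); [rewrite mul1n leq_pexp2l | rewrite leq_mul2r m0 orbT].
  case: HM => [[xX M2]|[ML xM]].
    apply: leq_trans (CE1 F d x E i il xX) (leq_trans _ (leq_addr _ _)).
    rewrite leq_mul2l; apply/orP; right; rewrite mulnA; apply: leq_mul => //.
    by rewrite M2 expnD (expnM 2 3) leq_pmulr // expn_gt0.
  apply: leq_trans (CE2 F d x M E i il d0 ML xM) (leq_trans _ (leq_addl _ _)).
  by rewrite leq_mul2l; apply/orP; right; rewrite mulnA; apply: leq_mul.
exists Q => //; rewrite /has_tester -(subnK kn); apply: (tester k0 m0 mE EL) => //.
  right; apply: (chain_room mx) => //.
  by rewrite /k /kpar; have := kbase_ge F d; clear; lia.
move=> i iL; have := room_nsample rat m0 tmx2 iL; rewrite -/k -/E.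
by move: (nsample _ _ _ _ _) (allow _ _ _ _) => a b; rewrite -!natrX -!natrM ler_nat.
Qed.

End Conclusion.

(** * Translation between the real hypotheses and natural numbers *)

Section RealBounds.
Local Open Scope R_scope.

Lemma INR_muln a b : INR (a * b)%N = INR a * INR b.
Proof. by rewrite -multE mult_INR. Qed.

Lemma INR_expn a b : INR (a ^ b)%N = INR a ^ b.
Proof. by elim: b => [|b IH] //=; rewrite expnS INR_muln IH. Qed.

Lemma leq_INR a b : (a <= b)%N -> INR a <= INR b.
Proof. by move/ssrnat.leP; apply: le_INR. Qed.

Lemma ltn_INR a b : (a < b)%N -> INR a < INR b.
Proof. by move/ssrnat.ltP; apply: lt_INR. Qed.

Lemma nat_inv delta : 0 < delta <= 1 ->
  exists m, (0 < m)%N /\ 1 <= delta * INR m <= 2.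
Proof.
move=> [d0 d1]; have [u1 u2] := archimed (/ delta).
have i1 : 1 <= / delta by rewrite -Rinv_1; apply: Rinv_le_contravar.
have dd : delta * / delta = 1 by apply: Rinv_r; Lra.lra.
have z0 : Z.le Z0 (up (/ delta)) by apply: le_IZR; Lra.lra.
exists (Z.to_nat (up (/ delta))).
have E : INR (Z.to_nat (up (/ delta))) = IZR (up (/ delta)) by rewrite INR_IZR_INZ Znat.Z2Nat.id.
split; first by apply/ssrnat.ltP; apply: INR_lt; rewrite E /=; Lra.lra.
by rewrite E; split; Lra.nra.
Qed.

Lemma query_bound (C m q e Q M : nat) (delta L : R) :
  0 < delta -> delta * INR m <= 2 -> INR M <= L ->
  (Q <= C * (m * (q ^ 4 * M ^ e)))%N -> (0 < q)%N ->
  INR Q <= (2 * INR C + 1) * Rpower (INR q) (INR 4) / delta * L ^ e.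
Proof.
move=> d0 dm ML QB q0.
have {}QB : INR Q <= INR C * (INR m * (INR q ^ 4 * INR M ^ e)).
  by rewrite -!INR_expn -!INR_muln; apply: leq_INR.
have q0r : 0 < INR q by apply: (ltn_INR q0).
rewrite Rpower_pow // /Rdiv; apply: Rle_trans QB _.
have C0 := pos_INR C; have M0 := pos_INR M; have m0 := pos_INR m.
have p0 : 0 < INR q ^ 4 by apply: pow_lt.
have Me : 0 <= INR M ^ e <= L ^ e by split; [apply: pow_le | apply: pow_incr].
have mi : INR m <= 2 * / delta.
  apply: (Rmult_le_reg_l delta) => //.
  have -> : delta * (2 * / delta) = 2 by rewrite -Rmult_assoc Rinv_r_simpl_m; Lra.lra.
  done.
have i0 : 0 < / delta by apply: Rinv_0_lt_compat.
move: (INR C) (INR m) (INR q ^ 4) (INR M ^ e) (L ^ e) (/ delta) C0 m0 p0 Me mi i0 => c m' p a b i c0 m0 p0 [a0 ab] mi i0.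
have h1 : m' * (p * a) <= 2 * i * (p * b).
  by apply: Rmult_le_compat => //; Lra.nra.
have h2 : 0 <= i * (p * b) by apply: Rmult_le_pos; Lra.nra.
have h3 := Rmult_le_compat_l _ _ _ c0 h1.
by Lra.lra.
Qed.

(** If the exponent [e] were below [maxn 1 x], then [q^(e-1)] would be at most [q^(x-1) < tm], or at
    most [1 <= tm] when [x = 0]; the factor 1/50 excludes both. *)
Lemma room_log (q d n x tm : nat) :
  (1 < q)%N -> (0 < d)%N -> (0 < tm)%N -> (x = 0%N \/ (q ^ x.-1 < tm)%N) ->
  INR tm <= / 50 * Rpower (INR q) (INR n / (100 * (INR d + INR q)) - 1) ->
  (100 * (d + q) * maxn 1 x <= n)%N.
Proof.
move=> q1 d0 tm0 hx; set e := INR n / _ => H.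
have q1r : 1 < INR q by apply: (ltn_INR q1).
have d0r : 0 < INR d by apply: (ltn_INR d0).
have tm1 : 1 <= INR tm by apply: (leq_INR tm0).
have key : INR (maxn 1 x) <= e.
  apply: Rnot_lt_le => lt.
  have H2 : Rpower (INR q) (e - 1) <= Rpower (INR q) (INR (maxn 1 x) - 1).
    by apply: Rle_Rpower; Lra.lra.
  case: x hx lt H2 => [|x] hx lt H2.
    rewrite (_ : INR (maxn 1 0) - 1 = 0) in H2; last by rewrite /=; Lra.lra.
    by rewrite Rpower_O in H2; Lra.lra.
  rewrite (maxn_idPr _) // in H2.
  rewrite (_ : INR x.+1 - 1 = INR x) in H2; last by rewrite S_INR; Lra.lra.
  rewrite Rpower_pow in H2; last by Lra.lra.
  case: hx => // /ltn_INR; rewrite INR_expn /= => hx.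
  have : 0 < INR q ^ x by apply: pow_lt; Lra.lra.
  Lra.lra.
have D0 : 0 < 100 * (INR d + INR q) by Lra.lra.
apply/ssrnat.leP; apply: INR_le; rewrite INR_muln INR_muln plus_INR (_ : INR 100 = 100); last by rewrite INR_IZR_INZ.
apply: (Rmult_le_reg_r (/ (100 * (INR d + INR q)))); first exact: Rinv_0_lt_compat.
rewrite -/(Rdiv (INR n) _) -/e; apply: Rle_trans key.
by right; rewrite Rinv_r_simpl_m; Lra.lra.
Qed.

(** From [q^(x-1) < t m <= 2 t / delta] and [q >= 2] one gets [2^(x-2) <= t / delta], and
    [ln 2 > 1/2]. *)
Lemma log_ge (q x t m : nat) (delta : R) : (1 < q)%N -> (2 <= x)%N -> (0 < t)%N ->
  0 < delta -> delta * INR m <= 2 -> (q ^ x.-1 < t * m)%N ->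
  INR ((x - 2) %/ 2) <= ln (INR t / delta).
Proof.
move=> q1 x2 t0 d0 dm /ltn_INR; rewrite INR_expn INR_muln => H.
have q2 : 2 <= INR q by apply: (leq_INR q1).
have t0r : 0 < INR t by apply: (ltn_INR t0).
have p1 : 2 ^ x.-1 <= INR q ^ x.-1 by apply: pow_incr; Lra.lra.
have xE : x.-1 = (x - 2).+1 by lia.
rewrite xE -[2 ^ _]/(2 * 2 ^ (x - 2)) in p1.
have td : 2 ^ (x - 2) <= INR t / delta.
  apply: (Rmult_le_reg_r delta) => //.
  rewrite /Rdiv Rmult_assoc Rinv_l; last by Lra.lra.
  rewrite xE in H.
  have H3 : 2 * 2 ^ (x - 2) * delta <= INR t * INR m * delta by apply: Rmult_le_compat_r; Lra.lra.
  have H4 : INR t * (delta * INR m) <= INR t * 2 by apply: Rmult_le_compat_l; Lra.lra.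
  by Lra.lra.
have p0 : 0 < 2 ^ (x - 2) by apply: pow_lt; Lra.lra.
have : ln (2 ^ (x - 2)) <= ln (INR t / delta).
  by case: td => [lt|<-]; [left; apply: ln_increasing | right].
rewrite ln_pow; last by Lra.lra.
have l2 := ln_lt_2.
have hx : INR ((x - 2) %/ 2) * 2 <= INR (x - 2).
  have := leq_INR (leq_trunc_div (x - 2) 2); rewrite INR_muln /=; Lra.lra.
have := pos_INR (x - 2); Lra.nra.
Qed.

End RealBounds.

Theorem theorem5p2 :
  exists c1 c2 : R, (0 < c1)%Re /\ (0 < c2)%Re /\
  forall (F : finFieldType) (n d : nat) (delta : R) (t : nat),
    0 < n -> 0 < d ->
    (0 < delta <= 1)%Re ->
    (INR t <= delta / 100 *
       Rpower (INR #|F|) (INR n / (100 * (INR d + INR #|F|)) - 1))%Re ->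
    exists (S : finType) (query : S -> seq F -> 'rV[F]_n)
           (decide : S -> seq F -> bool) (Q : nat),
      0 < #|S| /\
      (INR Q <= c2 * Rpower (INR #|F|) c1 / delta *
                  (Rmax 2 (ln (INR t / delta))) ^ (3 * d + 3 * #|F|))%Re /\
      (forall f : 'rV[F]_n -> F, deg_le d f ->
         forall adv, t_adversary t adv ->
           (2 / 3 <= acc_prob query decide Q adv f)%Re) /\
      (forall f : 'rV[F]_n -> F, far delta d f ->
         forall adv, t_adversary t adv ->
           (acc_prob query decide Q adv f <= 1 / 3)%Re).
Proof.
(* 2100 is large enough that [x > 2100] yields [(x - 2) / 2 >= 1024], as [tester_online]
   requires. *)
have [Cc HCc] := tester_classical; have [Co HCo] := tester_online 2100.
exists (INR 4), (2 * INR (Cc + Co) + 1)%Re.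
split; first by rewrite /=; Lra.lra.
split; first by have := pos_INR (Cc + Co); Lra.lra.
move=> F n d delta t n0 d0 del tle; have [del0 del1] := del.
have [m [m0 [m1 m2]]] := nat_inv del.
have q1 := card_field_gt1 F.
suff [Q [M [ML QB [S [query [decide [S0 comp sound]]]]]]] : exists Q M,
    [/\ (INR M <= Rmax 2 (ln (INR t / delta)))%Re,
        Q <= (Cc + Co) * (m * (#|F| ^ 4 * M ^ (3 * d + 3 * #|F|))) & has_tester F n d m t Q].
  exists S, query, decide, Q; split=> //; split.
    exact: (query_bound del0 m2 ML QB (ltnW q1)).
  have S0r : (0 < INR #|S|)%Re := ltn_INR S0.
  split=> [f fd adv tadv|f ffar adv tadv]; rewrite /acc_prob.
    have := leq_INR (comp f fd adv tadv); rewrite !INR_muln => H.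
    apply: (Rmult_le_reg_r (INR #|S|)) => //; rewrite /Rdiv [X in (_ <= X)%Re]Rmult_assoc Rinv_l; last by Lra.lra.
    by move: H; rewrite [INR 2]/= [INR 3]/=; Lra.lra.
  have fm g : deg_le d g -> #|F| ^ n <= m * ndiff f g.
    move=> gd; apply/ssrnat.leP; apply: INR_le; rewrite INR_muln.
    have := ffar g gd; have := pos_INR (#|F| ^ n); have := pos_INR (ndiff f g).
    have := pos_INR m; move: (INR (#|F| ^ n)) (INR (ndiff f g)) (INR m) m1 => a b c; clear -del0.
    move=> h1 h2 h3 h4 h5.
    apply: (Rmult_le_reg_l delta) => //.
    have h6 : (delta * a <= b * 1)%Re by Lra.lra.
    have h7 : (b * 1 <= b * (delta * c))%Re by apply: Rmult_le_compat_l.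
    by Lra.lra.
  have := leq_INR (sound f fm adv tadv); rewrite !INR_muln => H.
  apply: (Rmult_le_reg_r (INR #|S|)) => //; rewrite /Rdiv [X in (X <= _)%Re]Rmult_assoc Rinv_l; last by Lra.lra.
  by move: H; rewrite [INR 3]/=; Lra.lra.
(* For [t = 0] the hypothesis on [t] holds for every [n], so the room for [kpar] cannot be derived
   from it. *)
case: (posnP t) => [t0|t0].
  have [Q QB QT] := HCc F n d m n0 m0; exists Q, 2; split.
  - by apply: Rle_trans (Rmax_l _ _); rewrite /=; Lra.lra.
  - by apply: leq_trans QB _; rewrite leq_mul2r leq_addr orbT.
  by rewrite t0.
pose x := up_log #|F| (t * m).
have tmx : t * m <= #|F| ^ x by apply: up_logP.
have tm0 : 0 < t * m by rewrite muln_gt0 t0.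
have hx : x = 0 \/ #|F| ^ x.-1 < t * m.
  case: (ltnP 1 (t * m)) => tm1; first by right; apply: up_log_gtn.
  by left; apply/eqP; rewrite up_log_eq0 tm1 orbT.
have room : 100 * (d + #|F|) * maxn 1 x <= n.
  apply: (room_log q1 d0 tm0 hx); rewrite INR_muln.
  set P := Rpower _ _ in tle *; have P0 : (0 < P)%Re by apply: exp_pos.
  have h1 : (INR t * INR m <= delta / 100 * P * INR m)%Re.
    by apply: Rmult_le_compat_r tle; apply: pos_INR.
  have h2 : (delta * INR m * P <= 2 * P)%Re by apply: Rmult_le_compat_r; Lra.lra.
  by Lra.lra.
have kn : kpar F d x <= n.
  apply: leq_trans room; have := kpar_le F d x; move: q1.
  move: #|F| (kpar F d x) => q k q1 H; case: (posnP x) => x0.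
    by rewrite x0 maxn0; move: H; rewrite x0; move: d0 q1; clear; lia.
  rewrite (maxn_idPr x0).
  have : (d + q) * 1 <= (d + q) * x by rewrite leq_mul2l x0 orbT.
  have : (1 + 2) * x <= (d + q) * x by rewrite leq_mul2r leq_add ?orbT.
  move: ((d + q) * x) (mulnA 100 (d + q) x) => y <-.
  by move: H d0 q1; clear; lia.
case: (leqP x 2100) => x2.
  have [|Q QB QT] := HCo F n d m t x 2 d0 m0 t0 tmx kn; first by left.
  exists Q, 2; split=> //.
  - by apply: Rle_trans (Rmax_l _ _); rewrite /=; Lra.lra.
  - by apply: leq_trans QB _; rewrite leq_mul2r leq_addl orbT.
have x3 : 2 <= x by move: x2; clear; lia.
have [|Q QB QT] := HCo F n d m t x ((x - 2) %/ 2) d0 m0 t0 tmx kn.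
  by right; split; move: x2; clear; lia.
exists Q, ((x - 2) %/ 2); split=> //.
- apply: Rle_trans (Rmax_r _ _); apply: (log_ge q1 x3 t0 del0 m2).
  by case: hx => // x0; move: x3; rewrite x0.
- by apply: leq_trans QB _; rewrite leq_mul2r leq_addl orbT.
Qed.
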